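(* Let $(R,\mathfrak m)$ be a Gorenstein local ring and let $x_1,\dots,x_n$ be a regular sequence on $R$. Set $Q=(x_1,\dots,x_n)$. Then the following conditions are equivalent: (1) $R$ satisfies (SAC). (2) $R/Q$ satisfies (SAC). (3) $R/Q^\ell$ satisfies (SAC) for some integer $\ell>0$. (4) $R/Q^\ell$ satisfies (SAC) for all integers $1\le \ell\le n$.
   Context: All rings are commutative Noetherian with identity. A regular sequence on a local ring $(R,\mathfrak m)$ consists of elements of $\mathfrak m$, with $n\geq 1$. A ring $R$ satisfies (SAC) if for each finitely generated $R$-module $M$: whenever $\mathrm{Ext}_R^i(M,R)=0$ for all $i>0$ and $\mathrm{Ext}_R^i(M,M)=0$ for all sufficiently large $i$, one has $\mathrm{Ext}_R^i(M,M)=0$ for all $i>0$. *)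

(* Defs.v *)
From HB Require Import structures.
From mathcomp Require Import all_boot all_algebra ring_quotient.
From mathcomp Require Import boolp.
From mathcomp Require Import freeg.

Set Implicit Arguments.
Unset Strict Implicit.
Unset Printing Implicit Defensive.

Import GRing.Theory.
Local Open Scope ring_scope.
Local Open Scope quotient_scope.

(** The library's [idealr] contains proper ideals only; here the unit
    ideal is allowed, so that products, powers and quotients are total.  Since
    [`[< P >]] is the classical boolean of [P], membership predicates in [bool]
    are arbitrary subsets. *)

HB.mixin Record isIdeal (R : comPzRingType) (S : R -> bool) := {
  ideal_mull : forall a, {in S, forall u, a * u \in S}
}.

#[short(type="idealType")]
HB.structure Definition Ideal (R : comPzRingType) :=
  {S of GRing.ZmodClosed R S & isIdeal R S}.

Section Ideals.
Variable R : comPzRingType.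
Implicit Types (I J : idealType R) (s : seq R).

Definition ideal_gen s : {pred R} :=
  fun a => `[< exists c : 'I_(size s) -> R, a = \sum_i c i * s`_i >].

Lemma ideal_gen_zmod_closed s : zmod_closed (ideal_gen s).
Proof.
split=> [|a b].
  by apply/asboolP; exists (fun=> 0); rewrite big1 // => i _; rewrite mul0r.
move=> /asboolP[c ->] /asboolP[d ->]; apply/asboolP.
exists (fun i => c i - d i); rewrite -sumrB.
by apply: eq_bigr => i _; rewrite mulrBl.
Qed.

Lemma ideal_gen_mull s a : {in ideal_gen s, forall u, a * u \in ideal_gen s}.
Proof.
move=> u /asboolP[c ->]; apply/asboolP; exists (fun i => a * c i).
by rewrite mulr_sumr; apply: eq_bigr => i _; rewrite mulrA.
Qed.

HB.instance Definition _ s :=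
  GRing.isZmodClosed.Build R (ideal_gen s) (ideal_gen_zmod_closed s).
HB.instance Definition _ s := isIdeal.Build R (ideal_gen s) (@ideal_gen_mull s).

Definition ideal_mul I J : {pred R} := fun a =>
  `[< exists2 t : seq (R * R), {in t, forall p, p.1 \in I /\ p.2 \in J}
                             & a = \sum_(p <- t) p.1 * p.2 >].

Lemma ideal_mul_zmod_closed I J : zmod_closed (ideal_mul I J).
Proof.
split=> [|a b].
  by apply/asboolP; exists [::]; rewrite ?big_nil.
move=> /asboolP[s sP ->] /asboolP[t tP ->]; apply/asboolP.
exists (s ++ [seq (- p.1, p.2) | p <- t]) => [p|].
  rewrite mem_cat => /orP[/sP //|/mapP[q /tP[q1 q2] ->]] /=.
  by rewrite rpredN.
rewrite big_cat big_map /= -sumrN; congr (_ + _).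
by apply: eq_bigr => p _; rewrite mulNr.
Qed.

Lemma ideal_mul_mull I J a :
  {in ideal_mul I J, forall u, a * u \in ideal_mul I J}.
Proof.
move=> u /asboolP[t tP ->]; apply/asboolP.
exists [seq (a * p.1, p.2) | p <- t] => [p /mapP[q /tP[q1 q2] ->]|] /=.
  by split=> //; apply: ideal_mull.
by rewrite big_map mulr_sumr; apply: eq_bigr => p _; rewrite mulrA.
Qed.

HB.instance Definition _ I J :=
  GRing.isZmodClosed.Build R (ideal_mul I J) (ideal_mul_zmod_closed I J).
HB.instance Definition _ I J :=
  isIdeal.Build R (ideal_mul I J) (@ideal_mul_mull I J).

Definition ideal_full : {pred R} := fun=> true.

Lemma ideal_full_zmod_closed : zmod_closed ideal_full.
Proof. by []. Qed.

Lemma ideal_full_mull a : {in ideal_full, forall u, a * u \in ideal_full}.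
Proof. by []. Qed.

HB.instance Definition _ :=
  GRing.isZmodClosed.Build R ideal_full ideal_full_zmod_closed.
HB.instance Definition _ := isIdeal.Build R ideal_full ideal_full_mull.

Fixpoint ideal_exp I n : idealType R :=
  if n is k.+1 then ideal_mul I (ideal_exp I k) else ideal_full.

Definition maximal_ideal I : Prop :=
  1 \notin I /\ forall J, {subset I <= J} -> 1 \in J \/ J =i I.

End Ideals.

Definition noetherian (R : comPzRingType) : Prop :=
  forall I : idealType R, exists s : seq R, I =i ideal_gen s.

Definition is_local (R : comPzRingType) (m : idealType R) : Prop :=
  maximal_ideal m /\ forall J : idealType R, maximal_ideal J -> J =i m.

Section IdealQuotient.
Variables (R : comPzRingType) (I : idealType R).

Definition ideal_quotient : Type := @Quotient.quot R I.
Local Notation Q := ideal_quotient.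

HB.instance Definition _ := Choice.on Q.
HB.instance Definition _ := GRing.Zmodule.on Q.
HB.instance Definition _ : EqQuotient R (Quotient.equiv I) Q :=
  EqQuotient.on Q.
HB.instance Definition _ :
  isZmodQuotient R (Quotient.equiv I) 0 -%R +%R Q :=
  ZmodQuotient.on Q.

Definition iq_one : Q := \pi_Q 1.
Definition iq_mul (a b : Q) : Q := \pi_Q (repr a * repr b).

Lemma iq_eqP (x y : R) : reflect (\pi_Q x = \pi_Q y) (x - y \in I).
Proof. rewrite (@Quotient.idealrBE R I); exact: eqP. Qed.

Lemma iq_piM (x y : R) : iq_mul (\pi_Q x) (\pi_Q y) = \pi_Q (x * y).
Proof.
apply/esym; apply/iq_eqP; set x' := repr _; set y' := repr _.
have Ix : x - x' \in I by apply/iq_eqP; rewrite reprK.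
have Iy : y - y' \in I by apply/iq_eqP; rewrite reprK.
have -> : x * y - x' * y' = y * (x - x') + x' * (y - y').
  by rewrite !mulrBr (mulrC y x) (mulrC y x') addrA subrK.
by apply: rpredD; apply: ideal_mull.
Qed.

Lemma iq_mulA : associative iq_mul.
Proof.
move=> a b c; rewrite -[a]reprK -[b]reprK -[c]reprK.
rewrite (iq_piM (repr b)) (iq_piM (repr a)) (iq_piM (repr a)) iq_piM.
by rewrite mulrA.
Qed.

Lemma iq_mulC : commutative iq_mul.
Proof. by move=> a b; rewrite /iq_mul mulrC. Qed.

Lemma iq_mul1 : left_id iq_one iq_mul.
Proof. by move=> a; rewrite -[a]reprK (iq_piM 1) mul1r. Qed.

Lemma iq_mulDl : left_distributive iq_mul +%R.
Proof.
move=> a b c; rewrite -[a]reprK -[b]reprK -[c]reprK.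
rewrite -raddfD (iq_piM (repr a + repr b)) (iq_piM (repr a)) (iq_piM (repr b)).
by rewrite -raddfD mulrDl.
Qed.

HB.instance Definition _ :=
  GRing.Zmodule_isComPzRing.Build Q iq_mulA iq_mulC iq_mul1 iq_mulDl.

Definition quotient_map (x : R) : Q := \pi_Q x.

Lemma quotient_map_zmod : zmod_morphism quotient_map.
Proof. exact: raddfB. Qed.

Lemma quotient_map_monoid : monoid_morphism quotient_map.
Proof. by split=> // x y; apply/esym/iq_piM. Qed.

HB.instance Definition _ :=
  GRing.isZmodMorphism.Build R Q quotient_map quotient_map_zmod.
HB.instance Definition _ :=
  GRing.isMonoidMorphism.Build R Q quotient_map quotient_map_monoid.

Lemma quotient_map_surj (q : Q) : exists x, quotient_map x = q.
Proof. by exists (repr q); apply: reprK. Qed.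

Lemma quotient_map_eq0 (x : R) : quotient_map x = 0 <-> x \in I.
Proof.
rewrite -[0](raddf0 quotient_map) -{2}[x]subr0.
exact: rwP (iq_eqP x 0).
Qed.

End IdealQuotient.

(** [x_1, ..., x_n] in [m], with each [x_(i+1)] a nonzerodivisor on the ring
    [R / (x_1, ..., x_i)]; it is enough to ask for elements of [m], as then
    [R / (x_1, ..., x_n)] is automatically nonzero. *)
Definition regular_sequence (R : comPzRingType) (m : idealType R)
    (n : nat) (x : n.-tuple R) : Prop :=
  {in x, forall y, y \in m} /\
  forall i, (i < n)%N -> GRing.lreg (quotient_map (ideal_gen (take i x)) x`_i).

Section Modules.
Variable R : comPzRingType.
Implicit Types M N : lmodType R.

Definition fin_gen M : Prop :=
  exists s : seq M, forall y : M, exists c : 'I_(size s) -> R,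
    y = \sum_i c i *: s`_i.

Definition surjective (U V : Type) (f : U -> V) : Prop :=
  forall y, exists x, f x = y.

Definition exact_at (U V W : lmodType R) (f : U -> V) (g : V -> W) : Prop :=
  forall y, g y = 0 <-> exists x, f x = y.

Definition projective (P : lmodType R) : Prop :=
  forall (A B : lmodType R) (p : {linear A -> B}) (f : {linear P -> B}),
    surjective p -> exists g : {linear P -> A}, forall x, p (g x) = f x.

Definition injective_module (E : lmodType R) : Prop :=
  forall (A B : lmodType R) (j : {linear A -> B}) (f : {linear A -> E}),
    injective j -> exists g : {linear B -> E}, forall x, g (j x) = f x.

Record proj_resolution M := ProjResolution {
  pr_term :> nat -> lmodType R;
  pr_diff : forall n, {linear pr_term n.+1 -> pr_term n};
  pr_aug : {linear pr_term 0 -> M};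
  pr_projective : forall n, projective (pr_term n);
  pr_aug_surj : surjective pr_aug;
  pr_exact0 : exact_at (pr_diff 0) pr_aug;
  pr_exact : forall n, exact_at (pr_diff n.+1) (pr_diff n)
}.

Record inj_resolution M := InjResolution {
  ir_term :> nat -> lmodType R;
  ir_diff : forall n, {linear ir_term n -> ir_term n.+1};
  ir_aug : {linear M -> ir_term 0};
  ir_injective : forall n, injective_module (ir_term n);
  ir_aug_inj : injective ir_aug;
  ir_exact0 : exact_at ir_aug (ir_diff 0);
  ir_exact : forall n, exact_at (ir_diff n) (ir_diff n.+1)
}.

Definition finite_inj_dim M : Prop :=
  exists (E : inj_resolution M) (d : nat),
    forall n, (d < n)%N -> forall y : E n, y = 0.

Definition cocycle M N (P : proj_resolution M) i (f : {linear P i -> N}) : Prop :=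
  forall y, f (pr_diff P i y) = 0.

Definition coboundary M N (P : proj_resolution M) i : {linear P i -> N} -> Prop :=
  match i with
  | 0 => fun f => forall y, f y = 0
  | k.+1 => fun f =>
      exists g : {linear P k -> N}, forall y, f y = g (pr_diff P k y)
  end.

(** [Ext^i(M, N) = 0]: the [i]-th cohomology of [Hom(P, N)] vanishes for the
    projective resolutions [P] of [M].  This does not depend on [P], and
    projective resolutions exist, see [proj_resolution_exists] (for [R <> 0];
    over the zero ring every module is zero, hence projective). *)
Definition Ext_vanishes i M N : Prop :=
  forall (P : proj_resolution M) (f : {linear P i -> N}),
    cocycle f -> coboundary f.

End Modules.

Definition gorenstein_local (R : comPzRingType) (m : idealType R) : Prop :=
  [/\ noetherian R, is_local m & finite_inj_dim R^o].

Definition SAC (R : comPzRingType) : Prop :=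
  forall M : lmodType R, fin_gen M ->
    (forall i, (0 < i)%N -> Ext_vanishes i M R^o) ->
    (exists N, forall i, (N <= i)%N -> Ext_vanishes i M M) ->
    forall i, (0 < i)%N -> Ext_vanishes i M M.

Section Kernel.
Variables (R : pzRingType) (U V : lmodType R) (f : {linear U -> V}).

Definition lker_pred : {pred U} := fun x => f x == 0.

Lemma lker_pred_closed : subsemimod_closed lker_pred.
Proof.
split; first split.
- by rewrite unfold_in linear0.
- by move=> x y; rewrite !unfold_in => /eqP fx /eqP fy; rewrite linearD fx fy addr0.
- by move=> a x; rewrite !unfold_in => /eqP fx; rewrite linearZ_LR fx scaler0.
Qed.

HB.instance Definition _ :=
  GRing.isSubmodClosed.Build R U lker_pred lker_pred_closed.

Definition lkernel := {x : U | lker_pred x}.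
HB.instance Definition _ := [isSub of lkernel for @sval _ _].
HB.instance Definition _ := [Choice of lkernel by <:].
HB.instance Definition _ := [SubChoice_isSubLmodule of lkernel by <:].

End Kernel.

Section FreeResolution.
Variable R : comNzRingType.

Section FreeModule.
Variables (K : choiceType) (M : lmodType R) (h : K -> M).

Definition free_map (D : {freeg K / R}) : M := fglift h D.

HB.instance Definition _ :=
  GRing.isZmodMorphism.Build {freeg K / R} M free_map
    (@lift_is_additive R K M h).

Lemma free_mapU a k : free_map << a *g k >> = a *: h k.
Proof. exact: liftU. Qed.

Lemma free_mapE D : free_map D = \sum_(k <- dom D) coeff k D *: h k.
Proof.
rewrite -{1}[D]freeg_sumE raddf_sum /=.
by apply: eq_bigr => k _; rewrite free_mapU.
Qed.

Lemma freegZU (a b : R) (k : K) : a *: << b *g k >> = << a * b *g k >>.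
Proof. by apply/eqP/freeg_eqP => x; rewrite coeffZ !coeffU mulrA. Qed.

Lemma free_map_scalable : scalable free_map.
Proof.
move=> a D; rewrite -{1}[D]freeg_sumE scaler_sumr raddf_sum free_mapE /=.
rewrite scaler_sumr; apply: eq_bigr => k _.
by rewrite freegZU free_mapU scalerA.
Qed.

HB.instance Definition _ :=
  GRing.isScalable.Build R {freeg K / R} M *:%R free_map free_map_scalable.

End FreeModule.

Lemma free_projective (K : choiceType) : projective {freeg K / R}.
Proof.
move=> A B p f psurj.
pose h k := projT1 (cid (psurj (f << k >>))).
have hP k : p (h k) = f << k >> by rewrite /h; case: cid.
exists (free_map h) => D; rewrite /= free_mapE -[in RHS](freeg_sumE D).
rewrite !linear_sum; apply: eq_bigr => k _.
by rewrite linearZ_LR hP -linearZ_LR freegZU mulr1.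
Qed.

Variable M : lmodType R.

Definition cover (N : lmodType R) : {linear {freeg N / R} -> N} :=
  free_map id.

Fixpoint syzygy n : lmodType R :=
  if n is k.+1 then lkernel (cover (syzygy k)) else M.

Definition syzygy_diff n :
    {linear {freeg (syzygy n.+1) / R} -> {freeg (syzygy n) / R}} :=
  (\val : syzygy n.+1 -> {freeg (syzygy n) / R}) \o cover (syzygy n.+1).

Lemma cover_surj N : surjective (cover N).
Proof. by move=> y; exists << y >>; rewrite /= /free_map liftU scale1r. Qed.

Lemma syzygy_diff_image n y :
  cover (syzygy n) y = 0 <-> exists x, syzygy_diff n x = y.
Proof.
split=> [y0|[x <-]]; last exact/eqP/(valP (cover (syzygy n.+1) x)).
have y0' : lker_pred (cover (syzygy n)) y by apply/eqP.
have [x xP] := @cover_surj (syzygy n.+1) (exist _ y y0').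
by exists x; rewrite /= xP.
Qed.

Lemma proj_resolution_exists : inhabited (proj_resolution M).
Proof.
split; apply: (@ProjResolution R M (fun n => {freeg (syzygy n) / R})
  syzygy_diff (cover M)).
- by move=> n; apply: free_projective.
- exact: cover_surj.
- exact: (@syzygy_diff_image 0).
- move=> n y; rewrite -(@syzygy_diff_image n.+1); split=> [dy0|y0].
    by apply: val_inj; apply: dy0.
  by rewrite /= y0.
Qed.

End FreeResolution.

(* Main.v *)
(** Everything is reduced to matrices: a module over a Noetherian ring is given
    by a resolution F by finite free modules, and the vanishing of
    Ext^i(M, X) becomes a statement on tuples of elements of X.

    From R to R/x.  Lift a resolution D of an R/x-module N to matrices d over R
    and write d d = x h.  The blocks (d, -h; x, -d) then resolve over R a first
    syzygy M of N.  Since x kills N, the complex Hom(-, N) of the blocks is a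
    cone of h: if Ext_(R/x)(N, N) vanishes in large degrees, so does Ext_R(M, M),
    and then vanishing in all positive degrees descends from M to N.
    The same doubling transports from R to R/x the duality of exact free
    complexes that a finite injective resolution of R provides.

    From R/Q^l to R.  If Ext^i(M, R) = 0 for all i > 0, then duality over R/Q
    makes F/QF exact, so x_1, ..., x_n is regular on M, the graded pieces
    of M/Q^l M are copies of M/QM, and F/Q^l F resolves M/Q^l M.  Applying (SAC)
    there, a descending induction on the degree and Nakayama's lemma give
    Ext^i(M, M) = 0.

    From R/Q to S = R/Q^l, l <= n.  Let b be the rank of Q^(l-1)/Q^l over R/Q and
    c the length of the filtration of R/Q^(l-1) by copies of R/Q; then b > c
    exactly when l <= n.  For X = S or X = N with T^i = Ext_S^i(N, X/QX), the
    vanishing of Ext_S^(i+1)(N, X) makes b copies of T^(i+1) a quotient of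
    Ext_S^i(N, X/Q^(l-1)X), whose length is at most c times that of T^i.  At a
    prime where the T^i are eventually of finite nonzero length this is
    impossible, so T^i = 0 for large i, hence as soon as Ext_S^j(N, X) = 0 for
    all j >= i.  For X = S, duality over R/Q then shows that the resolution of N
    stays exact modulo Q, and N/QN inherits the hypotheses. *)

Require Import Defs.
From HB Require Import structures.
From mathcomp Require Import all_boot all_algebra ring_quotient boolp.

Set Implicit Arguments.
Unset Strict Implicit.
Unset Printing Implicit Defensive.

Import GRing.Theory.
Local Open Scope ring_scope.
Local Open Scope quotient_scope.

(** * Coefficients in subquotients of a module *)

Section Action.
Variable B : comPzRingType.
Implicit Types X Y : lmodType B.

(** Submodules are predicates on one ambient module, so that a subquotient V/U needs no type of its
    own: its elements have representatives in X. *)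
Definition submod X (U : X -> Prop) : Prop :=
  U 0 /\ forall a u v, U u -> U v -> U (a *: u + v).

Definition full X : X -> Prop := fun=> True.
Definition zero_sub X : X -> Prop := fun y => y = 0.

Lemma full_submod X : submod (@full X). Proof. by []. Qed.

Lemma zero_submod X : submod (@zero_sub X).
Proof. by split=> // a u v -> ->; rewrite /zero_sub scaler0 addr0. Qed.

Section SubmodTheory.
Variables (X : lmodType B) (U : X -> Prop) (sU : submod U).

Lemma submod0 : U 0. Proof. by case: sU. Qed.

Lemma submodD u v : U u -> U v -> U (u + v).
Proof. by case: sU => _ h Uu Uv; rewrite -[u]scale1r; apply: h. Qed.

Lemma submodZ a u : U u -> U (a *: u).
Proof. by case: sU => U0 h Uu; rewrite -[_ *: _]addr0; apply: h. Qed.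

Lemma submodN u : U u -> U (- u).
Proof. by rewrite -scaleN1r; apply: submodZ. Qed.

Lemma submodB u v : U u -> U v -> U (u - v).
Proof. by move=> Uu Uv; apply: submodD => //; apply: submodN. Qed.

Lemma submod_sum I (s : seq I) (P : pred I) (F : I -> X) :
  (forall i, P i -> U (F i)) -> U (\sum_(i <- s | P i) F i).
Proof. by move=> h; elim/big_rec: _ => [|i y Pi]; [exact: submod0|apply: submodD; apply: h]. Qed.

Lemma submodDr u v : U u -> U (u + v) -> U v.
Proof. by move=> Uu h; rewrite -(addKr u v); apply: submodD => //; apply: submodN. Qed.

End SubmodTheory.

Definition capS X (U V : X -> Prop) : X -> Prop := fun y => U y /\ V y.
Definition addS X (U V : X -> Prop) : X -> Prop :=
  fun y => exists u v, [/\ U u, V v & y = u + v].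

Lemma capS_submod X (U V : X -> Prop) : submod U -> submod V -> submod (capS U V).
Proof.
move=> sU sV; split; first by split; apply: submod0.
by move=> a u v [Uu Vu] [Uv Vv]; split; [apply: sU.2|apply: sV.2].
Qed.

Lemma addS_submod X (U V : X -> Prop) : submod U -> submod V -> submod (addS U V).
Proof.
move=> sU sV; split; first by exists 0, 0; rewrite addr0; split=> //; apply: submod0.
move=> a _ _ [u [v [Uu Vv ->]]] [u' [v' [Uu' Vv' ->]]].
exists (a *: u + u'), (a *: v + v'); split; [exact: sU.2|exact: sV.2|].
by rewrite scalerDr addrACA.
Qed.

Lemma addSl X (U V : X -> Prop) y : submod V -> U y -> addS U V y.
Proof. by move=> sV Uy; exists y, 0; rewrite addr0; split=> //; apply: submod0. Qed.

Lemma addSr X (U V : X -> Prop) y : submod U -> V y -> addS U V y.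
Proof. by move=> sU Uy; exists 0, y; rewrite add0r; split=> //; apply: submod0. Qed.

(** A tuple [f] stands for the linear map from row vectors with values [f] on the basis, and
    [mact A] for composition with [v |-> v *m A]; thus Hom(F, X) becomes a complex of tuples. *)
Definition mact p q X (A : 'M[B]_(p, q)) (f : {ffun 'I_q -> X}) :
  {ffun 'I_p -> X} := [ffun a => \sum_b A a b *: f b].

Lemma mact_is_linear p q X (A : 'M[B]_(p, q)) : linear (@mact p q X A).
Proof.
move=> a f g; apply/ffunP => i; rewrite !ffunE scaler_sumr -big_split /=.
by apply: eq_bigr => j _; rewrite !ffunE scalerDr !scalerA mulrC.
Qed.

HB.instance Definition _ p q X (A : 'M[B]_(p, q)) :=
  GRing.isLinear.Build B _ _ _ (@mact p q X A) (@mact_is_linear p q X A).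

Lemma mact_mul p q s X (A : 'M[B]_(p, q)) (A' : 'M[B]_(q, s)) (f : {ffun _ -> X}) :
  mact A (mact A' f) = mact (A *m A') f.
Proof.
apply/ffunP => i; rewrite !ffunE.
under eq_bigr do rewrite ffunE scaler_sumr.
rewrite exchange_big /=; apply: eq_bigr => k _.
rewrite !mxE scaler_suml; apply: eq_bigr => j _.
by rewrite scalerA.
Qed.

Lemma mact0 p q X (f : {ffun _ -> X}) : mact (0 : 'M[B]_(p, q)) f = 0.
Proof. by apply/ffunP => i; rewrite !ffunE big1 // => j _; rewrite mxE scale0r. Qed.

Definition pw (I : finType) X (U : X -> Prop) : {ffun I -> X} -> Prop :=
  fun f => forall i, U (f i).

Lemma pw_submod (I : finType) X (U : X -> Prop) :
  submod U -> submod (@pw I X U).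
Proof.
move=> sU; split=> [i|a u v hu hv i]; rewrite !ffunE; first exact: submod0.
exact: sU.2.
Qed.

Lemma mact_pw p q X (U : X -> Prop) (A : 'M[B]_(p, q)) f :
  submod U -> pw U f -> pw U (mact A f).
Proof.
move=> sU Uf i; rewrite ffunE; apply: submod_sum => // j _.
exact: submodZ.
Qed.

End Action.

Arguments pw_submod {B I X U}.
Arguments full {B X}.
Arguments zero_sub {B X}.

(** * Cohomology of Hom(F, V/U) for a complex F of matrices *)

Section Complexes.
Variables (B : comPzRingType) (r : nat -> nat)
          (D : forall i, 'M[B]_(r i.+1, r i)).

Definition is_cplx := forall i, D i.+1 *m D i = 0.

(** Row vectors are the elements of F, on which [D i] acts from degree i + 1 to degree i; column
    vectors are the elements of its dual. Only degrees at least 1 are tested. *)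
Definition row_exact := forall i (v : 'rV_(r i.+1)), v *m D i = 0 ->
  exists w, v = w *m D i.+1.

Definition col_exact i := forall f : 'cV_(r i.+1), D i.+1 *m f = 0 ->
  exists g, f = D i *m g.

Hypothesis cD : is_cplx.
Variable X : lmodType B.
Implicit Types U V W : X -> Prop.

Lemma mact_cplx i (f : {ffun _ -> X}) : mact (D i.+1) (mact (D i) f) = 0.
Proof. by rewrite mact_mul cD mact0. Qed.

(* Index shift: for a free resolution F given by D, the predicates below with
   index i concern H^(i+1)(Hom(F, V/U)), with representatives taken in X; thus
   coh0 says that this group vanishes, and kills that it is annihilated by a
   power of a. *)
Definition cocyc i V U : {ffun 'I_(r i.+1) -> X} -> Prop :=
  fun f => pw V f /\ pw U (mact (D i.+1) f).
Definition cobd i V U : {ffun 'I_(r i.+1) -> X} -> Prop :=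
  fun f => exists g, pw V g /\ pw U (f - mact (D i) g).

Arguments cocyc : clear implicits.
Arguments cobd : clear implicits.

Lemma cocyc_submod i V U : submod V -> submod U -> submod (cocyc i V U).
Proof.
move=> sV sU; split; first by rewrite /cocyc linear0; split; apply: submod0; exact: pw_submod.
move=> a u v [Vu Uu] [Vv Uv]; split; first by apply: (pw_submod sV).2.
by rewrite linearP; apply: (pw_submod sU).2.
Qed.

Lemma cobd_submod i V U : submod V -> submod U -> submod (cobd i V U).
Proof.
move=> sV sU; split.
  exists 0; rewrite linear0 subr0; split; apply: submod0; exact: pw_submod.
move=> a u v [g [Vg Ug]] [h [Vh Uh]]; exists (a *: g + h).
split; first exact: (pw_submod sV).2.
suff -> : a *: u + v - mact (D i) (a *: g + h) =
  a *: (u - mact (D i) g) + (v - mact (D i) h) by apply: (pw_submod sU).2.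
by rewrite linearP scalerBr addrACA opprD.
Qed.

Definition kills a i V U := exists k, forall f, cocyc i V U f -> cobd i V U (a ^+ k *: f).

Definition coh0 i V U := forall f, cocyc i V U f -> cobd i V U f.

Definition acyc i := forall f : {ffun 'I_(r i.+1) -> X}, mact (D i.+1) f = 0 ->
  exists g, f = mact (D i) g.

Lemma coh0_kills i V U : coh0 i V U -> kills 1 i V U.
Proof. by move=> h; exists 0 => f /h; rewrite expr0 scale1r. Qed.

Lemma kills_coh0 i V U : kills 1 i V U -> coh0 i V U.
Proof. by move=> [k h] f /h; rewrite expr1n scale1r. Qed.

Lemma acycP i : acyc i <-> coh0 i full zero_sub.
Proof.
split=> [h f [_ z]|h f z].
  have [|g ->] := h f; first by apply/ffunP => j; rewrite z ffunE.
  by exists g; split=> // j; rewrite subrr ffunE.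
have [|g [_ gP]] := h f; first by split=> // j; rewrite z ffunE.
by exists g; apply/eqP; rewrite -subr_eq0; apply/eqP/ffunP => j; rewrite gP ffunE.
Qed.

Lemma cobd_in i V U f : submod V -> (forall y, U y -> V y) -> cobd i V U f -> pw V f.
Proof.
move=> sV UV [g [Vg Ug]]; rewrite -(subrK (mact (D i) g) f) => j.
rewrite ffunE; apply: submodD => //; [exact/UV/Ug|exact: mact_pw].
Qed.

(** From the exact sequence H(V/U) -> H(W/U) -> H(W/V); the two exponents add up. *)
Lemma kills_ext a i U V W : submod U -> submod V -> submod W ->
  (forall y, U y -> V y) -> (forall y, V y -> W y) ->
  kills a i V U -> kills a i W V -> kills a i W U.
Proof.
move=> sU sV sW UV VW [k' h'] [k h].
exists (k' + k)%N => f [Wf Uf].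
have [|g [Wg Vg]] := h f; first by split=> // j; apply/UV.
have [|g' [Vg' Ug']] := h' (a ^+ k *: f - mact (D i) g).
  split=> //; rewrite linearB /= mact_cplx subr0 linearZ.
  exact: (submodZ (pw_submod sU)).
exists (a ^+ k' *: g + g'); split.
  by apply: (pw_submod sW).2 => // j; apply: VW.
rewrite linearP opprD addrA exprD -scalerA -scalerBr //.
Qed.

(** As H(W/U) vanishes in index i + 1, the connecting map from H(W/V) in index i to H(V/U) in index
    i + 1 is onto. *)
Lemma kills_conn a i U V W : submod U -> submod V -> submod W ->
  (forall y, U y -> V y) -> (forall y, V y -> W y) ->
  coh0 i.+1 W U -> kills a i W V -> kills a i.+1 V U.
Proof.
move=> sU sV sW UV VW h [k hk]; exists k => f [Vf Uf].
have [|g [Wg Ug]] := h f; first by split=> // j; apply/VW.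
have [|g' [Wg' Vg']] := hk g.
  split=> // j; have -> : mact (D i.+1) g = f - (f - mact (D i.+1) g) by rewrite subKr.
  by rewrite ffunE; apply: submodD => //; rewrite ffunE; apply: submodN => //; apply: UV.
exists (a ^+ k *: g - mact (D i) g'); split=> //.
rewrite linearB /= mact_cplx subr0 linearZ -scalerBr.
exact: (submodZ (pw_submod sU)).
Qed.

End Complexes.

Arguments cocyc {B r} D {X}.
Arguments cobd {B r} D {X}.
Arguments kills {B r} D {X}.
Arguments coh0 {B r} D {X}.

(** * Ext computed from free resolutions by matrices *)

Section Submodule.
Variables (B : comPzRingType) (X : lmodType B) (U : X -> Prop) (sU : submod U).

(** The proof of [submod U] is an argument so that the instances declared below can be inferred from
    the term. *)
Definition submod_pred of submod U : {pred X} := fun x => `[< U x >].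

Lemma submod_pred_closed : subsemimod_closed (submod_pred sU).
Proof.
split; first split.
- by apply/asboolP; exact: submod0.
- by move=> x y /asboolP Ux /asboolP Uy; apply/asboolP; exact: submodD.
- by move=> a x /asboolP Ux; apply/asboolP; exact: submodZ.
Qed.

HB.instance Definition _ :=
  GRing.isSubmodClosed.Build B X (submod_pred sU) submod_pred_closed.

Definition submodule := {x : X | submod_pred sU x}.
HB.instance Definition _ := [isSub of submodule for @sval _ _].
HB.instance Definition _ := [Choice of submodule by <:].
HB.instance Definition _ := [SubChoice_isSubLmodule of submodule by <:].

Definition submodule_val : {linear submodule -> X} := (\val : submodule -> X).

Lemma submodule_valP (y : submodule) : U (submodule_val y).
Proof. exact/asboolP/(valP y). Qed.

Lemma submodule_val_inj : injective submodule_val. Proof. exact: val_inj. Qed.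

Lemma submodule_corestr (A : lmodType B) (f : {linear A -> X}) :
  (forall a, U (f a)) ->
  exists g : {linear A -> submodule}, forall a, submodule_val (g a) = f a.
Proof.
move=> Uf; pose g a : submodule := exist _ (f a) (introT (asboolP _) (Uf a)).
have gl : linear g by move=> a u v; apply: val_inj; rewrite /= !linearP.
pose gL := GRing.isLinear.Build B A submodule _ g gl.
pose G : {linear A -> submodule} := HB.pack g gL.
by exists G.
Qed.

Lemma submodule_ex y : U y -> exists z, submodule_val z = y.
Proof.
move=> Uy; by exists (exist _ y (introT (asboolP _) Uy)).
Qed.

End Submodule.

Arguments submodule_val {B X U sU}.
Arguments submodule_valP {B X U sU}.
Arguments submodule_val_inj {B X U sU}.

(** * Comparison of projective resolutions *)

Section Comparison.
Variable B : comPzRingType.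

Lemma linear_of (X Y : lmodType B) (g : X -> Y) : linear g ->
  exists G : {linear X -> Y}, forall x, G x = g x.
Proof.
move=> gl; pose gL := GRing.isLinear.Build B X Y _ g gl.
pose G : {linear X -> Y} := HB.pack g gL.
by exists G.
Qed.

Lemma image_submod (X Y : lmodType B) (f : {linear X -> Y}) :
  submod (fun y => exists x, f x = y).
Proof.
split; first by exists 0; rewrite linear0.
by move=> a _ _ [x <-] [y <-]; exists (a *: x + y); rewrite linearP.
Qed.

(** Only the values of [f] need preimages: [p] is first corestricted to its image, where it is
    onto. *)
Lemma projective_lift (P A C : lmodType B) (p : {linear A -> C}) (f : {linear P -> C}) :
  projective P -> (forall x, exists a, p a = f x) ->
  exists g : {linear P -> A}, forall x, p (g x) = f x.
Proof.
move=> Pproj hf.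
have [|p' p'E] := submodule_corestr (image_submod p) (f := p); first by move=> a; exists a.
have [f' f'E] := submodule_corestr (image_submod p) hf.
have [|g gE] := Pproj _ _ p' f'.
  move=> y; have [a ay] := submodule_valP y; exists a.
  by apply: submodule_val_inj; rewrite p'E.
by exists g => x; rewrite -p'E gE f'E.
Qed.

Variable M : lmodType B.
Implicit Types P : proj_resolution M.

Lemma pr_diff2 P n y : pr_diff P n (pr_diff P n.+1 y) = 0.
Proof. by apply/(pr_exact (p := P) (n := n)); exists y. Qed.

Lemma pr_augd P y : pr_aug P (pr_diff P 0 y) = 0.
Proof. by apply/(pr_exact0 (p := P)); exists y. Qed.

Section ChainMap.
Variables P P' : proj_resolution M.

(** Boundaries go to boundaries: this is what the next lift needs, so the recursion carries it
    along. *)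
Definition good_map n (f : {linear P n -> P' n}) :=
  forall y, exists z, pr_diff P' n z = f (pr_diff P n y).

Lemma good_map0 : exists f : {linear P 0 -> P' 0},
  good_map f /\ forall y, pr_aug P' (f y) = pr_aug P y.
Proof.
have [f fE] := projective_lift (@pr_projective _ _ P 0)
  (fun x => @pr_aug_surj _ _ P' (pr_aug P x)).
exists f; split=> // y; apply/pr_exact0; rewrite fE; exact: pr_augd.
Qed.

Lemma good_mapS n (f : {linear P n -> P' n}) : good_map f ->
  exists g : {linear P n.+1 -> P' n.+1},
    good_map g /\ forall y, pr_diff P' n (g y) = f (pr_diff P n y).
Proof.
move=> gf.
have [g gE] := @projective_lift _ _ _ (pr_diff P' n) (f \o pr_diff P n)
  (@pr_projective _ _ P n.+1) gf.
exists g; split=> // y; apply/pr_exact; rewrite gE /= pr_diff2 linear0 //.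
Qed.

Fixpoint chain_map_aux n : {f : {linear P n -> P' n} | good_map f} :=
  match n with
  | 0 => let: exist f h := cid good_map0 in exist _ f h.1
  | k.+1 => let: exist f h := chain_map_aux k in
            let: exist g h' := cid (good_mapS h) in exist _ g h'.1
  end.

Definition chain_map n : {linear P n -> P' n} := sval (chain_map_aux n).

Lemma chain_map_aug y : pr_aug P' (chain_map 0 y) = pr_aug P y.
Proof. by rewrite /chain_map /=; case: cid => f [h h'] /=. Qed.

Lemma chain_mapE n y : pr_diff P' n (chain_map n.+1 y) = chain_map n (pr_diff P n y).
Proof.
rewrite /chain_map /=; case: (chain_map_aux n) => f h /=.
by case: cid => g [h1 h2] /=.
Qed.

End ChainMap.

Section Homotopy.
Variables (P : proj_resolution M) (e : forall n, {linear P n -> P n}).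
Hypothesis e0 : forall y, pr_aug P (e 0 y) = 0.
Hypothesis eS : forall n y, pr_diff P n (e n.+1 y) = e n (pr_diff P n y).

Lemma null_homotopic n : exists s : {linear P n -> P n.+1},
  exists t : {linear P n.+1 -> P n.+2},
    forall y, e n.+1 y = pr_diff P n.+1 (t y) + s (pr_diff P n y).
Proof.
(* On boundaries the lower term of the homotopy formula vanishes; what is left involves one map only
   and goes through by induction. *)
suff [s sP] : exists s : {linear P n -> P n.+1},
    forall y, e n (pr_diff P n y) = pr_diff P n (s (pr_diff P n y)).
  exists s.
  have [|t tE] := @projective_lift _ _ _ (pr_diff P n.+1)
    (e n.+1 \- (s \o pr_diff P n)) (@pr_projective _ _ P n.+1).
    move=> y; apply/pr_exact; rewrite /= linearB /= eS sP; exact: subrr.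
  by exists t => y; rewrite tE /= subrK.
elim: n => [|n [s sP]].
  have [s sE] := @projective_lift _ _ _ (pr_diff P 0) (e 0)
    (@pr_projective _ _ P 0) (fun y => (pr_exact0 (p := P) (e 0 y)).1 (e0 y)).
  by exists s => y; rewrite sE.
have [|t tE] := @projective_lift _ _ _ (pr_diff P n.+1)
  (e n.+1 \- (s \o pr_diff P n)) (@pr_projective _ _ P n.+1).
  move=> y; apply/pr_exact; rewrite /= linearB /= eS sP; exact: subrr.
by exists t => y; rewrite tE /= pr_diff2 linear0 subr0.
Qed.

End Homotopy.

(** [Ext_vanishes] speaks of all resolutions. One suffices, because the composite P -> P' -> P is
    homotopic to the identity. *)
Lemma Ext_vanishes_indep P P' (N : lmodType B) n :
  (forall f : {linear P' n.+1 -> N}, cocycle f -> coboundary f) ->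
  forall f : {linear P n.+1 -> N}, cocycle f -> coboundary f.
Proof.
move=> h f cf.
have [|g gE] := h (f \o chain_map P' P n.+1).
  by move=> y; rewrite /= -chain_mapE; apply: cf.
pose e k : {linear P k -> P k} := (chain_map P' P k \o chain_map P P' k) \- idfun.
have [||s [t stE]] := @null_homotopic P e _ _ n.
- by move=> y; rewrite /e /= linearB /= !chain_map_aug subrr.
- by move=> k y; rewrite /e /= linearB /= !chain_mapE.
exists ((g \o chain_map P P' n) \- (f \o s)) => y /=.
rewrite -chain_mapE -gE /=.
have := congr1 f (stE y); rewrite /e /= linearB linearD /= cf add0r => <-.
by rewrite subKr.
Qed.

End Comparison.

(** * Free resolutions by matrices *)

Section RowModules.
Variable B : comPzRingType.
Implicit Types X Y : lmodType B.

Definition rlin n X (f : {ffun 'I_n -> X}) : 'rV[B]_n -> X :=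
  fun v => \sum_j v 0 j *: f j.

Lemma rlin_is_linear n X (f : {ffun 'I_n -> X}) : linear (rlin f).
Proof.
move=> a u v; rewrite /rlin scaler_sumr -big_split /=.
by apply: eq_bigr => j _; rewrite !mxE scalerDl scalerA.
Qed.

HB.instance Definition _ n X (f : {ffun 'I_n -> X}) :=
  GRing.isLinear.Build B _ _ _ (rlin f) (rlin_is_linear f).

Lemma rlin_delta n X (f : {ffun 'I_n -> X}) j : rlin f (delta_mx 0 j) = f j.
Proof.
rewrite /rlin (bigD1 j) //= big1 ?addr0 => [|k kj]; rewrite mxE eqxx /=.
  by rewrite eqxx scale1r.
by rewrite (negPf kj) scale0r.
Qed.

Lemma rlinE n X (g : {linear 'rV[B]_n -> X}) v :
  g v = rlin [ffun j => g (delta_mx 0 j)] v.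
Proof.
rewrite {1}(row_sum_delta v) linear_sum; apply: eq_bigr => j _.
by rewrite linearZ ffunE.
Qed.

Lemma rlin_mact n p X (A : 'M[B]_(p, n)) (f : {ffun 'I_n -> X}) v :
  rlin f (v *m A) = rlin (mact A f) v.
Proof.
rewrite /rlin; under [RHS]eq_bigr do rewrite ffunE scaler_sumr.
rewrite exchange_big /=; apply: eq_bigr => k _.
rewrite mxE scaler_suml; apply: eq_bigr => j _.
by rewrite scalerA.
Qed.

Lemma rlin_inj n X (f g : {ffun 'I_n -> X}) : rlin f =1 rlin g -> f = g.
Proof. by move=> h; apply/ffunP => j; rewrite -!rlin_delta h. Qed.

Lemma fin_genP X :
  fin_gen X <-> exists n (f : {ffun 'I_n -> X}), forall y, exists v, y = rlin f v.
Proof.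
split=> [[s sP]|[n [f fP]]].
  exists (size s), [ffun i : 'I_(size s) => s`_i] => y.
  have [c ->] := sP y; exists (\row_i c i).
  by apply: eq_bigr => i _; rewrite mxE ffunE.
exists (codom f) => y; have [v ->] := fP y.
have e : size (codom f) = n by rewrite size_codom card_ord.
exists (fun i => v 0 (cast_ord e i)).
rewrite /rlin (reindex (cast_ord e)) /=; last first.
  by exists (cast_ord (esym e)) => i _; rewrite ?cast_ordK ?cast_ordKV.
apply: eq_bigr => i _; congr (_ *: _).
rewrite (nth_map (cast_ord e i)) ?size_enum_ord //; last by rewrite -[X in (_ < X)%N]e.
congr (f _); apply: val_inj => /=; rewrite nth_enum_ord //.
by rewrite -[X in (_ < X)%N]e.
Qed.

Lemma row_projective n : projective 'rV[B]_n.
Proof.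
move=> A C p f ps.
pose h := [ffun j : 'I_n => projT1 (cid (ps (f (delta_mx 0 j))))].
exists (rlin h) => x; rewrite (rlinE f) /= linear_sum; apply: eq_bigr => j _.
by rewrite linearZ !ffunE; case: cid => /= a ->.
Qed.

Lemma mulmxr_linear p n (A : 'M[B]_(p, n)) : linear (fun v : 'rV[B]_p => v *m A).
Proof. by move=> a u v; rewrite mulmxDl scalemxAl. Qed.

Section FreeRes.
Variables (r : nat -> nat) (D : forall i, 'M[B]_(r i.+1, r i)) (M : lmodType B)
  (eps : {linear 'rV[B]_(r 0) -> M}).

Record free_res : Prop := FreeRes {
  fr_cplx : is_cplx D;
  fr_exact : row_exact D;
  fr_surj : surjective eps;
  fr_ker : forall v, eps v = 0 <-> exists w, v = w *m D 0
}.

Hypothesis FR : free_res.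

Lemma free_proj_res : exists P : proj_resolution M,
  forall n (X : lmodType B),
    (forall f : {linear P n.+1 -> X}, cocycle f -> coboundary f) <-> acyc D X n.
Proof.
pose dm i : {linear 'rV[B]_(r i.+1) -> 'rV[B]_(r i)} :=
  HB.pack (fun v : 'rV[B]_(r i.+1) => v *m D i)
    (GRing.isLinear.Build B _ _ _ _ (mulmxr_linear (D i))).
have ex0 : exact_at (dm 0) eps.
  by move=> y; rewrite (fr_ker FR); split=> [] [w]; exists w.
have ex n : exact_at (dm n.+1) (dm n).
  move=> y; split=> [/(fr_exact FR)[w ->]|[w <-]]; first by exists w.
  by rewrite /= -mulmxA (fr_cplx FR) mulmx0.
exists (@ProjResolution B M (fun i => 'rV[B]_(r i)) dm eps
  (fun n => @row_projective (r n)) (fr_surj FR) ex0 ex) => n X.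
split=> [h f f0|h f cf].
  have [|g gE] := h (rlin f).
    by move=> y; rewrite /= rlin_mact f0 /rlin big1 // => j _; rewrite ffunE scaler0.
  exists [ffun j => g (delta_mx 0 j)]; apply: rlin_inj => v.
  by rewrite gE /= rlinE rlin_mact.
pose F := [ffun j => f (delta_mx 0 j)].
have [|g gE] := h F.
  apply: rlin_inj => v; rewrite -rlin_mact -rlinE.
  by have := cf v => /= ->; rewrite /rlin big1 // => j _; rewrite ffunE scaler0.
by exists (rlin g) => y /=; rewrite rlin_mact -gE -rlinE.
Qed.

(** All later uses of Ext pass through this equivalence, which holds for any one free resolution;
    the index on the right is the degree minus 1. *)
Lemma Ext_acyc n (X : lmodType B) : Ext_vanishes n.+1 M X <-> acyc D X n.
Proof.
have [P PE] := free_proj_res; rewrite -PE.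
split=> [h|h P' f]; first exact: h.
exact: Ext_vanishes_indep h f.
Qed.

Lemma free_res_fin_gen : fin_gen M.
Proof.
apply/fin_genP; exists (r 0), [ffun j => eps (delta_mx 0 j)] => y.
by have [v <-] := fr_surj FR y; exists v; rewrite (rlinE eps).
Qed.

End FreeRes.
End RowModules.

(** * Noetherian modules *)

Section Span.
Variable B : comPzRingType.
Implicit Types X : lmodType B.

Fixpoint span X (s : seq X) : X -> Prop :=
  if s is z :: s' then fun y => exists a u, span s' u /\ y = a *: z + u
  else zero_sub.

Lemma span_submod X (s : seq X) : submod (span s).
Proof.
elim: s => [|z s [IH0 IH]]; first exact: zero_submod.
split; first by exists 0, 0; rewrite scale0r addr0.
move=> a _ _ [b [u [su ->]]] [c [v [sv ->]]].
exists (a * b + c), (a *: u + v); split; first exact: IH.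
by rewrite scalerDr scalerA scalerDl addrACA.
Qed.

Lemma span_mem X (s : seq X) z : z \in s -> span s z.
Proof.
elim: s => //= t s IH; rewrite inE => /orP[/eqP->|/IH sz].
  by exists 1, 0; rewrite scale1r addr0; split=> //; apply: submod0 (span_submod s).
by exists 0, z; rewrite scale0r add0r.
Qed.

Lemma span_sub X (s : seq X) U : submod U -> (forall z, z \in s -> U z) ->
  forall y, span s y -> U y.
Proof.
move=> sU; elim: s => [_ y ->|z s IH h y [a [u [su ->]]]]; first exact: submod0.
apply: sU.2; first by apply: h; rewrite mem_head.
by apply: IH su => t ts; apply: h; rewrite inE ts orbT.
Qed.

Lemma spanP X (s : seq X) y :
  span s y <-> exists c : 'I_(size s) -> B, y = \sum_i c i *: s`_i.
Proof.
split=> [|[c ->]]; last first.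
  apply: (submod_sum (span_submod s)) => i _.
  by apply/(submodZ (span_submod s))/span_mem/mem_nth.
elim: s y => [y ->|z s IH y [a [u [/IH[c ->] ->]]]].
  by exists (fun=> 0); rewrite big_ord0.
exists (fun i => if unlift ord0 i is Some j then c j else a).
rewrite big_ord_recl unlift_none /=; congr (_ + _); apply: eq_bigr => i _.
by rewrite liftK.
Qed.

Definition fg_sub X (U : X -> Prop) :=
  exists s : seq X, (forall z, z \in s -> U z) /\ forall y, U y -> span s y.

Definition noeth_mod X := forall U : X -> Prop, submod U -> fg_sub U.

(** A failure yields, by dependent choice, a strictly ascending chain of submodules. Its union is
    finitely generated, so one term contains all the generators and the chain cannot grow beyond
    it. *)
Lemma noeth_ind X (P : (X -> Prop) -> Prop) : noeth_mod X ->
  (forall U, submod U ->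
     (forall V, submod V -> (forall y, U y -> V y) -> (exists y, V y /\ ~ U y) -> P V) ->
     P U) ->
  forall U, submod U -> P U.
Proof.
move=> nX step U sU; apply: contrapT => nPU.
pose T := {V : X -> Prop | submod V /\ ~ P V}.
pose R (V W : T) := (forall y, sval V y -> sval W y) /\ exists y, sval W y /\ ~ sval V y.
have next V : {W : T | R V W}.
  apply/cid; case: V => V [sV nPV]; apply: contrapT => no; apply: (nPV).
  apply: step => // W sW VW [y [Wy nVy]]; apply: contrapT => nPW.
  by apply: no; exists (exist _ W (conj sW nPW)); split=> //; exists y.
have [f [_ fR]] := dependent_choice next (exist _ U (conj sU nPU)).
have mono i j : (i <= j)%N -> forall y, sval (f i) y -> sval (f j) y.
  elim: j => [|j IH]; first by rewrite leqn0 => /eqP->.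
  by rewrite leq_eqVlt => /orP[/eqP-> //|/IH h y /h fy]; apply: (fR j).1.
pose W y := exists i, sval (f i) y.
have sW : submod W.
  split; first by exists 0%N; case: (svalP (f 0%N)) => /submod0.
  move=> a u v [i fu] [j fv]; exists (maxn i j).
  apply: (svalP (f (maxn i j))).1.2.
    by apply: mono fu; apply: leq_maxl.
  by apply: mono fv; apply: leq_maxr.
have [s [sW' Ws]] := nX W sW.
have [N hN] : exists N, forall z, z \in s -> sval (f N) z.
  elim: (s) sW' => [_|z t IH h]; first by exists 0%N.
  have [|N hN] := IH; first by move=> y yt; apply: h; rewrite inE yt orbT.
  have [i fi] : W z by apply: h; rewrite mem_head.
  exists (maxn N i) => y; rewrite inE => /orP[/eqP->|/hN fy].
    by apply: mono fi; apply: leq_maxr.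
  by apply: mono fy; apply: leq_maxl.
have [_ [y [fy]]] := fR N; apply.
apply: (span_sub (svalP (f N)).1 hN); apply: Ws.
by exists N.+1.
Qed.

Section IdealOf.
Variables (U : B^o -> Prop) (sU : submod U).

Definition ideal_of of submod U : {pred B} := fun a => `[< U a >].

Lemma ideal_of_closed : zmod_closed (ideal_of sU).
Proof.
split; first by apply/asboolP; exact: (submod0 sU).
move=> a b /asboolP Ua /asboolP Ub; rewrite unfold_in; apply/asboolP.
exact: (submodB sU Ua Ub).
Qed.

Lemma ideal_of_mull a : {in ideal_of sU, forall u, a * u \in ideal_of sU}.
Proof. by move=> u /asboolP Uu; rewrite unfold_in; apply/asboolP; exact: (submodZ sU a Uu). Qed.

HB.instance Definition _ := GRing.isZmodClosed.Build B (ideal_of sU) ideal_of_closed.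
HB.instance Definition _ := isIdeal.Build B (ideal_of sU) ideal_of_mull.

Lemma ideal_ofP a : a \in (ideal_of sU : idealType B) <-> U a.
Proof. by split=> /asboolP. Qed.

End IdealOf.

Lemma ideal_genP (s : seq B) a : a \in ideal_gen s <-> span (s : seq B^o) a.
Proof.
rewrite spanP; split=> [/asboolP[c ->]|[c ->]].
  by exists c.
by apply/asboolP; exists c.
Qed.

Lemma noeth_reg : noetherian B -> noeth_mod B^o.
Proof.
move=> nB U sU; have [s sP] := nB (ideal_of sU).
exists s; split=> [z zs|y Uy].
  by apply/(ideal_ofP sU); rewrite sP; apply/ideal_genP/span_mem.
by apply/ideal_genP; rewrite -sP; apply/ideal_ofP.
Qed.

Lemma span_cat X (s t : seq X) y : span (s ++ t) y <-> addS (span s) (span t) y.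
Proof.
have sst := addS_submod (span_submod s) (span_submod t).
split=> [|[u [v [su tv ->]]]].
  apply: span_sub => // z; rewrite mem_cat => /orP[zs|zt].
    by apply: addSl (span_submod t) _; apply: span_mem.
  by apply: addSr (span_submod s) _; apply: span_mem.
apply: (submodD (span_submod (s ++ t))).
  by apply: span_sub su => // [|z zs]; [exact: span_submod|apply: span_mem; rewrite mem_cat zs].
by apply: span_sub tv => // [|z zs]; [exact: span_submod|apply: span_mem; rewrite mem_cat zs orbT].
Qed.

(** Induction on the generators: the coefficients of [z] in elements of [U] form an ideal. Lifts to
    [U] of its generators, together with generators of the intersection of [U] with the span of [s],
    generate [U]. *)
Lemma fg_sub_span X (s : seq X) U : noetherian B -> submod U ->
  (forall y, U y -> span s y) -> fg_sub U.
Proof.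
move=> nB; elim: s U => [|z s IH] U sU Us.
  by exists [::]; split=> // y /Us.
pose I (a : B^o) := exists u, span s u /\ U (a *: z + u).
have sI : submod I.
  split; first by exists 0; rewrite scale0r addr0; split; apply: submod0 => //; apply: span_submod.
  move=> a b c [u [su Uu]] [v [sv Uv]]; exists (a *: u + v).
  split; first exact: (span_submod s).2.
  suff -> : (a *: b + c : B^o) *: z + (a *: u + v) = a *: (b *: z + u) + (c *: z + v).
    exact: sU.2.
  by rewrite scalerDr scalerDl scalerA addrACA.
have [t [tI It]] := noeth_reg nB sI.
have [] := IH (capS U (span s)).
- by apply: capS_submod => //; apply: span_submod.
- by move=> y [].
move=> t' [t'U Ut'].
have [e eP] : exists e : seq X, (forall y, y \in e -> U y) /\
    forall a, span t a -> exists u, span s u /\ span e (a *: z + u).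
  elim: t tI {It} => [_|b t IHt tI].
    exists [::]; split=> // _ ->; exists 0; rewrite scale0r addr0; split=> //.
    exact: submod0 (span_submod s).
  have [|e [eU eP]] := IHt; first by move=> y yt; apply: tI; rewrite inE yt orbT.
  have [u [su Uu]] := tI b (mem_head _ _).
  exists (b *: z + u :: e); split=> [y|_ [c [a [ta ->]]]].
    by rewrite inE => /orP[/eqP->|/eU].
  have [v [sv ev]] := eP a ta; exists (c *: u + v).
  split; first exact: (span_submod s).2.
  exists c, (a *: z + v); split=> //.
  by rewrite scalerDr scalerDl scalerA addrACA.
exists (e ++ t'); split=> [y|y Uy].
  by rewrite mem_cat => /orP[/eP.1//|/t'U[]].
have [a [u [su yE]]] := Us y Uy.
have Ia : I a by exists u; rewrite -yE.
have [v [sv ev]] := eP.2 a (It _ Ia).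
apply/span_cat; exists (a *: z + v), (u - v); split=> //; last first.
  by rewrite yE -[RHS]addrA [v + _]addrC subrK.
apply: Ut'; split; last exact: (submodB (span_submod s)).
have -> : u - v = y - (a *: z + v) by rewrite yE opprD addrACA subrr add0r.
by apply: submodB => //; apply: (span_sub sU eP.1).
Qed.

Lemma fin_gen_span X : fin_gen X <-> exists s : seq X, forall y, span s y.
Proof.
split=> [] [s sP]; exists s => y; first exact/spanP.
exact/spanP/sP.
Qed.

Lemma noeth_fin_gen X : noetherian B -> fin_gen X -> noeth_mod X.
Proof.
move=> nB /fin_gen_span[s sP] U sU.
exact: (fg_sub_span (s := s)).
Qed.

Lemma row_fin_gen n : fin_gen 'rV[B]_n.
Proof.
apply/fin_genP; exists n, [ffun j => delta_mx 0 j] => y; exists y.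
by rewrite {1}(row_sum_delta y); apply: eq_bigr => j _; rewrite ffunE.
Qed.

Lemma ffun_fin_gen n X : fin_gen X -> fin_gen {ffun 'I_n -> X}.
Proof.
move=> /fin_gen_span[s sP]; apply/fin_gen_span.
pose e (j : 'I_n) (z : X) : {ffun 'I_n -> X} := [ffun k => if k == j then z else 0].
have eP j y : span [seq e j z | z <- s] (e j y).
  elim: (s) y (sP y) => [_ ->|z t IH _ [a [u [su ->]]]].
    by apply/ffunP => k; rewrite !ffunE if_same.
  exists a, (e j u); split; first exact: IH.
  by apply/ffunP => k; rewrite !ffunE; case: ifP; rewrite // scaler0 addr0.
exists (flatten [seq [seq e j z | z <- s] | j <- enum 'I_n]) => f.
have -> : f = \sum_j e j (f j).
  apply/ffunP => k; rewrite sum_ffunE (bigD1 k) //= big1 ?addr0 ?ffunE ?eqxx // => j jk.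
  by rewrite ffunE eq_sym (negPf jk).
apply: (submod_sum (span_submod _)) => j _.
apply: span_sub (eP j (f j)); first exact: span_submod.
move=> z zs; apply: span_mem; apply/flattenP.
by exists [seq e j z | z <- s] => //; apply/map_f; rewrite mem_enum.
Qed.

Lemma ker_fg (nB : noetherian B) p X (g : {linear 'rV[B]_p -> X}) :
  exists k (A : 'M[B]_(k, p)), forall v, g v = 0 <-> exists w, v = w *m A.
Proof.
have sK : submod (fun v => g v = 0).
  by split; [rewrite linear0|move=> a u v hu hv; rewrite linearP hu hv scaler0 addr0].
have [s [sK' Ks]] := noeth_fin_gen nB (row_fin_gen p) sK.
exists (size s), (\matrix_i s`_i) => v.
split=> [/Ks/spanP[c ->]|[w ->]].
  exists (\row_i c i); rewrite mulmx_sum_row; apply: eq_bigr => i _.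
  by rewrite mxE rowK.
rewrite mulmx_sum_row linear_sum big1 // => i _.
have gi := sK' _ (mem_nth 0 (ltn_ord i)).
by rewrite linearZ rowK /= gi scaler0.
Qed.

Lemma free_res_exists X : noetherian B -> fin_gen X ->
  exists r (D : forall i, 'M[B]_(r i.+1, r i)) (eps : {linear 'rV[B]_(r 0) -> X}),
    free_res D eps.
Proof.
move=> nB /fin_genP[n [f fP]].
have K p q (A : 'M[B]_(p, q)) :
    {k : nat & {A' : 'M[B]_(k, p) | forall v : 'rV[B]_p, v *m A = 0 <-> exists w, v = w *m A'}}.
  pose g : {linear 'rV[B]_p -> 'rV[B]_q} :=
    HB.pack (fun v : 'rV[B]_p => v *m A) (GRing.isLinear.Build B _ _ _ _ (mulmxr_linear A)).
  have /cid[k /cid[A' A'P]] := ker_fg nB g.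
  exists k; exists A'; exact: A'P.
have [k0 [A0 A0P]] := ker_fg nB (rlin f : {linear _ -> _}).
(* The dimensions change along the iteration, so a state packs a matrix with its sizes. By
   computation each matrix has as many columns as the previous one has rows, which makes [D] well
   typed. *)
pose T := {pq : nat * nat & 'M[B]_(pq.1, pq.2)}.
pose next (t : T) : T :=
  existT (fun pq : nat * nat => 'M[B]_(pq.1, pq.2))
    (projT1 (K _ _ (projT2 t)), (projT1 t).1) (sval (projT2 (K _ _ (projT2 t)))).
pose t0 : T := existT (fun pq : nat * nat => 'M[B]_(pq.1, pq.2)) (k0, n) A0.
pose st i : T := iter i next t0.
pose r i := if i is j.+1 then (projT1 (st j)).1 else n.
pose D i : 'M[B]_(r i.+1, r i) :=
  match i with 0 => projT2 (st 0%N) | j.+1 => projT2 (st j.+1) end.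
have DP i (v : 'rV[B]_(r i.+1)) : v *m D i = 0 <-> exists w, v = w *m D i.+1.
  case: i v => [|i] v; first exact: (svalP (projT2 (K _ _ (projT2 (st 0%N))))).
  exact: (svalP (projT2 (K _ _ (projT2 (st i.+1))))).
exists r, D, (rlin f); split.
- move=> i; apply/row_matrixP => j; rewrite row_mul row0; apply/DP.
  by exists (row j 1%:M); rewrite -row_mul mul1mx.
- by move=> i v /DP.
- by move=> y; have [v ->] := fP y; exists v.
- exact: A0P.
Qed.

End Span.

(** * Nakayama's lemma over a Noetherian local ring *)

Section Local.
Variables (B : comPzRingType) (m : idealType B).
Hypotheses (nB : noetherian B) (lm : is_local m).

(** Noetherian induction replaces Zorn's lemma: either a strictly larger proper ideal exists, or [U]
    is itself maximal and equals [m]. *)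
Lemma proper_sub_local (U : B^o -> Prop) : submod U -> ~ U 1 -> forall y, U y -> y \in m.
Proof.
move=> sU; move: U sU.
apply: (noeth_ind (noeth_reg nB)) => U sU IH nU1 y Uy.
have [[V [sV UV VU nV1]]|no] :=
    pselect (exists V : B^o -> Prop, [/\ submod V, forall z, U z -> V z,
               exists z, V z /\ ~ U z & ~ V 1]).
  by apply: IH (UV _ Uy).
rewrite -(lm.2 (ideal_of sU)); first exact/ideal_ofP.
split; first by apply/negP => /ideal_ofP.
move=> J UJ.
have sJ : submod (fun y : B^o => y \in J).
  by split=> [|a u v Ju Jv]; [exact: rpred0|apply: rpredD => //; apply: ideal_mull].
have [J1|nJ1] := pselect (1 \in J); [by left|right=> z].
apply/idP/idP => [Jz|Uz]; last exact: UJ.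
apply/ideal_ofP; apply: contrapT => nUz; apply: no.
exists (fun y : B^o => y \in J); split=> //; last by exists z.
by move=> t Ut; apply: UJ; apply/ideal_ofP.
Qed.

Lemma local_unit x : x \in m -> exists b, b * (1 - x) = 1.
Proof.
move=> xm; apply: contrapT => no.
have sU : submod (fun y : B^o => exists b, y = b * (1 - x)).
  split; first by exists 0; rewrite mul0r.
  by move=> a _ _ [b ->] [c ->]; exists (a * b + c); rewrite mulrDl -mulrA.
have : 1 - x \in m.
  apply: (proper_sub_local sU) => [[b b1]|]; first by apply: no; exists b.
  by exists 1; rewrite mul1r.
move=> xm1; have : 1 \in m by rewrite -(subrK x 1) rpredD.
by apply/negP; case: lm => [[]].
Qed.

(** Generators [y] of [Z] modulo [C] are removed one at a time. If y = c + x u and u is a y modulo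
    the others, then (1 - x a) y lies in [C] plus the span of the others, and 1 - x a is a unit. *)
Lemma nakayama (W : lmodType B) (x : B) (C Z : W -> Prop) :
  noeth_mod W -> x \in m -> submod C -> submod Z ->
  (forall z, Z z -> exists c u, [/\ C c, Z u & z = c + x *: u]) ->
  forall z, Z z -> C z.
Proof.
move=> nW xm sC sZ h.
have [s [sZ' Zs]] := nW Z sZ.
suff : forall t, (forall z, z \in t -> Z z) ->
    (forall z, Z z -> addS C (span t) z) -> forall z, Z z -> C z.
  by move=> /(_ s sZ'); apply=> z /Zs sz; apply: addSr.
elim=> [|y t IH] tZ Zt z Zz.
  by have [c [u [Cc -> ->]]] := Zt z Zz; rewrite addr0.
apply: IH Zz => {z} [z zt|z Zz]; first by apply: tZ; rewrite inE zt orbT.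
have sCt := addS_submod sC (span_submod t).
have key w : Z w -> exists a, addS C (span t) (w - a *: y).
  move=> /Zt[c [_ [Cc [a [u [tu ->]]] ->]]]; exists a.
  by rewrite (addrC (a *: y)) addrA addrK; exists c, u.
suff hy : addS C (span t) y.
  have [a ha] := key z Zz.
  by rewrite -(subrK (a *: y) z); apply: submodD => //; apply: submodZ.
have [c [u [Cc Zu yE]]] := h y (tZ y (mem_head _ _)).
have [a ha] := key u Zu.
have [b bP] : exists b, b * (1 - x * a) = 1.
  by apply: local_unit; rewrite mulrC; apply: ideal_mull.
rewrite -[y]scale1r -bP -scalerA; apply: submodZ => //.
suff -> : (1 - x * a) *: y = c + x *: (u - a *: y).
  by apply: submodD => //; [exact: addSl (span_submod t) _|apply: submodZ].
by rewrite scalerBl scale1r {1}yE scalerBr addrA scalerA.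
Qed.

End Local.

(** * Powers of a regular sequence *)

(* Qs xs U is (xs) U and Qp xs j is (xs)^j X.  Lists are read from the right:
   in weakly_regular, the head is regular modulo the tail. *)
Section Powers.
Variable B : comPzRingType.
Implicit Types (X Y : lmodType B) (xs : seq B).

Fixpoint Qs X xs (U : X -> Prop) : X -> Prop :=
  if xs is x :: t then fun y => exists u v, [/\ U u, Qs t U v & y = x *: u + v]
  else zero_sub.

Lemma Qs_submod X xs (U : X -> Prop) : submod U -> submod (Qs xs U).
Proof.
move=> sU; elim: xs => [|x t IH]; first exact: zero_submod.
split.
  by exists 0, 0; rewrite scaler0 addr0; split=> //; apply: submod0.
move=> a _ _ [u [v [Uu tv ->]]] [u' [v' [Uu' tv' ->]]].
exists (a *: u + u'), (a *: v + v'); split; [exact: sU.2|exact: IH.2|].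
by rewrite !scalerDr addrACA !scalerA mulrC.
Qed.

Lemma Qs_mem X xs (U : X -> Prop) x u : submod U -> x \in xs -> U u -> Qs xs U (x *: u).
Proof.
move=> sU; elim: xs => //= y t IH; rewrite inE => /orP[/eqP<-|xt] Uu.
  by exists u, 0; rewrite addr0; split=> //; apply: submod0; apply: Qs_submod.
by exists 0, (x *: u); rewrite scaler0 add0r; split=> //; [apply: submod0|apply: IH].
Qed.

Lemma Qs_min X xs (U V : X -> Prop) : submod V ->
  (forall x u, x \in xs -> U u -> V (x *: u)) -> forall y, Qs xs U y -> V y.
Proof.
move=> sV; elim: xs => [_ y ->|x t IH h y [u [v [Uu tv ->]]]]; first exact: submod0.
apply: submodD => //; first by apply: h => //; rewrite mem_head.
by apply: IH tv => z w zt Uw; apply: h => //; rewrite inE zt orbT.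
Qed.

Lemma Qs_mono X xs (U V : X -> Prop) : (forall y, U y -> V y) ->
  forall y, Qs xs U y -> Qs xs V y.
Proof.
move=> UV; elim: xs => //= x t IH y [u [v [Uu tv ->]]].
by exists u, v; split=> //; [apply: UV|apply: IH].
Qed.

Lemma Qs_sub_seq X xs ys (U : X -> Prop) : submod U -> {subset xs <= ys} ->
  forall y, Qs xs U y -> Qs ys U y.
Proof.
move=> sU xy; apply: Qs_min; first exact: Qs_submod.
by move=> x u /xy; apply: Qs_mem.
Qed.

Lemma Qs_le X xs (U : X -> Prop) : submod U -> forall y, Qs xs U y -> U y.
Proof. by move=> sU; apply: Qs_min => // x u _; apply: submodZ. Qed.

Definition Qp X xs j : X -> Prop := iter j (@Qs X xs) full.

Lemma iter_Qs_submod X xs j (U : X -> Prop) : submod U -> submod (iter j (@Qs X xs) U).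
Proof. by move=> sU; elim: j => //= j IH; apply: Qs_submod. Qed.

Lemma Qp_submod X xs j : submod (Qp xs j : X -> Prop).
Proof. exact: iter_Qs_submod. Qed.

Lemma Qp_le X xs i j : (i <= j)%N -> forall y : X, Qp xs j y -> Qp xs i y.
Proof.
elim: j => [|j IH]; first by rewrite leqn0 => /eqP->.
rewrite leq_eqVlt => /orP[/eqP-> //|ij] y jy; apply: IH => //.
by apply: Qs_le jy; apply: Qp_submod.
Qed.

Lemma Qp_sub_seq X xs ys j : {subset xs <= ys} -> forall y : X, Qp xs j y -> Qp ys j y.
Proof.
move=> xy; elim: j => //= j IH y /(Qs_mono IH).
by apply: Qs_sub_seq => //; apply: Qp_submod.
Qed.

(** Monomials count as formal products: coinciding values are kept, so that the length of the list
    does not depend on the ring. The inner recursion adds the multiples of the first entry to the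
    monomials that avoid it. *)
Fixpoint mons xs : nat -> seq B :=
  if xs is x :: t then
    fix mons_x j := if j is k.+1 then mons t k.+1 ++ [seq x * w | w <- mons_x k]
                    else [:: 1]
  else fun j => if j is 0 then [:: 1] else [::].

Arguments mons : simpl never.

Lemma mons0 xs : mons xs 0 = [:: 1]. Proof. by case: xs. Qed.

Lemma monsS x t j :
  mons (x :: t) j.+1 = mons t j.+1 ++ [seq x * w | w <- mons (x :: t) j].
Proof. by []. Qed.

Lemma mons_mul xs x w j : x \in xs -> w \in mons xs j -> x * w \in mons xs j.+1.
Proof.
elim: xs j w => [|y t IHt] //.
elim=> [|j IHj] w xt.
  rewrite mons0 inE => /eqP->; rewrite monsS mem_cat.
  move: xt; rewrite inE => /orP[/eqP->|xt]; first by rewrite mons0 /= mem_head orbT.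
  by rewrite IHt // mons0 mem_head.
rewrite [mons _ j.+2]monsS monsS !mem_cat; case/orP=> [wt|].
  move: xt; rewrite inE => /orP[/eqP->|xt]; last by rewrite IHt.
  by rewrite map_f ?orbT // mem_cat wt.
case/mapP=> w' w'j ->; rewrite mulrCA map_f ?orbT // -monsS.
exact: IHj.
Qed.

Lemma mons_div xs w j : w \in mons xs j.+1 ->
  exists x w', [/\ x \in xs, w' \in mons xs j & w = x * w'].
Proof.
elim: xs j w => // y t IHt j w.
have sub k v : v \in mons t k -> v \in mons (y :: t) k.
  by case: k => [|k]; rewrite ?mons0 // monsS mem_cat => ->.
rewrite monsS mem_cat => /orP[/IHt[x [w' [xt w't ->]]]|/mapP[w' w'j ->]].
  by exists x, w'; split=> //; [rewrite inE xt orbT|apply: sub].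
by exists y, w'; rewrite mem_head.
Qed.

(** Coefficients are functions on all of [nat], so that lists of different lengths need no casts. *)
Definition comb X (ws : seq B) (c : nat -> X) : X := \sum_(i < size ws) ws`_i *: c i.

Lemma comb_linear X ws (c d : nat -> X) a :
  comb ws (fun i => a *: c i + d i) = a *: comb ws c + comb ws d.
Proof.
rewrite /comb scaler_sumr -big_split; apply: eq_bigr => i _.
by rewrite scalerDr !scalerA mulrC.
Qed.

Lemma combB X ws (c d : nat -> X) :
  comb ws (fun i => c i - d i) = comb ws c - comb ws d.
Proof. by rewrite /comb -sumrB; apply: eq_bigr => i _; rewrite scalerBr. Qed.

Lemma combZ X ws a (c : nat -> X) : comb ws (fun i => a *: c i) = a *: comb ws c.
Proof. by rewrite /comb scaler_sumr; apply: eq_bigr => i _; rewrite !scalerA mulrC. Qed.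

Lemma comb_cat X ws ws' (c : nat -> X) :
  comb (ws ++ ws') c = comb ws c + comb ws' (fun i => c (size ws + i)%N).
Proof.
rewrite /comb size_cat big_split_ord /=; congr (_ + _); apply: eq_bigr => i _.
  by rewrite nth_cat ltn_ord.
by rewrite nth_cat ltnNge leq_addr /= addKn.
Qed.

Lemma comb_map X x ws (c : nat -> X) : comb [seq x * w | w <- ws] c = x *: comb ws c.
Proof.
rewrite /comb scaler_sumr size_map; apply: eq_bigr => i _.
by rewrite (nth_map 0) // scalerA.
Qed.

Lemma comb1 X w (c : nat -> X) : comb [:: w] c = w *: c 0%N.
Proof. by rewrite /comb big_ord1. Qed.

Lemma comb_morph X Y (g : {linear X -> Y}) ws c : g (comb ws c) = comb ws (g \o c).
Proof. by rewrite /comb linear_sum; apply: eq_bigr => i _; rewrite linearZ. Qed.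

Lemma comb_delta X ws i (u : X) : (i < size ws)%N ->
  comb ws (fun k => if k == i then u else 0) = ws`_i *: u.
Proof.
move=> iw; rewrite /comb (bigD1 (Ordinal iw)) //= eqxx big1 ?addr0 // => k ki.
by rewrite ifN ?scaler0.
Qed.

Lemma iter_QsP X xs j (U : X -> Prop) y : submod U ->
  iter j (@Qs X xs) U y <->
  exists c, (forall i, (i < size (mons xs j))%N -> U (c i)) /\ y = comb (mons xs j) c.
Proof.
move=> sU; split=> [|[c [Uc ->]]].
  elim: j y => [y Uy|j IH y /= Qy].
    by exists (fun=> y); rewrite mons0 comb1 scale1r.
  pose V (y : X) := exists c, (forall i, (i < size (mons xs j.+1))%N -> U (c i)) /\
    y = comb (mons xs j.+1) c.
  apply: (Qs_min (V := V)) Qy.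
    split.
      exists (fun=> 0); split; first by move=> *; apply: submod0.
      by rewrite /comb big1 // => i _; rewrite scaler0.
    move=> a _ _ [c [Uc ->]] [d [Ud ->]]; exists (fun i => a *: c i + d i).
    by split; [move=> i ij; apply: sU.2; [apply: Uc|apply: Ud]|rewrite comb_linear].
  move=> x _ xxs /IH[c [Uc ->]].
  suff /choice[k kP] : forall i : 'I_(size (mons xs j)),
      exists k, (k < size (mons xs j.+1))%N /\ (mons xs j.+1)`_k = x * (mons xs j)`_i.
    (* Several [i] may share the index [k i], since values of monomials may coincide; their
       coefficients are added. *)
    exists (fun l => \sum_(i < size (mons xs j) | l == k i) c i); split.
      by move=> l _; apply: submod_sum => // i _; apply: Uc.
    rewrite -combZ /comb.
    under [RHS]eq_bigr do rewrite scaler_sumr.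
    under [RHS]eq_bigr do rewrite big_mkcond.
    rewrite exchange_big /=; apply: eq_bigr => i _.
    rewrite (bigD1 (Ordinal (kP i).1)) //= eqxx big1 ?addr0 => [|l li].
      by rewrite (kP i).2 !scalerA mulrC.
    by rewrite ifN.
  move=> i; have xw := mons_mul xxs (mem_nth 0 (ltn_ord i)).
  by exists (index (x * (mons xs j)`_i) (mons xs j.+1)); rewrite index_mem nth_index.
apply: submod_sum => [|i _]; first exact: iter_Qs_submod.
have: (mons xs j)`_i \in mons xs j by apply: mem_nth.
have: U (c i) by apply: Uc.
move: (c i) (mons xs j)`_i => u w Uu {c Uc i}.
elim: j w => [|j IH] w; first by rewrite mons0 inE => /eqP-> /=; rewrite scale1r.
case/mons_div=> x [w' [xxs w'j ->]]; rewrite -scalerA.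
by apply: Qs_mem => //; [apply: iter_Qs_submod|apply: IH].
Qed.

Lemma QpP X xs j (y : X) : Qp xs j y <-> exists c, y = comb (mons xs j) c.
Proof.
rewrite /Qp iter_QsP; last exact: full_submod.
by split=> [[c [_ ->]]|[c ->]]; exists c.
Qed.

Lemma QpSP X xs j (y : X) : Qp xs j.+1 y <->
  exists c, (forall i, (i < size (mons xs j))%N -> Qs xs full (c i)) /\ y = comb (mons xs j) c.
Proof. by rewrite /Qp iterSr iter_QsP //; apply: Qs_submod; apply: full_submod. Qed.

Lemma Qp_comb X xs j (c : nat -> X) : Qp xs j (comb (mons xs j) c).
Proof. by apply/QpP; exists c. Qed.

Lemma Qp_mem X xs j w (y : X) : w \in mons xs j -> Qp xs j (w *: y).
Proof.
move=> wj; have ij : (index w (mons xs j) < size (mons xs j))%N by rewrite index_mem.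
by apply/QpP; exists (fun k => if k == index w (mons xs j) then y else 0);
  rewrite comb_delta // nth_index.
Qed.

Lemma Qp_memS X xs j w (y : X) : w \in mons xs j -> Qs xs full y -> Qp xs j.+1 (w *: y).
Proof.
move=> wj Qy; have ij : (index w (mons xs j) < size (mons xs j))%N by rewrite index_mem.
apply/QpSP; exists (fun k => if k == index w (mons xs j) then y else 0).
split; last by rewrite comb_delta // nth_index.
move=> i _; case: eqP => // _; apply: submod0; apply: Qs_submod; exact: full_submod.
Qed.

Fixpoint weakly_regular X xs : Prop :=
  if xs is x :: t then
    (forall y : X, Qs t full (x *: y) -> Qs t full y) /\ weakly_regular X t
  else True.

(** The canonical map onto Q^j X/Q^(j+1) X from a sum of copies of X/QX, one for each monomial of
    degree j, is injective. *)
Definition quasi_regular X xs j : Prop := forall c : nat -> X,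
  Qp xs j.+1 (comb (mons xs j) c) ->
  forall i, (i < size (mons xs j))%N -> Qs xs full (c i).

(** Induction on the sequence, then on the degree: a relation is split into the monomials without x
    and those divisible by x, and each part is reduced to one of the two induction hypotheses. *)
Lemma weakly_regular_quasi X xs : weakly_regular X xs -> forall j, quasi_regular X xs j.
Proof.
elim: xs => [_ [|j] c //= c0 [|] // _|x t IHt [xreg /IHt{IHt} tq]].
  by move: c0; rewrite comb1 scale1r.
(* Quasi-regularity of [t] turns regularity of x modulo (t) into regularity modulo (t)^j. *)
have xregQ j (y : X) : Qp t j (x *: y) -> Qp t j y.
  elim: j => // j IH xy.
  have /IH/QpP[c yE] : Qp t j (x *: y) by apply: Qp_le xy; apply: leqnSn.
  apply/QpSP; exists c; split=> // i ij; apply: xreg.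
  by apply: (tq j (fun i => x *: c i)) ij; rewrite combZ -yE.
have subt (y : X) : Qs t full y -> Qs (x :: t) full y.
  by apply: Qs_sub_seq => // z zt; rewrite inE zt orbT.
have sQ := Qs_submod (x :: t) (full_submod X).
elim=> [|j IHj] c; first by rewrite !mons0 comb1 scale1r => c0 [|].
case/QpSP=> e [Qe cE] i iS.
suff Qf k : (k < size (mons (x :: t) j.+1))%N -> Qs (x :: t) full (c k - e k).
  by rewrite -(subrK (e i) (c i)); apply: submodD => //; [apply: Qf|apply: Qe].
pose f k := c k - e k; rewrite -/(f k).
(* After subtraction of [e], whose coefficients lie in (x, t)X, the relation is exact. Its part
   divisible by x is x h; so x h lies in (t)^(j+1) X, and therefore h does. *)
have : comb (mons (x :: t) j.+1) f = 0 by rewrite combB cE subrr.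
rewrite monsS comb_cat comb_map; set f' := fun i => f (_ + i)%N.
set h := comb _ f'; move/eqP; rewrite addr_eq0 => /eqP fE.
have th : Qp t j.+1 h.
  apply: xregQ; rewrite -[_ *: _]opprK -fE.
  by apply: submodN; [apply: Qp_submod|apply: Qp_comb].
have /QpP[g hE] := th.
have Qf' := IHj f' (Qp_sub_seq (fun z zt => mem_behead (s := x :: t) zt) th).
rewrite size_cat size_map => kS; have [kt|tk] := ltnP k (size (mons t j.+1)).
  (* Writing h over the monomials in [t] gives a relation among these monomials alone. *)
  have : Qs t full (f k + x *: g k).
    apply: (tq j.+1 (fun k => f k + x *: g k)) kt.
    rewrite (_ : comb _ _ = 0); first by apply: submod0; apply: Qp_submod.
    rewrite /comb; under eq_bigr do rewrite scalerDr.
    by rewrite big_split /= -/(comb _ f) -/(comb _ (fun k => x *: g k)) combZ -hE fE addNr.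
  move/subt; rewrite addrC; apply: submodDr => //.
  by apply: Qs_mem; rewrite ?mem_head.
have -> : f k = f' (k - size (mons t j.+1))%N by rewrite /f' subnKC.
by apply: Qf'; rewrite ltn_subLR.
Qed.

End Powers.

Arguments Qp_submod {B X}.
Arguments Qp : simpl never.
Arguments mons : simpl never.

(** * The filtration by powers, and change of rings *)

Section Coordinates.
Variable B : comPzRingType.
Implicit Types (X Y : lmodType B) (xs : seq B).

Lemma Qs_linear X Y (g : {linear X -> Y}) xs (U : X -> Prop) (V : Y -> Prop) :
  (forall y, U y -> V (g y)) -> forall y, Qs xs U y -> Qs xs V (g y).
Proof.
move=> UV; elim: xs => /= [y ->|x t IH y [u [v [Uu tv ->]]]]; first exact: linear0.
by exists (g u), (g v); rewrite linearD linearZ; split=> //; [apply: UV|apply: IH].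
Qed.

Lemma Qp_linear X Y (g : {linear X -> Y}) xs j y : Qp xs j y -> Qp xs j (g y).
Proof. by elim: j y => // j IH y; apply: Qs_linear. Qed.

Lemma ffunBE (I : finType) X (f g : {ffun I -> X}) j : (f - g) j = f j - g j.
Proof. by rewrite !ffunE. Qed.

Section Product.
Variables (I : finType) (X Y : lmodType B).
Variables (pr : I -> {linear Y -> X}) (inj : I -> {linear X -> Y}).
Hypothesis prK : forall y, y = \sum_b inj b (pr b y).

(** Abstract projections and injections serve both finite functions and row vectors. *)
Lemma Qp_prod xs j y : (forall b, Qp xs j (pr b y)) <-> Qp xs j y.
Proof.
split=> [h|h b]; last exact: Qp_linear.
rewrite (prK y); apply: (submod_sum (Qp_submod _ _)) => b _.
exact: Qp_linear.
Qed.

Lemma quasi_regular_prod xs j : quasi_regular X xs j -> quasi_regular Y xs j.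
Proof.
move=> h c /Qp_prod Qc i ij; apply/(Qp_prod xs 1) => b.
by apply: (h (pr b \o c)) => //; rewrite -comb_morph.
Qed.

End Product.

Section FfunProduct.
Variables (p : nat) (X : lmodType B).

Definition ffun_pr (b : 'I_p) (f : {ffun 'I_p -> X}) : X := f b.
Lemma ffun_pr_linear b : linear (ffun_pr b).
Proof. by move=> a u v; rewrite /ffun_pr !ffunE. Qed.
HB.instance Definition _ b := GRing.isLinear.Build B _ _ _ _ (ffun_pr_linear b).

Definition ffun_inj (b : 'I_p) (y : X) : {ffun 'I_p -> X} :=
  [ffun k => if k == b then y else 0].
Lemma ffun_inj_linear b : linear (ffun_inj b).
Proof.
move=> a u v; apply/ffunP => k; rewrite !ffunE; case: ifP => //.
by rewrite scaler0 addr0.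
Qed.
HB.instance Definition _ b := GRing.isLinear.Build B _ _ _ _ (ffun_inj_linear b).

Lemma ffun_prK f : f = \sum_b ffun_inj b (ffun_pr b f).
Proof.
apply/ffunP => k; rewrite sum_ffunE (bigD1 k) //= big1 ?addr0 ?ffunE ?eqxx // => j jk.
by rewrite ffunE eq_sym (negPf jk).
Qed.

Lemma pw_Qp xs j (f : {ffun 'I_p -> X}) : pw (Qp xs j) f <-> Qp xs j f.
Proof.
exact: (Qp_prod (pr := fun b => ffun_pr b : {linear _ -> _})
  (inj := fun b => ffun_inj b : {linear _ -> _}) ffun_prK).
Qed.

Lemma quasi_regular_ffun xs j : quasi_regular X xs j -> quasi_regular {ffun 'I_p -> X} xs j.
Proof.
exact: (quasi_regular_prod (pr := fun b => ffun_pr b : {linear _ -> _})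
  (inj := fun b => ffun_inj b : {linear _ -> _}) ffun_prK).
Qed.

End FfunProduct.

Section RowProduct.
Variables (p : nat).

Definition row_pr (b : 'I_p) (f : 'rV[B]_p) : B^o := f 0 b.
Lemma row_pr_linear b : linear (row_pr b).
Proof. by move=> a u v; rewrite /row_pr !mxE. Qed.
HB.instance Definition _ b := GRing.isLinear.Build B _ _ _ _ (row_pr_linear b).

Definition row_inj (b : 'I_p) (y : B^o) : 'rV[B]_p := y *: delta_mx 0 b.
Lemma row_inj_linear b : linear (row_inj b).
Proof. by move=> a u v; rewrite /row_inj scalerDl scalerA. Qed.
HB.instance Definition _ b := GRing.isLinear.Build B _ _ _ _ (row_inj_linear b).

Lemma row_prK f : f = \sum_b row_inj b (row_pr b f).
Proof. exact: row_sum_delta. Qed.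

Lemma row_Qp xs j (f : 'rV[B]_p) : (forall b, Qp xs j (f 0 b : B^o)) <-> Qp xs j f.
Proof.
exact: (Qp_prod (pr := fun b => row_pr b : {linear _ -> _})
  (inj := fun b => row_inj b : {linear _ -> _}) row_prK).
Qed.

Lemma quasi_regular_row xs j : quasi_regular B^o xs j -> quasi_regular 'rV[B]_p xs j.
Proof.
exact: (quasi_regular_prod (pr := fun b => row_pr b : {linear _ -> _})
  (inj := fun b => row_inj b : {linear _ -> _}) row_prK).
Qed.

End RowProduct.

Definition rowmul p q (A : 'M[B]_(p, q)) (v : 'rV[B]_p) : 'rV[B]_q := v *m A.
HB.instance Definition _ p q (A : 'M[B]_(p, q)) :=
  GRing.isLinear.Build B _ _ _ (rowmul A) (mulmxr_linear A).

End Coordinates.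

(** * Annihilation of cohomology along the filtration by powers *)

Section Filtration.
Variables (B : comPzRingType) (r : nat -> nat)
          (D : forall i, 'M[B]_(r i.+1, r i)).
Hypothesis cD : is_cplx D.
Variables (xs : seq B) (X : lmodType B).
Local Notation Q j := (Qp xs j : X -> Prop).

Let sQ j : submod (Q j) := Qp_submod xs j.

(** By quasi-regularity Q^j X/Q^(j+1) X is a sum of copies of X/QX, and the same power of [a] works
    for each copy. *)
Lemma kills_layer a i j : quasi_regular X xs j ->
  kills D a i full (Q 1) -> kills D a i (Q j) (Q j.+1).
Proof.
move=> qr [k hk]; exists k => f [/pw_Qp/QpP[F ->] ].
rewrite comb_morph => /pw_Qp/(quasi_regular_ffun qr) DF.
have /choice[G GP] m : exists g, (m < size (mons xs j))%N ->
    pw (Q 1) (a ^+ k *: F m - mact (D i) g).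
  have [mj|] := boolP (m < _)%N; last by exists 0.
  have [|g [_ gP]] := hk (F m); last by exists g.
  by split=> //; apply/pw_Qp/DF.
exists (comb (mons xs j) G); split; first by apply/pw_Qp; apply: Qp_comb.
apply/pw_Qp; rewrite -combZ (comb_morph (mact (D i))) -combB; apply/QpSP.
by exists (fun m => a ^+ k *: F m - mact (D i) (G m)); split=> // m mj; apply/(pw_Qp _ 1)/GP.
Qed.

(** As soon as there is a monomial, X/QX is a summand of Q^j X/Q^(j+1) X: the copy that belongs to
    the first one. *)
Lemma kills_unlayer a i j : quasi_regular X xs j -> (0 < size (mons xs j))%N ->
  kills D a i (Q j) (Q j.+1) -> kills D a i full (Q 1).
Proof.
move=> qr j0 [k hk]; exists k => f [_ Df].
pose F m := if m == 0%N then f else 0.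
have [|_ [/pw_Qp/QpP[G ->]]] := hk (comb (mons xs j) F).
  split; first by apply/pw_Qp; apply: Qp_comb.
  rewrite comb_morph; apply/pw_Qp/QpSP; exists (mact (D i.+1) \o F); split=> // m _ /=.
  apply/(pw_Qp _ 1); rewrite /F; case: eqP => // _.
  by rewrite linear0; apply: submod0; apply: pw_submod.
rewrite -combZ (comb_morph (mact (D i))) -combB => /pw_Qp.
move=> /(quasi_regular_ffun qr)/(_ 0%N j0)/(pw_Qp _ 1).
by rewrite /= => h; exists (G 0%N).
Qed.

Lemma kills_quot a i l : (forall j, (j < l)%N -> quasi_regular X xs j) ->
  kills D a i full (Q 1) -> kills D a i full (Q l).
Proof.
elim: l => [|l IH] qr h.
  by exists 0%N => f _; exists 0.
apply: (kills_ext cD (V := Q l)) => //.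
- by move=> y; apply: Qp_le.
- by apply: kills_layer => //; apply: qr.
- by apply: IH => // j jl; apply: qr; apply: ltnW.
Qed.

End Filtration.

(** * Exactness of F/Q^j F *)

Section RowsModQ.
Variables (B : comPzRingType) (r : nat -> nat)
          (D : forall i, 'M[B]_(r i.+1, r i)) (xs : seq B).
Hypothesis cD : is_cplx D.

Definition row_exact_mod j := forall i (v : 'rV[B]_(r i.+1)),
  Qp xs j (v *m D i) -> exists w, Qp xs j (v - w *m D i.+1).

(** Modulo boundaries a cycle lies in Q^j F. By quasi-regularity its coefficients on the monomials
    are cycles modulo Q, and these are boundaries modulo Q. *)
Lemma row_exact_modS j : quasi_regular B^o xs j ->
  row_exact_mod 1 -> row_exact_mod j -> row_exact_mod j.+1.
Proof.
move=> qr ex1 exj i v hv.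
have [|w] := exj i v; first exact: Qp_le hv.
move=> /QpP[c qE].
have : Qp xs j.+1 (comb (mons xs j) (rowmul (D i) \o c)).
  rewrite -comb_morph -qE /= /rowmul mulmxBl -mulmxA cD mulmx0 subr0 //.
move=> /(quasi_regular_row qr) hc.
have /choice[g gP] m : exists g, (m < size (mons xs j))%N -> Qp xs 1 (c m - g *m D i.+1).
  have [mj|] := boolP (m < _)%N; last by exists 0.
  by have [|g gP] := ex1 i (c m); [exact: hc|exists g].
exists (w + comb (mons xs j) g).
rewrite mulmxDl opprD addrA qE -/(rowmul _ (comb _ _)) comb_morph -combB.
by apply/QpSP; exists (fun m => c m - (rowmul (D i.+1) \o g) m).
Qed.

Lemma row_exact_modP l : (forall j, (j < l)%N -> quasi_regular B^o xs j) ->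
  row_exact_mod 1 -> forall j, (j <= l)%N -> row_exact_mod j.
Proof.
move=> qr ex1; elim=> [_ i v _|j IH jl]; first by exists 0.
by apply: row_exact_modS => //; [apply: qr|apply: IH; apply: ltnW].
Qed.

Variables (M : lmodType B) (eps : {linear 'rV[B]_(r 0) -> M}).
Hypothesis eps_surj : surjective eps.
Hypothesis eps_ker : forall v, eps v = 0 <-> exists w, v = w *m D 0.

Lemma Qs_lift (X Y : lmodType B) (g : {linear X -> Y}) (U : X -> Prop) (V : Y -> Prop) :
  (forall y, V y -> exists x, U x /\ g x = y) ->
  forall y, Qs xs V y -> exists x, Qs xs U x /\ g x = y.
Proof.
move=> UV; elim: xs => /= [y ->|x t IH y [u [v [Vu tv ->]]]]; first by exists 0; rewrite linear0.
have [u' [Uu' u'E]] := UV u Vu; have [v' [tv' v'E]] := IH v tv.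
exists (x *: u' + v'); split; last by rewrite linearD linearZ /= u'E v'E.
by exists u', v'.
Qed.

Lemma Qp_lift (X Y : lmodType B) (g : {linear X -> Y}) j y : surjective g ->
  Qp xs j y -> exists x, Qp xs j x /\ g x = y.
Proof.
move=> gs; elim: j y => [y _|j IH y]; first by have [x <-] := gs y; exists x.
exact: Qs_lift.
Qed.

(** The coefficients are lifted to F. The relation then holds in F up to the boundary of some t that
    is a cycle modulo Q^j; by exactness t may be taken in Q^j F and absorbed into the
    coefficients. *)
Lemma quasi_regular_coker j : quasi_regular B^o xs j ->
  row_exact_mod j -> row_exact_mod 1 -> quasi_regular M xs j.
Proof.
move=> qr exj ex1 c hc i ij.
have /choice[v vE] : forall m, exists v, eps v = c m by move=> m; apply: eps_surj.
have [u [Qu uE]] := Qp_lift eps_surj hc.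
have [|t tE] := (eps_ker (comb (mons xs j) v - u)).1.
  rewrite linearB /= uE comb_morph; apply/eqP; rewrite subr_eq0; apply/eqP.
  by apply: eq_bigr => k _; rewrite /= vE.
have [|w /QpP[q qE]] := exj 0%N t.
  rewrite -tE; apply: submodB; [exact: Qp_submod|exact: Qp_comb|].
  by apply: Qp_le Qu.
have : Qp xs j.+1 (comb (mons xs j) (fun m => v m - (rowmul (D 0) \o q) m)).
  rewrite combB -comb_morph -qE /= /rowmul mulmxBl -mulmxA cD mulmx0 subr0 -tE.
  by rewrite subKr.
move=> /(quasi_regular_row qr)/(_ i ij) /(Qp_linear (j := 1) eps).
rewrite linearB /= vE [X in _ - X](_ : _ = 0) ?subr0 //.
by apply/eps_ker; exists (q i).
Qed.

End RowsModQ.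

(** * Surjective ring maps and semilinear maps *)

Section Semilinear.
Variables (B B' : comPzRingType) (phi : {rmorphism B -> B'}).
Hypothesis phi_surj : surjective phi.

Definition semilinear (X : lmodType B) (Y : lmodType B') (rho : X -> Y) :=
  forall a u v, rho (a *: u + v) = phi a *: rho u + rho v.

Section Fixed.
Variables (X : lmodType B) (Y : lmodType B') (rho : X -> Y).
Hypothesis rs : semilinear rho.

Lemma semilinear0 : rho 0 = 0.
Proof.
have := rs 1 0 0; rewrite scaler0 add0r rmorph1 scale1r => /eqP.
by rewrite -subr_eq0 opprD addNKr oppr_eq0 => /eqP.
Qed.

Lemma semilinearD u v : rho (u + v) = rho u + rho v.
Proof. by rewrite -[u]scale1r rs rmorph1 !scale1r. Qed.

Lemma semilinearZ a u : rho (a *: u) = phi a *: rho u.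
Proof. by rewrite -[_ *: u]addr0 rs semilinear0 addr0. Qed.

Lemma semilinearB u v : rho (u - v) = rho u - rho v.
Proof. by rewrite semilinearD -scaleN1r semilinearZ rmorphN1 scaleN1r. Qed.

Lemma semilinear_sum I (s : seq I) (P : pred I) (F : I -> X) :
  rho (\sum_(i <- s | P i) F i) = \sum_(i <- s | P i) rho (F i).
Proof. by elim/big_rec2: _ => [|i y1 y2 _ <-]; rewrite ?semilinear0 ?semilinearD. Qed.

Lemma semilinear_mact p q (A : 'M[B]_(p, q)) (f : {ffun 'I_q -> X}) :
  mact (map_mx phi A) [ffun j => rho (f j)] = [ffun j => rho (mact A f j)].
Proof.
apply/ffunP => i; rewrite !ffunE semilinear_sum; apply: eq_bigr => j _.
by rewrite mxE ffunE semilinearZ.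
Qed.

Lemma semilinear_Qs xs (U : X -> Prop) (V : Y -> Prop) :
  (forall y, U y -> V (rho y)) -> forall y, Qs xs U y -> Qs [seq phi x | x <- xs] V (rho y).
Proof.
move=> UV; elim: xs => /= [y ->|x t IH y [u [v [Uu tv ->]]]]; first exact: semilinear0.
by exists (rho u), (rho v); rewrite rs; split=> //; [apply: UV|apply: IH].
Qed.

Lemma semilinear_Qs_lift xs (U : X -> Prop) (V : Y -> Prop) :
  (forall y, V y -> exists x, U x /\ rho x = y) ->
  forall y, Qs [seq phi x | x <- xs] V y -> exists x, Qs xs U x /\ rho x = y.
Proof.
move=> UV; elim: xs => /= [y ->|x t IH y [u [v [Vu tv ->]]]].
  by exists 0; rewrite semilinear0.
have [u' [Uu' u'E]] := UV u Vu; have [v' [tv' v'E]] := IH v tv.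
exists (x *: u' + v'); split; last by rewrite rs u'E v'E.
by exists u', v'.
Qed.

Lemma semilinear_Qp xs j y : Qp xs j y -> Qp [seq phi x | x <- xs] j (rho y).
Proof. by elim: j y => // j IH y; apply: semilinear_Qs. Qed.

Hypothesis rho_surj : surjective rho.

Lemma semilinear_Qp_lift xs j y :
  Qp [seq phi x | x <- xs] j y -> exists x, Qp xs j x /\ rho x = y.
Proof.
elim: j y => [y _|j IH y]; first by have [x <-] := rho_surj y; exists x.
exact: semilinear_Qs_lift.
Qed.

Variable U : X -> Prop.
Hypothesis rho_ker : forall y, rho y = 0 <-> U y.

Lemma semilinear_ffun_lift (I : finType) (f : {ffun I -> Y}) :
  exists g : {ffun I -> X}, f = [ffun j => rho (g j)].
Proof.
have /choice[g gP] : forall j, exists y, rho y = f j by move=> j; apply: rho_surj.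
by exists (finfun g); apply/ffunP => j; rewrite !ffunE gP.
Qed.

(** Since [rho] identifies Y with X/U, the reduced matrices acting on Y and the original ones acting
    on X/U give the same complex. *)
Lemma semilinear_acyc r (D : forall i, 'M[B]_(r i.+1, r i)) i :
  acyc (fun i => map_mx phi (D i)) Y i <-> coh0 D i full U.
Proof.
split=> [h f [_ Uf]|h f f0].
  have [|g] := h [ffun j => rho (f j)].
    by rewrite semilinear_mact; apply/ffunP => j; rewrite ffunE [RHS]ffunE; apply/rho_ker.
  have [g' ->] := semilinear_ffun_lift g; rewrite semilinear_mact => /ffunP E.
  exists g'; split=> // j; apply/rho_ker; have := E j; rewrite ffunE [RHS]ffunE => fE.
  by rewrite ffunBE semilinearB fE subrr.
have [g gE] := semilinear_ffun_lift f; subst f.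
have [|g' [_ g'P]] := h g.
  split=> // j; apply/rho_ker; move/ffunP/(_ j): f0.
  by rewrite semilinear_mact ffunE [RHS]ffunE.
exists [ffun j => rho (g' j)]; rewrite semilinear_mact; apply/ffunP => j.
rewrite ffunE [RHS]ffunE; apply/eqP; rewrite -subr_eq0; apply/eqP.
by have /rho_ker := g'P j; rewrite ffunBE semilinearB.
Qed.

End Fixed.

Lemma map_mons xs j : mons [seq phi x | x <- xs] j = [seq phi w | w <- mons xs j].
Proof.
elim: xs j => [|x t IH] [|j]; rewrite ?mons0 /= ?rmorph1 //.
elim: j => [|j IHj]; rewrite [LHS]monsS [in RHS]monsS map_cat IH -map_comp.
  by rewrite !mons0 /= !mulr1.
rewrite IHj -map_comp; congr (_ ++ _).
by apply: eq_map => w /=; rewrite rmorphM.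
Qed.

Lemma rmorph_semilinear : semilinear (phi : B^o -> B'^o).
Proof. by move=> a u v; rewrite rmorphD rmorphM. Qed.

Lemma lift_mx p q (A : 'M[B']_(p, q)) : exists A' : 'M[B]_(p, q), A = map_mx phi A'.
Proof.
have /choice[g gP] : forall a, exists b, phi b = a by exact: phi_surj.
by exists (map_mx g A); apply/matrixP => i j; rewrite !mxE gP.
Qed.

Section Reduction.
Variables (X : lmodType B) (U : X -> Prop).
Hypothesis sU : submod U.
Hypothesis kU : forall a, phi a = 0 -> forall y : X, U (a *: y).

(** This is X/U, with scalars of [B'] acting through lifts to [B]; the choice of the lift does not
    matter because the kernel of [phi] sends X into U. *)
Lemma reduction_exists : exists (Y : lmodType B') (rho : X -> Y),
  [/\ semilinear rho, surjective rho & forall y, rho y = 0 <-> U y].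
Proof.
have /choice[lift liftK] : forall b, exists a, phi a = b by exact: phi_surj.
pose T := @Quotient.quot X (submod_pred sU).
pose p (x : X) : T := \pi_T x.
have pP x y : p x = p y <-> U (x - y).
  split=> [e|Uxy].
    by have /asboolP : x - y \in submod_pred sU by rewrite Quotient.idealrBE; apply/eqP.
  have : x - y \in submod_pred sU by apply/asboolP.
  by rewrite Quotient.idealrBE => /eqP.
have pD x y : p x + p y = p (x + y) by rewrite /p raddfD.
pose sc (b : B') (t : T) : T := p (lift b *: repr t).
have scp a b x : phi a = b -> sc b (p x) = p (a *: x).
  move=> ab; apply/pP; have /pP : p (repr (p x)) = p x by apply: reprK.
  set x' := repr _ => Ux.
  have -> : lift b *: x' - a *: x = lift b *: (x' - x) + (lift b - a) *: x.
    by rewrite scalerBr scalerBl addrA subrK.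
  apply: submodD => //; first exact: submodZ.
  by apply: kU; rewrite rmorphB liftK ab subrr.
have repK t : p (repr t) = t by apply: reprK.
have h1 a b v : sc a (sc b v) = sc (a * b) v.
  rewrite -[v]repK (scp (lift b) b) // (scp (lift a) a) // (scp (lift a * lift b)) ?scalerA //.
  by rewrite rmorphM !liftK.
have h2 : left_id 1 sc.
  by move=> v; rewrite -[v]repK (scp 1) ?rmorph1 // scale1r.
have h3 : right_distributive sc +%R.
  move=> a u v; rewrite -[u]repK -[v]repK pD !(scp (lift a) a) // pD.
  by rewrite scalerDr.
have h4 v a b : sc (a + b) v = sc a v + sc b v.
  rewrite -[v]repK (scp (lift a) a) // (scp (lift b) b) // pD.
  by rewrite (scp (lift a + lift b)) ?rmorphD ?liftK // scalerDl.
pose Y : lmodType B' := HB.pack T (GRing.Zmodule_isLmodule.Build B' T h1 h2 h3 h4).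
exists Y, p; split=> [a u v|t|y].
- by rewrite -pD -(scp a _ u erefl).
- by exists (repr t); apply: repK.
- by rewrite -[y in X in _ <-> X]subr0 -pP /p raddf0.
Qed.

End Reduction.
End Semilinear.

(** * Length at a prime *)

Section Length.
Variables (B : comPzRingType) (P : B -> Prop).
Hypothesis P1 : ~ P 1.
Hypothesis PM : forall a b, P (a * b) -> P a \/ P b.
Implicit Types W : lmodType B.

Lemma nPM a b : ~ P a -> ~ P b -> ~ P (a * b).
Proof. by move=> na nb /PM[]. Qed.

(** Z/Y has a nonzero localization at P. *)
Definition nontriv W (Y Z : W -> Prop) := exists z, Z z /\ forall s, ~ P s -> ~ Y (s *: z).

(* For P a prime ideal: the localization of Z/C at P has length at least k. *)
Fixpoint length_ge W k (C Z : W -> Prop) : Prop :=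
  if k is k'.+1 then
    exists Y, [/\ submod Y, forall y, C y -> Y y, forall y, Y y -> Z y,
                  length_ge k' C Y & nontriv Y Z]
  else True.

Lemma length_ge_mono W k (C Z Z' : W -> Prop) : (forall y, Z y -> Z' y) ->
  length_ge k C Z -> length_ge k C Z'.
Proof.
case: k => //= k ZZ' [Y [sY CY YZ lY [z [Zz h]]]]; exists Y; split=> // [y /YZ/ZZ' //|].
by exists z; split=> //; apply: ZZ'.
Qed.

Lemma length_ge_le W k k' (C Z : W -> Prop) : (k' <= k)%N ->
  length_ge k C Z -> length_ge k' C Z.
Proof.
elim: k Z => [|k IH] Z; first by rewrite leqn0 => /eqP->.
rewrite leq_eqVlt => /orP[/eqP-> //|/IH h [Y [sY CY YZ lY _]]].
exact: length_ge_mono YZ (h _ lY).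
Qed.

(** [Z'/C'] lies in the image of [Z/C] under [g], and chains are replaced by their inverse
    images. *)
Lemma length_ge_pull W W' (g : {linear W -> W'}) k (C Z : W -> Prop) (C' Z' : W' -> Prop) :
  submod C' -> submod Z ->
  (forall y, C y -> Z y) -> (forall y, C y -> C' (g y)) ->
  (forall y', Z' y' -> exists y, Z y /\ C' (y' - g y)) ->
  length_ge k C' Z' -> length_ge k C Z.
Proof.
move=> sC'; elim: k Z Z' => //= k IH Z Z' sZ CZ CC' ZZ' [Y' [sY' C'Y' Y'Z' lY' [z' [Z'z' h]]]].
have sY : submod (capS Z (fun y => Y' (g y))).
  apply: capS_submod => //; split; first by rewrite linear0; apply: submod0.
  by move=> a u v Yu Yv; rewrite linearP; apply: sY'.2.
exists (capS Z (fun y => Y' (g y))); split=> //.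
- by move=> y Cy; split; [apply: CZ|apply/C'Y'/CC'].
- by move=> y [].
- apply: IH lY' => // [y Cy|y' Y'y']; first by split; [apply: CZ|apply/C'Y'/CC'].
  have [y [Zy C'y]] := ZZ' y' (Y'Z' _ Y'y'); exists y; do 2!split=> //.
  by rewrite -(subKr y' (g y)); apply: submodB => //; apply: C'Y'.
have [z [Zz C'z]] := ZZ' z' Z'z'; exists z; split=> // s ns [_]; rewrite linearZ => Y'z.
apply: (h s ns); rewrite -(subrK (g z) z') scalerDr; apply: submodD => //.
by apply: submodZ => //; apply: C'Y'.
Qed.

(** No nonzero class of [Z/C] has a representative sent into [C']; so the images of the terms of a
    chain, enlarged by [C'], still increase at P. *)
Lemma length_ge_push W W' (g : {linear W -> W'}) k (C Z : W -> Prop) (C' Z' : W' -> Prop) :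
  submod C' -> submod Z' -> submod C -> submod Z ->
  (forall y, C' y -> Z' y) -> (forall y, C y -> Z y) -> (forall y, Z y -> Z' (g y)) ->
  (forall y, Z y -> C' (g y) -> C y) ->
  length_ge k C Z -> length_ge k C' Z'.
Proof.
move=> sC' sZ' sC; elim: k Z Z' sZ' => //= k IH Z Z' sZ' sZ C'Z' CZ ZZ' ZC.
move=> [Y [sY CY YZ lY [z [Zz h]]]].
pose gY y' := exists y, Y y /\ g y = y'.
have sgY : submod gY.
  split; first by exists 0; rewrite linear0; split=> //; apply: submod0.
  move=> a _ _ [u [Yu <-]] [v [Yv <-]]; exists (a *: u + v); rewrite linearP.
  by split=> //; apply: sY.2.
exists (addS gY C'); split.
- exact: addS_submod.
- by move=> y; apply: addSr.
- by move=> _ [_ [v [[u [Yu <-]] C'v ->]]]; apply: submodD => //; [apply/ZZ'/YZ|apply: C'Z'].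
- apply: IH lY => //; first exact: addS_submod.
  + by move=> y; apply: addSr.
  + by move=> y Yy; apply: addSl => //; exists y.
  + by move=> y /YZ; apply: ZC.
exists (g z); split=> [|s ns [_ [v [[u [Yu <-]] C'v szE]]]]; first exact: ZZ'.
apply: (h s ns); rewrite -(subrK u (s *: z)); apply: submodD => //; apply: CY.
apply: ZC; first by apply: submodB => //; [apply: submodZ|apply: YZ].
by rewrite linearB linearZ /= szE addrC addKr.
Qed.

Lemma length_ge_cat W k1 k2 (C Y Z : W -> Prop) : (forall y, C y -> Y y) ->
  length_ge k1 C Y -> length_ge k2 Y Z -> (forall y, Y y -> Z y) -> length_ge (k1 + k2) C Z.
Proof.
move=> CY lY; elim: k2 Z => [|k2 IH] Z; first by rewrite addn0 => _ YZ; apply: length_ge_mono lY.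
move=> [X [sX YX XZ lX nX]] YZ; rewrite addnS; exists X; split=> //; first by move=> y /CY/YX.
exact: IH.
Qed.

(** Additivity of length: a step from X to Z that is nontrivial at P remains so either between the
    intersection of X with Y and Y, or between X + Y and Z. *)
Lemma length_ge_split W k (C Y Z : W -> Prop) :
  submod C -> submod Y -> submod Z -> (forall y, C y -> Y y) -> (forall y, Y y -> Z y) ->
  length_ge k C Z -> exists k1 k2, [/\ (k1 + k2)%N = k, length_ge k1 C Y & length_ge k2 Y Z].
Proof.
move=> sC; elim: k Y Z => [|k IH] Y Z sY sZ CY YZ /=; first by exists 0%N, 0%N.
move=> [X [sX CX XZ lX [z [Zz h]]]].
have sYX := capS_submod sY sX.
have [||k1 [k2 [<- l1 l2]]] := IH (capS Y X) X sYX sX _ _ lX.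
- by move=> y Cy; split; [apply: CY|apply: CX].
- by move=> y [].
have sYaX := addS_submod sY sX.
have YaXZ y : addS Y X y -> Z y.
  by move=> [u [v [/YZ Zu /XZ Zv ->]]]; apply: submodD.
have l2' : length_ge k2 Y (addS Y X).
  apply: (length_ge_push (g := idfun)) l2 => //= y; first exact: addSl.
  - by case.
  - exact: addSr.
have [nY|nnY] := pselect (nontriv (capS Y X) Y).
  exists k1.+1, k2; rewrite addSn; split=> //; last exact: length_ge_mono l2'.
  exists (capS Y X); split=> // [y Cy|y []//].
  by split; [apply: CY|apply: CX].
exists k1, k2.+1; rewrite addnS; split=> //; first by apply: length_ge_mono l1 => y [].
exists (addS Y X); split=> // [y|]; first exact: addSl.
exists z; split=> // s ns [u [v [Yu Xv szE]]]; apply: nnY; exists u; split=> // t nt [_ Xtu].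
apply: (h (t * s)); first exact: nPM.
by rewrite -scalerA szE scalerDr; apply: submodD => //; apply: submodZ.
Qed.

Section Finite.
Variables (W : lmodType B) (C Z : W -> Prop) (s : B) (gens : seq B).
Hypotheses (nW : noeth_mod W) (sC : submod C) (sZ : submod Z).
Hypothesis CZ : forall y, C y -> Z y.
Hypothesis ns : ~ P s.
Hypothesis Pgens : forall a, P a -> span (gens : seq B^o) a.
Hypothesis nil : forall a, a \in gens -> exists k, forall z, Z z -> C ((s * a) ^+ k *: z).

(** Once s is inverted, a power of P kills Z/C. So there is a chain from C to Z with cyclic
    quotients killed by s P, and each of them contributes at most 1 to the length. *)
Lemma length_finite : exists k, ~ length_ge k C Z.
Proof.
(* Noetherian induction climbs from C, where the length is 0, to Z. *)
suff H : forall Y : W -> Prop, submod Y -> (forall y, C y -> Y y) -> (forall y, Y y -> Z y) ->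
    (exists k, ~ length_ge k C Y) -> exists k, ~ length_ge k C Z.
  apply: (H C) => //; exists 1%N; move=> [Y [sY CY YC _ [z [Cz h]]]].
  by apply: (h 1 P1); rewrite scale1r; apply: CY.
apply: noeth_ind => // Y sY IH CY YZ [k nk].
have [ZY|] := pselect (forall z, Z z -> Y z).
  by exists k => lZ; apply: nk; apply: length_ge_mono lZ.
move/existsNP=> [z /not_implyP[Zz nYz]].
(* For each generator a of P in turn, the element is multiplied by the highest power of s a that
   leaves it outside Y. *)
have [w [Zw nYw hw]] : exists w, [/\ Z w, ~ Y w & forall a, P a -> Y ((s * a) *: w)].
  suff [w [Zw nYw hw]] : exists w, [/\ Z w, ~ Y w &
      forall a, a \in gens -> Y ((s * a) *: w)].
    exists w; split=> // a /Pgens sa.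
    have sV : submod (fun a : B^o => Y ((s * a) *: w)).
      split; first by rewrite mulr0 scale0r; apply: submod0.
      move=> b u v Yu Yv.
      have -> : (s * (b *: u + v : B^o)) *: w = b *: ((s * u) *: w) + (s * v) *: w.
        by rewrite mulrDr scalerDl scalerA mulrCA.
      exact: sY.2.
    exact: (span_sub sV hw).
  elim: (gens) nil => [_|a t IHt nilt]; first by exists z.
  have [|w [Zw nYw hw]] := IHt; first by move=> b bt; apply: nilt; rewrite inE bt orbT.
  have [l hl] := nilt a (mem_head _ _).
  have: Y ((s * a) ^+ l *: w) by apply/CY/hl.
  elim: l {hl} => [|l IHl]; first by rewrite scale1r.
  have [/IHl //|nYl] := pselect (Y ((s * a) ^+ l *: w)).
  rewrite exprS -scalerA => Yl; exists ((s * a) ^+ l *: w); split=> //; first exact: submodZ.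
  move=> b; rewrite inE => /orP[/eqP-> //|bt].
  by rewrite scalerA mulrC -scalerA; apply: submodZ => //; apply: hw.
pose Y' y := exists u a, Y u /\ y = u + a *: w.
have sY' : submod Y'.
  split; first by exists 0, 0; rewrite scale0r addr0; split=> //; apply: submod0.
  move=> b _ _ [u [a [Yu ->]]] [v [c [Yv ->]]]; exists (b *: u + v), (b * a + c).
  by rewrite scalerDr scalerDl scalerA addrACA; split=> //; apply: sY.2.
have YY' y : Y y -> Y' y by move=> Yy; exists y, 0; rewrite scale0r addr0.
apply: (IH Y') => //.
- by exists w; split=> //; exists 0, 1; rewrite add0r scale1r; split=> //; apply: submod0.
- by move=> y /CY/YY'.
- by move=> _ [u [a [Yu ->]]]; apply: submodD => //; [apply: YZ|apply: submodZ].
exists k.+1 => lY'.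
have [k1 [k2 [E l1 l2]]] := length_ge_split sC sY sY' CY YY' lY'.
(* In a chain of two steps from Y to Y + Bw, let x = u + a w be in the middle term and witness the
   first step. If a is in P, then s x lies in Y, against the first step; otherwise a sends all of Y'
   into the middle term, against the second. *)
have k2le : (k2 <= 1)%N.
  rewrite leqNgt; apply/negP => /length_ge_le /(_ l2) {l2 k1 l1 E k2}.
  move=> [X [sX YX XY' [X0 [sX0 YX0 _ _ [x [Xx hx]]]] [x' [Y'x' hx']]]].
  have [u [a [Yu xE]]] := XY' x Xx.
  have [Pa|nPa] := pselect (P a).
    apply: (hx s ns); apply: YX0; rewrite xE scalerDr scalerA.
    by apply: submodD => //; [apply: submodZ|apply: hw].
  move: Y'x' => [u' [a' [Yu' x'E]]].
  apply: (hx' a nPa); rewrite x'E scalerDr scalerA mulrC -scalerA.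
  have -> : a *: w = x - u by rewrite xE addrC addKr.
  apply: submodD => //; apply: submodZ => //; first exact: YX.
  by apply: submodB => //; apply: YX.
apply: nk; apply: length_ge_le l1; move: E k2le.
by case: k2 {l2} => [|[|]] //; rewrite ?addn0 ?addn1 => E; [rewrite E|case: E => ->].
Qed.

End Finite.

End Length.

(** * Growth of lengths along the cohomology *)

Section MonomialCount.
Variable B : comPzRingType.

Lemma size_mons (x : B) t j : size (mons (x :: t) j) = 'C(size t + j, j).
Proof.
elim: t x j => [|y t IHt] x.
  elim=> [|j IHj]; first by rewrite mons0 bin0.
  by rewrite monsS size_cat size_map IHj add0n !binn.
elim=> [|j IHj]; first by rewrite mons0 bin0.
by rewrite monsS size_cat size_map IHj IHt /= !addSn binS !addnS.
Qed.

Lemma sum_bin_diag n l : (\sum_(j < l.+1) 'C(n + j, j) = 'C((n + l).+1, l))%N.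
Proof.
elim: l => [|l IH]; first by rewrite big_ord1 !bin0.
by rewrite big_ord_recr /= IH addnS binS addnC.
Qed.

(** With n + 1 variables and l > 0 the sum is C(n + l, l - 1), and C(n + l, l) is (n + 1)/l times as
    large. Since l + 1 is the exponent of the theorem, the hypothesis is that the exponent is at
    most the length of the sequence. *)
Lemma mons_count (xs : seq B) l : (l < size xs)%N ->
  (\sum_(j < l) size (mons xs j) < size (mons xs l))%N.
Proof.
case: xs => // x t; rewrite size_mons ltnS => lt.
under eq_bigr do rewrite size_mons.
case: l lt => [|k] kt; first by rewrite big_ord0 bin0.
rewrite sum_bin_diag -addnS.
have := mul_bin_left (size t + k.+1) k.
rewrite (_ : size t + k.+1 - k = (size t).+1)%N; last by rewrite addnS -addSn addnK.
move=> E; rewrite -(ltn_pmul2l (ltn0Sn k)) E ltn_pmul2r ?ltnS //.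
by rewrite bin_gt0 addnS ltnW // ltnS leq_addl.
Qed.

Lemma mons_count_gt0 (xs : seq B) l : (l < size xs)%N -> (0 < size (mons xs l))%N.
Proof. by move/mons_count; apply: leq_ltn_trans. Qed.

End MonomialCount.

(** * Lengths of the cohomology of the layers *)

Section LengthFiltration.
Variables (B : comPzRingType) (r : nat -> nat)
          (D : forall i, 'M[B]_(r i.+1, r i)).
Hypothesis cD : is_cplx D.
Variables (xs : seq B) (X : lmodType B).
Local Notation Q j := (Qp xs j : X -> Prop).
Variable P : B -> Prop.
Hypothesis P1 : ~ P 1.
Hypothesis PM : forall a b, P (a * b) -> P a \/ P b.

Definition coh_length_ge k i (V U : X -> Prop) := length_ge P k (cobd D i V U) (cocyc D i V U).

Let sQ j : submod (Q j) := Qp_submod xs j.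
Let sfull : submod (@full B X) := full_submod X.

Lemma coboundary_cocycle i (V U : X -> Prop) f : submod V -> submod U ->
  (forall y, U y -> V y) -> cobd D i V U f -> cocyc D i V U f.
Proof.
move=> sV sU UV cf; split; first exact: (cobd_in sV UV cf).
have [g [Vg Ug]] := cf; rewrite -(subrK (mact (D i) g) f) linearD /= mact_cplx // addr0.
exact: mact_pw.
Qed.

Section Layer.
Variables (i j : nat).
Hypothesis qr : quasi_regular X xs j.
Local Notation ws := (mons xs j).
Local Notation W := {ffun 'I_(r i.+1) -> X}.

(** The classes supported on the first m of the copies of X/QX that make up Q^j X/Q^(j+1) X. This
    filters the cohomology of the layer, with that of X/QX as successive quotients. *)
Definition layer m (f : W) := exists F : nat -> W,
  [/\ forall k, cocyc D i full (Q 1) (F k), forall k, (m <= k)%N -> F k = 0 &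
      cobd D i (Q j) (Q j.+1) (f - comb ws F)].

Let sC := cobd_submod D i (sQ j) (sQ j.+1).
Let sZ1 := cocyc_submod D i sfull (sQ 1).

Lemma layer_submod m : submod (layer m).
Proof.
split.
  exists (fun=> 0); split=> // [k|]; first exact: (submod0 sZ1).
  rewrite sub0r /comb big1 ?oppr0; first exact: (submod0 sC).
  by move=> k _; rewrite scaler0.
move=> a u v [F [F1 F2 F3]] [G [G1 G2 G3]]; exists (fun k => a *: F k + G k); split.
- by move=> k; apply: sZ1.2.
- by move=> k mk; rewrite F2 // G2 // scaler0 addr0.
rewrite comb_linear opprD addrACA -scalerBr; exact: sC.2.
Qed.

Lemma layer0 f : layer 0 f <-> cobd D i (Q j) (Q j.+1) f.
Proof.
have E (F : nat -> W) : (forall k, (0 <= k)%N -> F k = 0) -> comb ws F = 0.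
  by move=> F0; rewrite /comb big1 // => k _; rewrite F0 // scaler0.
split=> [[F [_ /E F0]]|cf]; first by rewrite F0 subr0.
exists (fun=> 0); split=> // [k|]; first exact: (submod0 sZ1).
by rewrite E // subr0.
Qed.

Lemma layer_full f : cocyc D i (Q j) (Q j.+1) f -> layer (size ws) f.
Proof.
move=> [/pw_Qp/QpP[F ->]]; rewrite comb_morph => /pw_Qp/(quasi_regular_ffun qr) DF.
exists (fun k => if (k < size ws)%N then F k else 0); split=> [k|k|].
- case: ifP => [kw|_]; last exact: (submod0 sZ1).
  by split=> //; apply/pw_Qp; apply: DF.
- by rewrite leqNgt => /negPf->.
rewrite [X in _ - X](_ : _ = comb ws F) ?subrr; first exact: (submod0 sC).
by apply: eq_bigr => k _; rewrite ltn_ord.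
Qed.

Lemma layer_le m m' f : (m <= m')%N -> layer m f -> layer m' f.
Proof.
move=> mm' [F [F1 F2 F3]]; exists F; split=> // k m'k.
by apply: F2; apply: leq_trans m'k.
Qed.

Lemma layer_cocyc m f : layer m f -> cocyc D i (Q j) (Q j.+1) f.
Proof.
have sZ := cocyc_submod D i (sQ j) (sQ j.+1).
move=> [F [F1 _ F3]]; rewrite -(subrK (comb ws F) f); apply: submodD => //.
  by apply: coboundary_cocycle F3 => // y; apply: Qp_le.
split; apply/pw_Qp; first exact: Qp_comb.
rewrite comb_morph; apply/QpSP; exists (mact (D i.+1) \o F); split=> // k _ /=.
by apply/(pw_Qp _ 1); case: (F1 k).
Qed.

(** Multiplication by the monomial of index m is injective from H(X/QX) to [layer m.+1] modulo
    [layer m], since quasi-regularity determines the coefficient of that monomial modulo Q. *)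
Lemma layer_push k m : (m < size ws)%N ->
  coh_length_ge k i full (Q 1) -> length_ge P k (layer m) (layer m.+1).
Proof.
move=> mw; apply: (length_ge_push (g := ws`_m \*: idfun)).
- exact: layer_submod.
- exact: layer_submod.
- exact: cobd_submod.
- exact: cocyc_submod.
- by move=> y; apply: layer_le.
- by move=> y; apply: coboundary_cocycle.
- move=> f Zf /=; exists (fun k => if k == m then f else 0); split.
  + by move=> l; case: eqP => // _; exact: (submod0 sZ1).
  + by move=> l ml; rewrite gtn_eqF.
  by rewrite comb_delta // subrr; exact: (submod0 sC).
move=> f Zf [F [F1 F2 [_ [/pw_Qp/QpP[G ->]]]]] /=.
rewrite -(comb_delta f mw) (comb_morph (mact (D i))) -!combB => /pw_Qp.
move=> /(quasi_regular_ffun qr)/(_ m mw)/(pw_Qp _ 1).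
by rewrite eqxx F2 //= subr0 => h; exists (G m).
Qed.

(** The same multiplication is onto modulo [layer m]. *)
Lemma layer_pull k m : (m < size ws)%N ->
  length_ge P k (layer m) (layer m.+1) -> coh_length_ge k i full (Q 1).
Proof.
move=> mw; have wm : ws`_m \in ws by apply: mem_nth.
apply: (length_ge_pull (g := ws`_m \*: idfun)).
- exact: layer_submod.
- exact: cocyc_submod.
- by move=> y; apply: coboundary_cocycle.
- move=> f [g [_ gP]] /=; apply: (layer_le (leq0n m)); apply/layer0.
  exists (ws`_m *: g); split; first by apply/pw_Qp; apply: Qp_mem.
  by rewrite linearZ /= -scalerBr; apply/pw_Qp; apply: Qp_memS => //; apply/(pw_Qp _ 1).
move=> f [F [F1 F2 F3]]; exists (F m); split=> //=.
exists (fun k => if k == m then 0 else F k); split=> [l|l|].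
- by case: eqP => // _; exact: (submod0 sZ1).
- by rewrite leq_eqVlt eq_sym => /orP[->//|ml]; rewrite F2 ?if_same.
rewrite -addrA -opprD -(comb_delta (F m) mw) -[comb _ _ + _]scale1r.
rewrite -(scale1r (comb _ (fun k => if k == m then F m else 0))) -comb_linear scale1r.
rewrite [X in _ - X](_ : _ = comb ws F) //; apply: eq_bigr => l _.
by rewrite scale1r; case: eqP => [->|]; rewrite ?addr0 ?add0r.
Qed.

Lemma layer_length_lower k : coh_length_ge k i full (Q 1) ->
  coh_length_ge (size ws * k) i (Q j) (Q j.+1).
Proof.
move=> lk; suff H m : (m <= size ws)%N -> length_ge P (m * k) (layer 0) (layer m).
  have := length_ge_mono (@layer_cocyc (size ws)) (H _ (leqnn _)).
  rewrite (_ : layer 0 = cobd D i (Q j) (Q j.+1)) //.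
  by apply/funext => f; apply/propext/layer0.
elim: m => // m IH mw; rewrite mulSn addnC.
apply: (length_ge_cat (Y := layer m)) (IH (ltnW mw)) _ _.
- by move=> y; apply: layer_le.
- exact: layer_push.
- by move=> y; apply: layer_le.
Qed.

Lemma layer_length_upper t k : ~ coh_length_ge t.+1 i full (Q 1) ->
  coh_length_ge k i (Q j) (Q j.+1) -> (k <= size ws * t)%N.
Proof.
move=> nt lk.
have {lk} : length_ge P k (layer 0) (layer (size ws)).
  have := length_ge_mono layer_full lk.
  rewrite (_ : layer 0 = cobd D i (Q j) (Q j.+1)) //.
  by apply/funext => f; apply/propext/layer0.
suff H m : (m <= size ws)%N -> length_ge P k (layer 0) (layer m) -> (k <= m * t)%N by apply: H.
elim: m k => [|m IH] [|k] // mw.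
  move=> [Y [sY CY YZ _ [z [Zz h]]]]; case: (h 1 P1).
  by rewrite scale1r; apply: CY.
move=> lk.
have [||k1 [k2 [<- l1 l2]]] := length_ge_split PM (layer_submod 0) (layer_submod m)
  (layer_submod m.+1) _ _ lk.
- by move=> y; apply: layer_le.
- by move=> y; apply: layer_le.
rewrite mulSn [leqRHS]addnC; apply: leq_add; first by apply: IH l1; apply: ltnW.
rewrite leqNgt; apply/negP => tk2; apply: nt; apply: (layer_pull mw).
exact: length_ge_le l2.
Qed.

End Layer.

(** The layers with j < l filter X/Q^l X, and each monomial contributes at most t. *)
Lemma quot_length_upper t k i l : (forall j, (j < l)%N -> quasi_regular X xs j) ->
  ~ coh_length_ge t.+1 i full (Q 1) ->
  coh_length_ge k i full (Q l) -> (k <= (\sum_(j < l) size (mons xs j)) * t)%N.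
Proof.
elim: l k => [|l IH] k qr nt lk.
  case: k lk => // k [Y [sY CY YZ _ [z [Zz h]]]]; case: (h 1 P1).
  by rewrite scale1r; apply: CY; exists 0.
have QS y : Q l.+1 y -> Q l y by apply: Qp_le.
(* The classes of X/Q^(l+1) X that die in X/Q^l X; they come from the last layer. *)
pose Y (f : {ffun 'I_(r i.+1) -> X}) := cocyc D i full (Q l.+1) f /\ cobd D i full (Q l) f.
have sY : submod Y.
  by apply: capS_submod; [apply: cocyc_submod|apply: cobd_submod].
have [||||k1 [k2 [<- l1 l2]]] := length_ge_split PM _ sY _ _ _ lk.
- exact: cobd_submod.
- exact: cocyc_submod.
- move=> f cf; split; first exact: coboundary_cocycle.
  by have [g [_ gP]] := cf; exists g; split=> // b; apply: QS.
- by move=> f [].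
rewrite big_ord_recr /= mulnDl [leqRHS]addnC; apply: leq_add.
  apply: (layer_length_upper _ nt); first exact: qr.
  apply: (length_ge_pull (g := idfun)) l1.
  - exact: cobd_submod.
  - exact: cocyc_submod.
  - by move=> y; apply: coboundary_cocycle.
  - by move=> f [g [_ gP]]; exists g.
  move=> f [[_ Df] [g [_ gP]]]; exists (f - mact (D i) g); split.
    by split=> //; rewrite linearB /= mact_cplx // subr0.
  exists g; split=> //; rewrite /= subKr subrr => b; rewrite ffunE; exact: submod0.
apply: (IH _ _ nt); first by move=> j jl; apply: qr; apply: ltnW.
apply: (length_ge_push (g := idfun)) l2 => //.
- exact: cobd_submod.
- exact: cocyc_submod.
- exact: cocyc_submod.
- by move=> f; apply: coboundary_cocycle.
- by move=> f [].
by move=> f [_ Df]; split=> // b; apply: QS.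
Qed.

(** The vanishing makes the connecting map from H(X/Q^l X) in index i to H(Q^l X/Q^(l+1) X) in index
    i + 1 onto. *)
Lemma conn_length k i l : coh0 D i.+1 full (Q l.+1) ->
  coh_length_ge k i.+1 (Q l) (Q l.+1) -> coh_length_ge k i full (Q l).
Proof.
move=> h; have QS y : Q l.+1 y -> Q l y by apply: Qp_le.
apply: (length_ge_pull (g := mact (D i.+1))).
- exact: cobd_submod.
- exact: cocyc_submod.
- by move=> f; apply: coboundary_cocycle.
- move=> f [g [_ gP]]; exists (f - mact (D i) g); split=> //.
  rewrite linearB /= mact_cplx // subr0 subrr => b; rewrite ffunE; exact: submod0.
move=> f [Qf Df]; have [|g [_ gP]] := h f; first by split.
exists g; split; last first.
  exists 0; rewrite linear0 subr0; split=> // b; rewrite ffunE; exact: submod0.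
split=> //; rewrite -(subKr f (mact (D i.+1) g)) => b; rewrite ffunBE.
by apply: submodB => //; apply: QS.
Qed.

(** Let b be the number of monomials of degree l and c that of the lower ones. A length of at most t
    + 1 in index i would give b(t + 1) <= c(t + 1), against c < b. So nonzero lengths grow strictly
    as the index goes down. *)
Lemma length_growth t i l : (l < size xs)%N ->
  (forall j, (j <= l)%N -> quasi_regular X xs j) ->
  coh0 D i.+1 full (Q l.+1) ->
  coh_length_ge t.+1 i.+1 full (Q 1) -> coh_length_ge t.+2 i full (Q 1).
Proof.
move=> lx qr h0 lt; apply: contrapT => nt.
have := quot_length_upper (fun j jl => qr j (ltnW jl)) nt
  (conn_length h0 (layer_length_lower (qr l (leqnn l)) lt)).
by rewrite leq_pmul2r // leqNgt mons_count.
Qed.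

End LengthFiltration.

(** * Vanishing for X/QX from vanishing for X/Q^(l+1) X *)

Section Descent.
Variables (B : comPzRingType) (r : nat -> nat)
          (D : forall i, 'M[B]_(r i.+1, r i)).
Hypothesis cD : is_cplx D.
Variables (xs : seq B) (X : lmodType B) (l : nat).
Local Notation Q j := (Qp xs j : X -> Prop).
Hypothesis qr : forall j, (j <= l)%N -> quasi_regular X xs j.

Let sQ j : submod (Q j) := Qp_submod xs j.

(** QX/Q^(j+1) X is filtered by layers, which are sums of copies of X/QX. *)
Lemma coh0_tail i j : (j <= l)%N -> coh0 D i full (Q 1) -> coh0 D i (Q 1) (Q j.+1).
Proof.
move=> jl h; apply: kills_coh0; elim: j jl => [|j IH] jl.
  exists 0%N => f [Qf _]; exists 0; rewrite linear0 subr0 expr0 scale1r; split=> //.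
  by move=> b; rewrite ffunE; apply: submod0.
apply: (kills_ext cD (V := Q j.+1)) => //.
- by move=> y; apply: Qp_le.
- by move=> y; apply: Qp_le.
- by apply: kills_layer; [exact: qr|apply: coh0_kills].
by apply: IH; apply: ltnW.
Qed.

(* From the exact sequence H^i(X/Q^(l+1)) -> H^i(X/Q) -> H^(i+1)(Q/Q^(l+1)). *)
Lemma coh0_descent i : coh0 D i full (Q l.+1) -> coh0 D i.+1 full (Q 1) ->
  coh0 D i full (Q 1).
Proof.
move=> h /(coh0_tail (leqnn l)) h1 f [_ Df].
have [|g [Qg gP]] := h1 (mact (D i.+1) f).
  by split=> // b; rewrite mact_cplx // ffunE; apply: submod0.
have [|g' [_ g'P]] := h (f - g); first by split=> //; rewrite linearB.
exists g'; split=> // b.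
have -> : (f - mact (D i) g') b = (f - g - mact (D i) g') b + g b.
  by rewrite !ffunBE addrAC subrK.
by apply: submodD => //; apply: Qp_le (g'P b).
Qed.

End Descent.

(** * The length argument: vanishing in large degrees *)

Section EventualVanishing.
Variables (B : comPzRingType) (r : nat -> nat)
          (D : forall i, 'M[B]_(r i.+1, r i)).
Hypothesis cD : is_cplx D.
Hypothesis nB : noetherian B.
Variables (xs : seq B) (X : lmodType B) (l i0 : nat).
Hypothesis fX : fin_gen X.
Local Notation Q j := (Qp xs j : X -> Prop).
Hypothesis qr : forall j, (j <= l)%N -> quasi_regular X xs j.
Hypothesis lx : (l < size xs)%N.
Hypothesis h0 : forall i, (i0 <= i)%N -> coh0 D i full (Q l.+1).

Let sQ j : submod (Q j) := Qp_submod xs j.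
Let sfull : submod (@full B X) := full_submod X.
Let sC i := cobd_submod D i sfull (sQ 1).
Let sZ i := cocyc_submod D i sfull (sQ 1).

Let kill a i := kills D a i full (Q 1).

(** Annihilation passes from X/QX to X/Q^l X, by the connecting map to the last layer one index
    higher, and from there to its summand X/QX. *)
Lemma kill_step a i : (i0 <= i)%N -> kill a i -> kill a i.+1.
Proof.
move=> ii0 h; apply: (kills_unlayer (j := l)); [exact: qr|exact: mons_count_gt0|].
apply: (kills_conn cD (W := full)) => //; first by move=> y; apply: Qp_le.
  by apply: h0; apply: leqW.
by apply: kills_quot => // j /ltnW; apply: qr.
Qed.

Lemma kill_mono a i i' : (i0 <= i)%N -> (i <= i')%N -> kill a i -> kill a i'.
Proof.
move=> ii0; elim: i' => [|i' IH]; first by rewrite leqn0 => /eqP->.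
rewrite leq_eqVlt => /orP[/eqP->//|ii'] h; apply: kill_step; last exact: IH.
exact: leq_trans ii0 ii'.
Qed.

(** By [kill_mono] one index stands for all larger ones, which is why this is an ideal. *)
Definition kill_ideal (a : B^o) := exists i, (i0 <= i)%N /\ kill a i.

Lemma kill_ideal_submod : submod kill_ideal.
Proof.
split.
  exists i0; split=> //; exists 1%N => f _; rewrite expr1 scale0r; exact: submod0.
move=> c a b [i [ii0 ha]] [j [ji0 hb]]; exists (maxn i j).
split; first by rewrite leq_max ii0.
have [k hk] := kill_mono ii0 (leq_maxl i j) ha.
have [k' hk'] := kill_mono ji0 (leq_maxr i j) hb.
exists (k + k')%N => f Zf; rewrite exprDn scaler_suml.
apply: (submod_sum (sC _)) => t _; rewrite -mulr_natl -scalerA; apply: (submodZ (sC _)).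
have [tk|kt] := leqP k' t.
  by rewrite -(subnK tk) exprD mulrA -scalerA; apply: (submodZ (sC _)); apply: hk'.
rewrite (_ : k + k' - t = (k' - t) + k)%N; last by rewrite addnBAC ?(ltnW kt) // [(k' + k)%N]addnC.
set e := (_ + k)%N; have -> : (c * a : B) ^+ e * b ^+ t = c ^+ e * a ^+ (k' - t) * b ^+ t * a ^+ k.
  by rewrite exprMn /e (exprD a (k' - t) k) !mulrA [LHS]mulrAC.
rewrite -scalerA.
by apply: (submodZ (sC _)); apply: hk.
Qed.

Lemma kill_ideal_radical a n : kill_ideal (a ^+ n) -> kill_ideal a.
Proof.
move=> [i [ii0 [k hk]]]; exists i; split=> //; exists (n * k)%N => f Zf.
by rewrite exprM; apply: hk.
Qed.

(* The colon ideal (I : s) of the radical ideal I obtained here is prime. *)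
Lemma maximal_colon : ~ kill_ideal 1 -> exists s, ~ kill_ideal s /\
  forall s', ~ kill_ideal s' -> (forall a, kill_ideal (a * s) -> kill_ideal (a * s')) ->
    forall a, kill_ideal (a * s') -> kill_ideal (a * s).
Proof.
move=> n1.
have sI := kill_ideal_submod.
have sc s : submod (fun a : B^o => kill_ideal (a * s)).
  split; first by rewrite mul0r; apply: submod0.
  by move=> a u v Iu Iv; rewrite mulrDl -mulrA; apply: sI.2.
pose Pr (U : B^o -> Prop) := forall s, ~ kill_ideal s ->
  (forall a, U a <-> kill_ideal (a * s)) -> exists s, ~ kill_ideal s /\
  forall s', ~ kill_ideal s' -> (forall a, kill_ideal (a * s) -> kill_ideal (a * s')) ->
    forall a, kill_ideal (a * s') -> kill_ideal (a * s).
suff H : forall U, submod U -> Pr U by apply: (H _ (sc 1) 1).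
apply: (noeth_ind (noeth_reg nB)) => U sU IH s ns Us.
have [h|] := pselect (forall s', ~ kill_ideal s' ->
    (forall a, kill_ideal (a * s) -> kill_ideal (a * s')) ->
    forall a, kill_ideal (a * s') -> kill_ideal (a * s)); first by exists s.
move/existsNP=> [s' /not_implyP[ns' /not_implyP[ss' /existsNP[a /not_implyP[as' nas]]]]].
apply: (IH _ (sc s')) ns' _ => //.
- by move=> b /Us/ss'.
- by exists a; split=> // /Us.
Qed.

(** Otherwise a maximal colon ideal P = (I : s) of this radical ideal I is prime, and at P the
    cohomology of X/QX has finite nonzero length in large indices, which [length_growth] forbids. *)
Lemma kill_ideal_full : kill_ideal 1.
Proof.
apply: contrapT => n1.
have sI := kill_ideal_submod.
have [s [ns smax]] := maximal_colon n1.
pose P a := kill_ideal (a * s).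
have P1 : ~ P 1 by rewrite /P mul1r.
have PM a b : P (a * b) -> P a \/ P b.
  move=> Pab; have [Pa|nPa] := pselect (P a); [by left|right].
  apply: (smax (a * s)) => // [c Pc|]; last by rewrite mulrA (mulrC b).
  by rewrite mulrCA; apply: (submodZ sI a Pc).
have nPs : ~ P s by rewrite /P -expr2 => /kill_ideal_radical.
have sP : submod (P : B^o -> Prop).
  split; first by rewrite /P mul0r; apply: submod0.
  by move=> a u v Iu Iv; rewrite /P mulrDl -mulrA; apply: sI.2.
have [gens [gP Pg]] := noeth_reg nB sP.
(* P is finitely generated, so one index serves all its generators; there the length at P is
   finite. *)
have [i1 [i1i0 hi1]] : exists i, (i0 <= i)%N /\ forall a, a \in gens -> kill (s * a) i.
  elim: gens gP {Pg} => [_|a t IH gP]; first by exists i0.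
  have [|i [ii0 hi]] := IH; first by move=> b bt; apply: gP; rewrite inE bt orbT.
  have [j [ji0 hj]] := gP a (mem_head _ _).
  exists (maxn i j); split=> [|b]; first by rewrite leq_max ii0.
  rewrite inE => /orP[/eqP->|/hi]; last by apply: kill_mono => //; apply: leq_maxl.
  by rewrite mulrC; apply: kill_mono hj => //; apply: leq_maxr.
have nW i : noeth_mod {ffun 'I_(r i.+1) -> X}.
  by apply: noeth_fin_gen => //; apply: ffun_fin_gen.
have [||k nk] := length_finite P1 PM (nW i1) (sC i1) (sZ i1) _ nPs Pg.
- by move=> f; apply: coboundary_cocycle.
- by move=> a ag; have [k hk] := hi1 a ag; exists k.
(* If the cohomology vanished at P in index i, then, being finitely generated, it would be killed by
   a single t outside P; but such a t lies in I, hence in P. *)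
apply: nk; have nt i : (i0 <= i)%N -> coh_length_ge D P 1 i full (Q 1).
  move=> ii0; exists (cobd D i full (Q 1)); split=> //.
    by move=> f; apply: coboundary_cocycle.
  apply: contrapT => no.
  have {no} H z : cocyc D i full (Q 1) z -> exists s, ~ P s /\ cobd D i full (Q 1) (s *: z).
    move=> Zz; apply: contrapT => no'; apply: no; exists z; split=> // t nt Ct.
    by apply: no'; exists t.
  have [zs [zsZ Zzs]] := nW i _ (sZ i).
  suff [t [nt ht]] : exists t, ~ P t /\ forall z, z \in zs -> cobd D i full (Q 1) (t *: z).
    apply: nt; rewrite /P mulrC; apply: (submodZ sI s); exists i; split=> //.
    exists 1%N => f /Zzs; rewrite expr1.
    apply: (span_sub (U := fun f => cobd D i full (Q 1) (t *: f))) => //.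
    split; first by rewrite scaler0; apply: (submod0 (sC i)).
    move=> a u v Cu Cv; rewrite scalerDr scalerA mulrC -scalerA.
    exact: (sC i).2.
  elim: zs zsZ {Zzs} => [_|z zs IH zsZ]; first by exists 1.
  have [|t [nt ht]] := IH; first by move=> y yz; apply: zsZ; rewrite inE yz orbT.
  have [t' [nt' ht']] := H z (zsZ z (mem_head _ _)).
  exists (t' * t); split=> [|y]; first exact: nPM.
  rewrite inE => /orP[/eqP->|/ht Cy]; last by rewrite -scalerA; apply: (submodZ (sC i)).
  by rewrite mulrC -scalerA; apply: (submodZ (sC i)).
(* Length at least 1 in index i + m grows to at least m + 1 in index i; for i = i1 and m = k this
   exceeds the bound. *)
suff H m : forall i, (i0 <= i)%N -> coh_length_ge D P m.+1 i full (Q 1).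
  by apply: length_ge_le (H k i1 i1i0).
elim: m => // m IH i ii0; apply: (length_growth cD P1 PM lx) => //.
  by apply: h0; apply: leqW.
by apply: IH; apply: leqW.
Qed.

(** Since 1 is in the ideal, the cohomology of X/QX vanishes in large indices; [coh0_descent] brings
    this down to [i0]. *)
Lemma coh0_residue i : (i0 <= i)%N -> coh0 D i full (Q 1).
Proof.
have [i1 [i1i0 h1]] := kill_ideal_full.
have up j : (i1 <= j)%N -> coh0 D j full (Q 1).
  by move=> ij; apply: kills_coh0; apply: kill_mono h1.
suff H n : forall j, (i0 <= j)%N -> (i1 <= j + n)%N -> coh0 D j full (Q 1).
  by move=> ii0; apply: (H i1) => //; apply: leq_addl.
elim: n => [|n IH] j ji0; first by rewrite addn0 => /up.
rewrite addnS -addSn => jn; apply: (coh0_descent cD (l := l)) => //; first exact: h0.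
by apply: IH => //; apply: leqW.
Qed.

End EventualVanishing.

(** * Duality for free complexes *)

Section RowsFromColumns.
Variable B : comPzRingType.

(* A complex of finite free modules whose dual is exact in positive degrees is
   exact there; Gorenstein rings have this property. *)
Definition dual_exact := forall r (D : forall i, 'M[B]_(r i.+1, r i)),
  is_cplx D -> (forall i, col_exact D i) -> row_exact D.

Lemma linear_mact (X Y : lmodType B) (g : {linear X -> Y}) p q (A : 'M[B]_(p, q))
  (f : {ffun 'I_q -> X}) :
  mact A [ffun j => g (f j)] = [ffun j => g (mact A f j)].
Proof.
apply/ffunP => i; rewrite !ffunE linear_sum; apply: eq_bigr => j _.
by rewrite ffunE linearZ.
Qed.

Lemma linear_ffun_lift (X Y : lmodType B) (g : {linear X -> Y}) (I : finType)
  (f : {ffun I -> Y}) : (forall j, exists y, g y = f j) ->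
  exists f' : {ffun I -> X}, f = [ffun j => g (f' j)].
Proof.
move=> /choice[k kP].
by exists (finfun k); apply/ffunP => j; rewrite !ffunE kP.
Qed.

Section OneComplex.
Variables (r : nat -> nat) (D : forall i, 'M[B]_(r i.+1, r i)).
Hypothesis cD : is_cplx D.
Hypothesis eD : forall i, col_exact D i.

(** Tuples in K under the transposed matrices form the tensor product of F with K. *)
Definition row_exact_in (X : lmodType B) (K : X -> Prop) :=
  forall i (v : {ffun 'I_(r i.+1) -> X}), pw K v -> mact (D i)^T v = 0 ->
  exists w, pw K w /\ v = mact (D i.+1)^T w.

(** The tensor product of F with E is Hom of the dual of F into E, and Hom into an injective module
    preserves the exactness of the dual. Concretely, [v] defines a map on the image of a transposed
    matrix, which is then extended. *)
Lemma injective_row_exact (E : lmodType B) : injective_module E ->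
  row_exact_in (@full B E).
Proof.
move=> injE i v _ v0.
pose U (a : 'rV[B]_(r i.+2)) := exists g, a = g *m (D i.+1)^T.
have sU : submod U.
  split; first by exists 0; rewrite mul0mx.
  by move=> a _ _ [g ->] [h ->]; exists (a *: g + h); rewrite mulmxDl scalemxAl.
have wd g : g *m (D i.+1)^T = 0 -> rlin v g = 0.
  move=> g0; have [|t tE] := eD (i := i) (f := g^T).
    by apply: trmx_inj; rewrite trmx_mul trmxK g0 trmx0.
  rewrite -[g]trmxK tE trmx_mul rlin_mact v0 /rlin big1 // => j _.
  by rewrite ffunE scaler0.
have /choice[c cP] : forall a : submodule sU, exists g, submodule_val a = g *m (D i.+1)^T.
  by move=> a; exact: (submodule_valP a).
have fl : linear (fun a => rlin v (c a)).
  move=> k a b; apply/eqP; rewrite -linearP -subr_eq0 -linearB; apply/eqP/wd.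
  by rewrite mulmxBl mulmxDl -scalemxAl -!cP linearP subrr.
have [f fE] := linear_of fl.
have [G GE] := injE _ _ _ f submodule_val_inj.
pose w := [ffun j => G (delta_mx 0 j)].
exists w; split=> //; apply: rlin_inj => g; rewrite -rlin_mact -rlinE.
have [a aE] := submodule_ex sU (ex_intro _ g erefl : U (g *m (D i.+1)^T)).
rewrite -aE GE fE; apply/eqP; rewrite -subr_eq0 -linearB; apply/eqP/wd.
by rewrite mulmxBl -cP aE subrr.
Qed.

(** Dimension shift along 0 -> ker g -> E -> K' -> 0: [v] is the boundary of some [w] in E, the
    image of [w] in K' is a cycle and so a boundary, and lifting this corrects [w] into the
    kernel. *)
Lemma row_exact_step (E E' : lmodType B) (g : {linear E -> E'}) (K' : E' -> Prop) :
  injective_module E -> (forall y, K' y <-> exists x, g x = y) ->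
  row_exact_in K' -> row_exact_in (fun y => g y = 0).
Proof.
move=> injE K'P exK' i v Kv v0.
have [w [_ vE]] := injective_row_exact injE (fun=> I) v0.
have [||z [Kz zE]] := exK' i.+1 [ffun j => g (w j)].
- by move=> j; rewrite ffunE; apply/K'P; exists (w j).
- by rewrite linear_mact -vE; apply/ffunP => j; rewrite ffunE Kv ffunE.
have [|z' z'E] := linear_ffun_lift (g := g) (f := z); first by move=> j; apply/K'P.
exists (w - mact (D i.+2)^T z'); split.
  move=> j; rewrite ffunBE linearB.
  by move/ffunP/(_ j): zE; rewrite z'E linear_mact ffunE [RHS]ffunE => ->; rewrite subrr.
by rewrite linearB /= mact_mul -trmx_mul cD trmx0 mact0 subr0.
Qed.

(** Beyond [d] the terms of the injective resolution are zero. [row_exact_step] goes down from there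
    to the kernel of its first map, which is the ring. *)
Lemma finite_inj_dim_row_exact : finite_inj_dim B^o -> row_exact D.
Proof.
move=> [E [d E0]].
have H k : forall n, (d < n + k)%N -> row_exact_in (fun y => ir_diff E n y = 0).
  elim: k => [|k IH] n dn.
    move=> i v _ _; exists 0; rewrite linear0; split=> [j|]; first by rewrite ffunE linear0.
    by apply/ffunP => j; rewrite ffunE; apply: (E0 n); rewrite -(addn0 n).
  apply: (row_exact_step (K' := fun y => ir_diff E n.+1 y = 0)).
  - exact: ir_injective.
  - exact: ir_exact.
  - by apply: IH; rewrite addSnnS.
have {}H := H d.+1 0%N (leqnn _).
move=> i v v0.
have vD : mact (D i)^T [ffun j => v 0 j : B^o] = 0.
  apply/ffunP => j; rewrite !ffunE; have /rowP/(_ j) := v0; rewrite !mxE => vE; rewrite -[RHS]vE.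
  by apply: eq_bigr => k _; rewrite mxE ffunE mulrC.
have [||w [Kw wE]] := H i [ffun j => ir_aug E (v 0 j : B^o)].
- by move=> j; rewrite ffunE; apply/(ir_exact0 (i := E)); exists (v 0 j).
- have := linear_mact (ir_aug E) (D i)^T [ffun j => v 0 j : B^o]; rewrite vD.
  rewrite (_ : [ffun j => ir_aug E _] = [ffun j => ir_aug E (v 0 j : B^o)]) => [->|].
    by apply/ffunP => j; rewrite !ffunE linear0.
  by apply/ffunP => j; rewrite !ffunE.
have [|w' w'E] := linear_ffun_lift (g := ir_aug E) (f := w).
  by move=> j; apply/(ir_exact0 (i := E)).
exists (\row_j w' j); apply/rowP => j; apply: (@ir_aug_inj _ _ E).
have := congr1 (fun f : {ffun _ -> _} => f j) wE; rewrite w'E linear_mact ffunE [RHS]ffunE => ->.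
rewrite !ffunE !mxE; congr (ir_aug E _); apply: eq_bigr => k _.
by rewrite !mxE mulrC.
Qed.

End OneComplex.
End RowsFromColumns.

(** * Resolutions over R and over R/x *)

Section ColumnsAction.
Variables (B : comPzRingType) (r : nat -> nat) (D : forall i, 'M[B]_(r i.+1, r i)).

Lemma mact_col p q (A : 'M[B]_(p, q)) (f : 'cV[B]_q) :
  mact A [ffun j => f j 0 : B^o] = [ffun j => (A *m f) j 0 : B^o].
Proof. by apply/ffunP => j; rewrite !ffunE mxE; apply: eq_bigr => k _; rewrite ffunE. Qed.

Lemma acyc_col i : acyc D B^o i <-> col_exact D i.
Proof.
have colE n (f : {ffun 'I_n -> B^o}) : f = [ffun j => (\col_k f k) j 0 : B^o].
  by apply/ffunP => j; rewrite ffunE mxE.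
split=> h f f0.
  have [|g] := h [ffun j => f j 0 : B^o].
    by rewrite mact_col f0; apply/ffunP => j; rewrite !ffunE mxE.
  rewrite (colE _ g) mact_col => /ffunP E; exists (\col_k g k).
  by apply/colP => j; have := E j; rewrite !ffunE.
have [|g gE] := h (\col_k f k).
  have /ffunP E : [ffun j => (D i.+1 *m \col_k f k) j 0 : B^o] = 0 by rewrite -mact_col -colE.
  by apply/colP => j; have := E j; rewrite !ffunE => ->; rewrite mxE.
exists [ffun j => g j 0 : B^o]; by rewrite mact_col -gE -colE.
Qed.

Lemma acyc_row i n : acyc D B^o i -> acyc D 'rV[B]_n i.
Proof.
move=> h f f0.
have prE p q (A : 'M[B]_(p, q)) (g : {ffun 'I_q -> 'rV[B]_n}) b j :
    mact A [ffun j => row_pr b (g j)] j = row_pr b (mact A g j).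
  by rewrite linear_mact ffunE.
have /choice[g gP] b : exists g, [ffun j => row_pr b (f j)] = mact (D i) g.
  by apply: h; apply/ffunP => j; rewrite prE f0 !ffunE linear0.
exists [ffun j => \row_b g b j]; apply/ffunP => j; apply/rowP => b.
have /ffunP/(_ j) := gP b; rewrite ffunE /row_pr => ->.
rewrite -[RHS]/(row_pr b _) -prE.
suff -> : [ffun k => row_pr b ([ffun l => \row_c g c l] k)] = g b by [].
by apply/ffunP => k; rewrite !ffunE /row_pr mxE.
Qed.

Lemma acyc_submodule (X : lmodType B) (K : X -> Prop) (sK : submod K) i :
  acyc D (submodule sK) i <-> coh0 D i K zero_sub.
Proof.
have vE p q (A : 'M[B]_(p, q)) (g : {ffun 'I_q -> submodule sK}) j :
    mact A [ffun j => submodule_val (g j)] j = submodule_val (mact A g j).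
  by rewrite linear_mact ffunE.
have lift n (f : {ffun 'I_n -> X}) : pw K f ->
    exists g : {ffun 'I_n -> submodule sK}, f = [ffun j => submodule_val (g j)].
  by move=> Kf; apply: linear_ffun_lift => j; apply: submodule_ex.
split=> [h f [/lift[f' ->] Df]|h f f0].
  have [|g ->] := h f'.
    by apply/ffunP => j; apply: submodule_val_inj; rewrite -vE Df ffunE linear0.
  exists [ffun j => submodule_val (g j)]; split=> j.
    by rewrite ffunE; apply: submodule_valP.
  by rewrite ffunBE vE ffunE subrr.
have [|g [/lift[g' ->] gP]] := h [ffun j => submodule_val (f j)].
  split=> j; first by rewrite ffunE; apply: submodule_valP.
  by rewrite vE f0 ffunE; exact: linear0.
exists g'; apply/ffunP => j; apply: submodule_val_inj; apply/eqP.
by rewrite -subr_eq0 -vE; have := gP j; rewrite ffunBE ffunE => ->.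
Qed.

End ColumnsAction.

Section BlockAction.
Variables (B : comPzRingType) (X : lmodType B).

Definition ffcat m n (f : {ffun 'I_m -> X}) (g : {ffun 'I_n -> X}) : {ffun 'I_(m + n) -> X} :=
  [ffun k => match split k with inl j => f j | inr j => g j end].

Lemma ffcat_ex m n (f : {ffun 'I_(m + n) -> X}) : exists f1 f2, f = ffcat f1 f2.
Proof.
exists [ffun j => f (lshift n j)], [ffun j => f (rshift m j)].
by apply/ffunP => k; rewrite ffunE; case: splitP => j kj; rewrite ffunE;
  congr (f _); apply: val_inj.
Qed.

Lemma ffcatl m n (f : {ffun 'I_m -> X}) (g : {ffun 'I_n -> X}) j : ffcat f g (lshift n j) = f j.
Proof.
rewrite ffunE; case: splitP => [k /= /ord_inj->//|k /= E].
by have := ltn_ord j; rewrite E ltnNge leq_addr.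
Qed.

Lemma ffcatr m n (f : {ffun 'I_m -> X}) (g : {ffun 'I_n -> X}) j : ffcat f g (rshift m j) = g j.
Proof.
rewrite ffunE; case: splitP => [k /= E|k /= /addnI/ord_inj->//].
by have := ltn_ord k; rewrite -E ltnNge leq_addr.
Qed.

Lemma ffcat_inj m n (f f' : {ffun 'I_m -> X}) (g g' : {ffun 'I_n -> X}) :
  ffcat f g = ffcat f' g' -> f = f' /\ g = g'.
Proof.
move=> /ffunP E; split; apply/ffunP => j.
  by rewrite -(ffcatl f g) E ffcatl.
by rewrite -(ffcatr f g) E ffcatr.
Qed.

Lemma ffcat0 m n : ffcat 0 0 = 0 :> {ffun 'I_(m + n) -> X}.
Proof. by apply/ffunP => k; rewrite !ffunE; case: split => j; rewrite ffunE. Qed.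

Lemma mact_block m1 m2 n1 n2 (A1 : 'M[B]_(m1, n1)) (A2 : 'M_(m1, n2)) (A3 : 'M_(m2, n1))
    (A4 : 'M_(m2, n2)) (f : {ffun 'I_n1 -> X}) (g : {ffun 'I_n2 -> X}) :
  mact (block_mx A1 A2 A3 A4) (ffcat f g) =
  ffcat (mact A1 f + mact A2 g) (mact A3 f + mact A4 g).
Proof.
apply/ffunP => k; rewrite -[k]splitK; case: (split k) => j /=.
  rewrite ffcatl !ffunE big_split_ord /=; congr (_ + _); apply: eq_bigr => i _.
    by rewrite block_mxEul ffcatl.
  by rewrite block_mxEur ffcatr.
rewrite ffcatr !ffunE big_split_ord /=; congr (_ + _); apply: eq_bigr => i _.
  by rewrite block_mxEdl ffcatl.
by rewrite block_mxEdr ffcatr.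
Qed.

Lemma mactN p q (A : 'M[B]_(p, q)) (f : {ffun 'I_q -> X}) : mact (- A) f = - mact A f.
Proof.
apply/ffunP => i; rewrite !ffunE -sumrN; apply: eq_bigr => j _.
by rewrite mxE scaleNr.
Qed.

End BlockAction.

(** * The doubled complex of a complex over B/x *)

Section Hypersurface.
Variables (B B' : comPzRingType) (phi : {rmorphism B -> B'}) (x : B).
Hypothesis phi_surj : surjective phi.
Hypothesis phi_ker : forall a, phi a = 0 <-> exists b, a = x * b.
Hypothesis x_reg : forall a, x * a = 0 -> a = 0.

Lemma phi_mx_ker p q (A : 'M[B]_(p, q)) : map_mx phi A = 0 -> exists A', A = x *: A'.
Proof.
move=> A0; have /choice[f fP] : forall ij : 'I_p * 'I_q, exists b, A ij.1 ij.2 = x * b.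
  by move=> ij; apply/phi_ker; have /matrixP/(_ ij.1 ij.2) := A0; rewrite !mxE.
by exists (\matrix_(i, j) f (i, j)); apply/matrixP => i j; rewrite !mxE -fP.
Qed.

Lemma phi_mx_eq p q (A A' : 'M[B]_(p, q)) : map_mx phi A = map_mx phi A' ->
  exists C, A = A' + x *: C.
Proof.
move=> AA'; have [|C CE] := @phi_mx_ker _ _ (A - A'); first by rewrite map_mxB AA' subrr.
by exists C; rewrite -CE addrC subrK.
Qed.

Lemma phi_x : phi x = 0. Proof. by apply/phi_ker; exists 1; rewrite mulr1. Qed.

Lemma map_mx_xM p q (A : 'M[B]_(p, q)) : map_mx phi (x *: A) = 0.
Proof. by rewrite map_mxZ phi_x scale0r. Qed.

Lemma x_mx_inj p q (A A' : 'M[B]_(p, q)) : x *: A = x *: A' -> A = A'.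
Proof.
move=> xA; apply/matrixP => i j; apply/eqP; rewrite -subr_eq0; apply/eqP/x_reg.
by have /matrixP/(_ i j) := xA; rewrite !mxE mulrBr => ->; rewrite subrr.
Qed.

Section Double.
Variables (r : nat -> nat) (D : forall i, 'M[B']_(r i.+1, r i)).
Variables (d : forall i, 'M[B]_(r i.+1, r i)) (h : forall i, 'M[B]_(r i.+2, r i)).
Hypothesis dD : forall i, map_mx phi (d i) = D i.
Hypothesis dd : forall i, d i.+1 *m d i = x *: h i.

(** Both sides multiplied by x are d d d, and x can be cancelled. *)
Lemma dh_comm i : d i.+2 *m h i = h i.+1 *m d i.
Proof.
apply: x_mx_inj; rewrite scalemxAr -dd scalemxAl -dd; exact: mulmxA.
Qed.

(* Eisenbud and Shamash: without its term of degree 0, the resolution over B of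
   the module that D resolves over B/x. *)
Definition double_rank i := (r i.+1 + r i)%N.
Definition double i : 'M[B]_(double_rank i.+1, double_rank i) :=
  block_mx (d i.+1) (- h i) (x%:M) (- d i).

Lemma double_cplx : is_cplx double.
Proof.
move=> i; rewrite /double mulmx_block !mulmxN !mulNmx ?mulmxN ?opprK !dd dh_comm.
rewrite !(mul_mx_scalar, mul_scalar_mx) !subrr !addNr; exact: block_mx0.
Qed.

Lemma double_col_exact i : col_exact D i -> col_exact double i.
Proof.
move=> eD f; rewrite -[f]vsubmxK; set f1 := usubmx f; set f2 := dsubmx f.
rewrite mul_block_col mulNmx mul_scalar_mx -[0 in RHS]col_mx0.
case/eq_col_mx=> e1 /eqP; rewrite mulNmx subr_eq0 => /eqP e2.
have [|g gE] := eD (map_mx phi f2).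
  by rewrite -dD -map_mxM -e2 map_mx_xM.
have [g' g'E] := lift_mx phi_surj g.
have [|e eE] := @phi_mx_eq _ _ f2 (d i *m g'); first by rewrite map_mxM dD -g'E.
have f1E : f1 = h i *m g' + d i.+1 *m e.
  apply: x_mx_inj; rewrite e2 eE mulmxDr mulmxA dd scalerDr scalemxAl.
  by rewrite -[_ *m (x *: e)]scalemxAr.
exists (col_mx e (- g')); rewrite mul_block_col mul_scalar_mx !mulmxN !mulNmx !opprK.
by rewrite f1E eE addrC [_ + d i *m _]addrC.
Qed.

(** Used for exactness of the double in positive degrees and again for the kernel of its
    augmentation. *)
Lemma double_ker i (a : 'rV[B]_(r i.+1)) (b : 'rV[B]_(r i)) : row_exact D ->
  a *m d i + x *: b = 0 -> exists c e,
  a = c *m d i.+1 + x *: e /\ b = - (c *m h i + e *m d i).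
Proof.
move=> eD ab.
have [|c cE] := eD i (map_mx phi a).
  rewrite -dD -map_mxM; move/(congr1 (map_mx phi)): ab.
  by rewrite map_mxD map_mx_xM addr0 map_mx0.
have [c' c'E] := lift_mx phi_surj c.
have [|e eE] := @phi_mx_eq _ _ a (c' *m d i.+1); first by rewrite map_mxM dD -c'E.
exists c', e; split=> //; apply: x_mx_inj.
move/eqP: ab; rewrite addrC addr_eq0 => /eqP->.
by rewrite eE mulmxDl -mulmxA dd -scalemxAr -scalemxAl -scalerDr scalerN.
Qed.

Lemma double_row_exact : row_exact D -> row_exact double.
Proof.
move=> eD i v; rewrite -[v]hsubmxK; set a := lsubmx v; set b := rsubmx v.
rewrite mul_row_block mul_mx_scalar -[0 in RHS]row_mx0.
case/eq_row_mx=> /(double_ker eD)[c [e [aE bE]]] _.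
exists (row_mx c e); rewrite mul_row_block mul_mx_scalar -aE bE.
by rewrite !mulmxN -opprD.
Qed.

(** A cycle of D lifts to some a with a d = x u, and (a, -u) is a cycle of the double. The lowest
    positive degree is not reached. *)
Lemma row_exact_double : row_exact double -> forall i (v : 'rV[B']_(r i.+2)),
  v *m D i.+1 = 0 -> exists w, v = w *m D i.+2.
Proof.
move=> eD i v v0; have [a aE] := lift_mx phi_surj v.
have [|u uE] := @phi_mx_ker _ _ (a *m d i.+1); first by rewrite map_mxM dD -aE.
have [|w] := eD i (row_mx a (- u)).
  rewrite mul_row_block mul_mx_scalar uE scalerN subrr !mulmxN mulNmx opprK.
  rewrite (_ : _ + u *m d i = 0); first exact: row_mx0.
  apply: x_mx_inj; rewrite scaler0 scalerDr scalerN scalemxAl -uE -mulmxA dd.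
  by rewrite scalemxAr addNr.
rewrite -[w]hsubmxK mul_row_block mul_mx_scalar => /eq_row_mx[E _].
by exists (map_mx phi (lsubmx w)); rewrite aE E map_mxD map_mx_xM addr0 map_mxM dD.
Qed.

End Double.

Lemma double_lift r (D : forall i, 'M[B']_(r i.+1, r i)) : is_cplx D ->
  exists (d : forall i, 'M[B]_(r i.+1, r i)) (h : forall i, 'M[B]_(r i.+2, r i)),
    (forall i, map_mx phi (d i) = D i) /\ (forall i, d i.+1 *m d i = x *: h i).
Proof.
move=> cD.
have dP i : {A : 'M[B]_(r i.+1, r i) | map_mx phi A = D i}.
  by apply/cid; have [A ->] := lift_mx phi_surj (D i); exists A.
pose d i := sval (dP i); have dD i : map_mx phi (d i) = D i := svalP (dP i).
have hP i : {A : 'M[B]_(r i.+2, r i) | d i.+1 *m d i = x *: A}.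
  by apply/cid/phi_mx_ker; rewrite map_mxM !dD.
by exists d, (fun i => sval (hP i)); split=> // i; apply: svalP (hP i).
Qed.

(** The double inherits the exactness of the dual; duality over [B] makes it exact, and
    [row_exact_double] returns to D. *)
Lemma dual_exact_quot : noetherian B' -> dual_exact B -> dual_exact B'.
Proof.
move=> nB' deB r D cD eD.
have [k [A AP]] := ker_fg nB' (rowmul (D 0%N)^T : {linear _ -> _}).
(* One more term on the left is needed, as doubling loses one degree. *)
pose r' i := if i is j.+1 then r j else k.
pose D' i : 'M[B']_(r' i.+1, r' i) := match i with 0 => A^T | j.+1 => D j end.
have kerA (v : 'rV[B']_(r 0%N)) : v *m (D 0%N)^T = 0 <-> exists w, v = w *m A := AP v.
have cD' : is_cplx D'.
  case=> [|i]; last exact: cD.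
  rewrite /= -[D 0%N]trmxK -trmx_mul -trmx0; congr (_^T); apply/row_matrixP => j.
  by rewrite row_mul row0; apply/kerA; exists (row j 1%:M); rewrite -row_mul mul1mx.
have eD' i : col_exact D' i.
  case: i => [|i] f; last exact: eD.
  move=> /(congr1 trmx); rewrite trmx_mul trmx0 => /kerA[w wE].
  by exists w^T; rewrite -trmx_mul -wE trmxK.
have [d [h [dD dd]]] := double_lift cD'.
have eDD : row_exact (double d h).
  apply: deB; first exact: double_cplx dd.
  by move=> j; apply: (double_col_exact dD dd).
by move=> i; exact: (row_exact_double dD dd eDD (i := i)).
Qed.
End Hypersurface.

(** * (SAC) passes from R to R/x *)

Section HypersurfaceSAC.
Variables (B B' : comPzRingType) (phi : {rmorphism B -> B'}) (x : B).
Hypothesis phi_surj : surjective phi.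
Hypothesis phi_ker : forall a, phi a = 0 <-> exists b, a = x * b.
Hypothesis x_reg : forall a, x * a = 0 -> a = 0.

Section Coefficients.
Variables (r : nat -> nat) (D : forall i, 'M[B']_(r i.+1, r i)).
Variables (d : forall i, 'M[B]_(r i.+1, r i)) (h : forall i, 'M[B]_(r i.+2, r i)).
Hypothesis dD : forall i, map_mx phi (d i) = D i.
Hypothesis dd : forall i, d i.+1 *m d i = x *: h i.
Variable N : lmodType B'.

Local Notation double' := (fun i => map_mx phi (double x d h i)).

Lemma map_double i : map_mx phi (double x d h i) =
  block_mx (D i.+1) (- map_mx phi (h i)) 0 (- D i).
Proof.
rewrite /double map_block_mx !map_mxN !dD map_scalar_mx /= (phi_x phi_ker).
by rewrite raddf0.
Qed.

Lemma map_dh_comm i : D i.+2 *m map_mx phi (h i) = map_mx phi (h i.+1) *m D i.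
Proof. by rewrite -!dD -!map_mxM (dh_comm x_reg dd). Qed.

(** As x acts as zero on N, Hom of the double into N is a cone of h, and its cohomology in index i
    lies between that of Hom(D, N) in indices i + 1 and i. *)
Lemma acyc_double i : acyc D N i -> acyc D N i.+1 -> acyc double' N i.
Proof.
move=> hi hi1 f; have [f1 [f2 ->]] := ffcat_ex f.
rewrite map_double mact_block -[0 in RHS]ffcat0 => /ffcat_inj[e1 e2].
have [|g gE] := hi f2.
  by move/eqP: e2; rewrite mact0 add0r mactN oppr_eq0 => /eqP.
have [|e eE] := hi1 (f1 - mact (map_mx phi (h i)) g).
  rewrite linearB /= mact_mul map_dh_comm -mact_mul -gE.
  by move: e1; rewrite mactN.
exists (ffcat e (- g)); rewrite map_double mact_block -eE mact0 add0r !mactN !linearN.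
by rewrite /= !opprK subrK -gE.
Qed.

(** In the long exact sequence of the cone, h goes from index i to index i + 2. Its target vanishes,
    so a cocycle of Hom(D, N) extends to a cocycle of the cone. *)
Lemma acyc_undouble i : acyc double' N i -> acyc D N i.+2 -> acyc D N i.
Proof.
move=> hd hi2 f2 f20.
have [|f1 f1E] := hi2 (mact (map_mx phi (h i.+1)) f2).
  by rewrite mact_mul map_dh_comm -mact_mul f20 linear0.
have [|g] := hd (ffcat f1 f2).
  rewrite map_double mact_block mact0 add0r !mactN f20 oppr0 -f1E subrr.
  exact: ffcat0.
have [e [g' ->]] := ffcat_ex g.
rewrite map_double mact_block mact0 add0r !mactN => /ffcat_inj[_ f2E].
by exists (- g'); rewrite linearN.
Qed.

End Coefficients.

Lemma SAC_hypersurface : noetherian B' -> SAC B -> SAC B'.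
Proof.
move=> nB' sB N fN extN0 [N0 extNN].
have [r [D [eps FR]]] := free_res_exists nB' fN.
have acA i : acyc D B'^o i by apply/(Ext_acyc FR); apply: extN0.
have acN i : (N0 <= i)%N -> acyc D N i.
  by move=> Ni; apply/(Ext_acyc FR); apply: extNN; apply: leqW.
have eD := fr_exact FR; have cD := fr_cplx FR.
have [d [h [dD dd]]] := double_lift phi_surj phi_ker cD.
pose rho (v : 'rV[B]_(r 0)) : N := eps (map_mx phi v).
have rs : semilinear phi rho.
  by move=> a u v; rewrite /rho map_mxD map_mxZ linearP.
have rho_surj : surjective rho.
  move=> y; have [v <-] := fr_surj FR y; have [v' ->] := lift_mx phi_surj v.
  by exists v'.
pose K v := rho v = 0.
have sK : submod K.
  split; first by rewrite /K (semilinear0 rs).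
  by move=> a u v Ku Kv; rewrite /K rs Ku Kv scaler0 addr0.
(* Over [B] the relations of N are those lifted from [B'] and the multiples of x; [E] generates this
   syzygy module K. *)
pose E := col_mx (d 0%N) (x%:M) : 'M[B]_(double_rank r 0, r 0).
have EE a b : row_mx a b *m E = a *m d 0%N + x *: b.
  by rewrite mul_row_col mul_mx_scalar.
have KP v : K v <-> exists w, v = w *m E.
  split=> [/(fr_ker FR)[w]|[w ->]].
    have [w' ->] := lift_mx phi_surj w; rewrite -dD -map_mxM.
    by move=> /(phi_mx_eq phi_ker)[b ->]; exists (row_mx w' b); rewrite EE.
  rewrite -[w]hsubmxK EE; apply/(fr_ker FR).
  by exists (map_mx phi (lsubmx w)); rewrite map_mxD (map_mx_xM phi_ker) addr0 map_mxM dD.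
have [|eps' eps'E] := submodule_corestr sK (f := rowmul E : {linear _ -> _}).
  by move=> a; apply/KP; exists a.
have FR' : free_res (double x d h) eps'.
  split.
  - exact: (double_cplx x_reg dd).
  - exact: (double_row_exact phi_surj phi_ker x_reg dD dd eD).
  - move=> y; have /KP[w wE] := submodule_valP y; exists w.
    by apply: submodule_val_inj; rewrite eps'E.
  move=> v; have -> : eps' v = 0 <-> v *m E = 0.
    split=> [e0|vE0]; first by rewrite -[LHS]/(rowmul E v) -eps'E e0 linear0.
    by apply: submodule_val_inj; rewrite eps'E linear0.
  split=> [|[w ->]]; last first.
    rewrite -mulmxA /double mul_block_col dd mul_mx_scalar mul_scalar_mx scalerN subrr.
    by rewrite mulNmx mul_mx_scalar subrr col_mx0 mulmx0.
  rewrite -[v]hsubmxK EE => /(double_ker phi_surj phi_ker x_reg dD dd eD)[c [e [aE bE]]].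
  exists (row_mx c e); rewrite /double mul_row_block mul_mx_scalar -aE bE.
  by rewrite !mulmxN -opprD.
have acX i : acyc (double x d h) 'rV[B]_(r 0) i.
  apply: acyc_row; apply/acyc_col; apply: (double_col_exact phi_surj phi_ker x_reg dD dd).
  exact/acyc_col.
have NP i := semilinear_acyc rs rho_surj (U := K) (fun y => iff_refl _) (double x d h) i.
have acM i : acyc (double x d h) (submodule sK) i.
  apply/(Ext_acyc FR'); apply: sB => //.
  - exact: free_res_fin_gen FR'.
  - case=> // j _; apply/(Ext_acyc FR')/acyc_col.
    by apply: (double_col_exact phi_surj phi_ker x_reg dD dd); apply/acyc_col.
  (* For large degrees: in 0 -> K -> B^(r 0) -> N -> 0 the free term has no Ext from K, so vanishing
     for N in index j gives vanishing for K in index j + 1. *)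
  exists N0.+2; case=> // -[|j] Nj //; apply/(Ext_acyc FR')/acyc_submodule.
  have /NP h1 : acyc (fun i => map_mx phi (double x d h i)) N j.
    by apply: (acyc_double dD dd); apply: acN => //; apply: leqW.
  move=> f [Kf Df]; have [|g gE] := acX j.+1 f; first by apply/ffunP => k; rewrite Df ffunE.
  have [|g' [_ g'P]] := h1 g; first by split=> //; rewrite -gE.
  exists (g - mact (double x d h j) g'); split=> //.
  rewrite linearB /= mact_cplx ?subr0 -?gE ?subrr => [k|]; last exact: (fr_cplx FR').
  by rewrite ffunE.
(* The same sequence read backwards, after (SAC) over [B] has been applied to K. *)
have acN' i : acyc (fun i => map_mx phi (double x d h i)) N i.
  apply/NP => f [_ Kf]; have /acyc_submodule h1 := acM i.+1.
  have [|g [Kg gP]] := h1 (mact (double x d h i.+1) f).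
    by split=> // k; rewrite mact_cplx ?ffunE //; exact: (fr_cplx FR').
  have [|g' g'E] := acX i (f - g).
    apply/eqP; rewrite linearB /= subr_eq0; apply/eqP/ffunP => k.
    by apply/eqP; rewrite -subr_eq0 -ffunBE gP.
  by exists g'; split=> //; rewrite -g'E subKr.
(* [acyc_undouble] brings vanishing from index i + 2 to index i, starting from [N0]. *)
suff H n : forall i, (N0 <= i + n)%N -> acyc D N i.
  by case=> // i _; apply/(Ext_acyc FR)/(H N0)/leq_addl.
elim: n => [|n IH] i Ni; first by apply: acN; rewrite -(addn0 i).
apply: (acyc_undouble dD dd) => //.
by apply: IH; apply: leq_trans Ni _; rewrite addnS !addSn leqnSn.
Qed.

End HypersurfaceSAC.

(** * Passage between R and R/(x_1, ..., x_n)^l *)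

Section RegularReduction.
Variables (B : comPzRingType) (r : nat -> nat)
          (D : forall i, 'M[B]_(r i.+1, r i)).
Hypothesis cD : is_cplx D.
Variable X : lmodType B.

Lemma Qs_cons (x : B) t (U : X -> Prop) u v : U u -> Qs t U v -> Qs (x :: t) U (x *: u + v).
Proof. by exists u, v. Qed.

Lemma pw_Qs_cons n (x : B) t (f : {ffun 'I_n -> X}) : pw (Qs (x :: t) full) f ->
  exists g q, pw (Qs t full) q /\ f = x *: g + q.
Proof.
move=> h; have /choice[g gP] : forall j, exists u, exists v, Qs t full v /\ f j = x *: u + v.
  by move=> j; have [u [v [_ Qv ->]]] := h j; exists u, v.
have /choice[q qP] := gP; exists (finfun g), (finfun q); split=> [j|].
  by rewrite ffunE; case: (qP j).
by apply/ffunP => j; rewrite !ffunE; case: (qP j).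
Qed.

Lemma mact_reg x t i (u : {ffun 'I_(r i.+1) -> X}) :
  (forall y : X, Qs t full (x *: y) -> Qs t full y) ->
  pw (Qs t full) (mact (D i.+1) (x *: u)) -> pw (Qs t full) (mact (D i.+1) u).
Proof.
by move=> xreg h j; apply: xreg; have := h j; rewrite linearZ ffunE.
Qed.

(** From the sequence 0 -> X/tX -> X/tX -> X/(x, t)X -> 0 given by multiplication by x. *)
Lemma coh0_regular x t i : (forall y : X, Qs t full (x *: y) -> Qs t full y) ->
  coh0 D i full (Qs t full : X -> Prop) -> coh0 D i.+1 full (Qs t full : X -> Prop) ->
  coh0 D i full (Qs (x :: t) full : X -> Prop).
Proof.
have st : submod (Qs t full : X -> Prop) by apply: Qs_submod; apply: full_submod.
have sp n := pw_submod (I := 'I_n) st.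
move=> xreg hi hi1 f [_ /pw_Qs_cons[g [q [Qq fE]]]].
have [|g' [_ q'P]] := hi1 g.
  split=> //; apply: mact_reg xreg _.
  have -> : x *: g = mact (D i.+1) f - q by rewrite fE addrK.
  rewrite linearB /= mact_cplx // sub0r; apply: (submodN (sp _)); exact: mact_pw.
have [|g2 [_ q2P]] := hi (f - x *: g').
  split=> //; rewrite linearB linearZ /= fE addrAC -scalerBr.
  by apply: (submodD (sp _)) => //; apply: (submodZ (sp _)).
exists g2; split=> // j.
have -> : (f - mact (D i) g2) j = x *: g' j + (f - x *: g' - mact (D i) g2) j.
  rewrite !ffunBE (_ : (x *: g') j = x *: g' j); last by rewrite ffunE.
  by rewrite [RHS]addrA [x *: _ + _]addrC subrK.
exact: Qs_cons.
Qed.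

Lemma coh0_weakly_regular xs i0 : weakly_regular X xs ->
  (forall i, (i0 <= i)%N -> acyc D X i) ->
  forall i, (i0 <= i)%N -> coh0 D i full (Qs xs full : X -> Prop).
Proof.
move=> wr h; elim: xs wr => [_ i ii0|x t IH [xreg wr] i ii0]; first exact/acycP/h.
by apply: coh0_regular => //; apply: IH => //; apply: leqW.
Qed.

(** Entries are removed one by one: as x is regular modulo t, vanishing modulo (x, t) gives H = x H
    for the cohomology modulo t. *)
Lemma coh0_nakayama (m : idealType B) xs i : noetherian B -> is_local m ->
  fin_gen X -> (forall x, x \in xs -> x \in m) -> weakly_regular X xs ->
  coh0 D i full (Qs xs full : X -> Prop) -> acyc D X i.
Proof.
move=> nB lm fX; elim: xs => [_ _|x t IH xsm [xreg wr] h]; first by move/acycP.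
have st : submod (Qs t full : X -> Prop) by apply: Qs_submod; apply: full_submod.
have sp n := pw_submod (I := 'I_n) st.
apply: IH => // [y yt|]; first by apply: xsm; rewrite inE yt orbT.
have nW : noeth_mod {ffun 'I_(r i.+1) -> X}.
  by apply: noeth_fin_gen => //; apply: ffun_fin_gen.
apply: (nakayama nB lm (x := x) nW).
- by apply: xsm; rewrite mem_head.
- by apply: cobd_submod.
- by apply: cocyc_submod.
move=> f [_ Df]; have [|g [_ /pw_Qs_cons[u [q [Qq fE]]]]] := h f.
  split=> // j; move: (Df j); apply: Qs_sub_seq => // y yt; by rewrite inE yt orbT.
exists (mact (D i) g + q), u; split.
- by exists g; split=> //; rewrite addrC addKr.
- split=> //; apply: mact_reg xreg _.
  have -> : x *: u = f - mact (D i) g - q by rewrite fE addrK.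
  rewrite !linearB /= mact_cplx // subr0; apply: (submodB (sp _)) => //; exact: mact_pw.
by rewrite -addrA (addrC q) -fE addrC subrK.
Qed.

End RegularReduction.

(** * Reduction of a free resolution modulo a power of Q *)

Section ReductionModPowers.
Variables (B B' : comPzRingType) (phi : {rmorphism B -> B'}) (xs : seq B) (l : nat).
Hypothesis phi_surj : surjective phi.
Hypothesis phi_ker : forall a, phi a = 0 <-> Qp xs l (a : B^o).

Lemma map_mx_Qp n (v : 'rV[B]_n) : map_mx phi v = 0 <-> Qp xs l v.
Proof.
rewrite -row_Qp; split=> [/rowP h b|h].
  by apply/phi_ker; have := h b; rewrite !mxE.
by apply/rowP => b; rewrite !mxE; apply/phi_ker.
Qed.

Lemma row_exact_map r (D : forall i, 'M[B]_(r i.+1, r i)) :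
  row_exact (fun i => map_mx phi (D i)) <-> row_exact_mod D xs l.
Proof.
split=> h i v.
  move=> /map_mx_Qp; rewrite map_mxM => /h[w].
  have [w' ->] := lift_mx phi_surj w => vE; exists w'.
  by apply/map_mx_Qp; rewrite map_mxB map_mxM vE subrr.
have [v' ->] := lift_mx phi_surj v; rewrite -map_mxM => /map_mx_Qp/h[w hw].
exists (map_mx phi w); apply/eqP; rewrite -subr_eq0 -map_mxM -map_mxB.
exact/eqP/map_mx_Qp.
Qed.

Lemma Qp_scale (X : lmodType B) (a : B) (y : X) : Qp xs l (a : B^o) -> Qp xs l (a *: y).
Proof.
have [g gE] : exists g : {linear B^o -> X}, forall a, g a = a *: y.
  by apply: linear_of => b u v; rewrite scalerDl scalerA.
by rewrite -gE; apply: Qp_linear.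
Qed.

Section Coeff.
Variables (r : nat -> nat) (D : forall i, 'M[B]_(r i.+1, r i)).

Lemma acyc_base i : acyc (fun i => map_mx phi (D i)) B'^o i <->
  coh0 D i full (Qp xs l : B^o -> Prop).
Proof.
exact: (semilinear_acyc (rmorph_semilinear phi) phi_surj (U := Qp xs l) phi_ker).
Qed.

Variables (M : lmodType B) (eps : {linear 'rV[B]_(r 0) -> M}).
Hypothesis FR : free_res D eps.

(** Y is M/Q^l M, which F/Q^l F resolves once it is exact. The last clause lets Ext over [B'] be
    computed by the original matrices. *)
Lemma reduction_free_res : row_exact_mod D xs l ->
  exists (Y : lmodType B') (eps' : {linear 'rV[B']_(r 0) -> Y}),
    free_res (fun i => map_mx phi (D i)) eps' /\
    forall i, acyc (fun i => map_mx phi (D i)) Y i <-> coh0 D i full (Qp xs l : M -> Prop).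
Proof.
move=> exl.
have [|Y [rho [rs rho_surj rho_ker]]] :=
    reduction_exists phi_surj (Qp_submod (X := M) xs l).
  by move=> a /phi_ker Qa y; apply: Qp_scale.
pose F := [ffun j => rho (eps (delta_mx 0 j))].
have eE v : rlin F (map_mx phi v) = rho (eps v).
  rewrite (rlinE eps) /rlin (semilinear_sum rs); apply: eq_bigr => j _.
  by rewrite !ffunE mxE (semilinearZ rs).
exists Y, (rlin F : {linear _ -> _}); split; last by move=> i; apply: semilinear_acyc.
split.
- by move=> i; rewrite -map_mxM (fr_cplx FR) map_mx0.
- exact/row_exact_map.
- move=> y; have [u <-] := rho_surj y; have [v <-] := fr_surj FR u.
  by exists (map_mx phi v); rewrite /= eE.
move=> v; have [v' ->] := lift_mx phi_surj v; rewrite /= eE rho_ker; split.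
  move=> /(Qp_lift (fr_surj FR))[u [Qu uE]].
  have [w wE] : exists w, v' - u = w *m D 0%N.
    by apply/(fr_ker FR); rewrite linearB uE subrr.
  exists (map_mx phi w); rewrite -map_mxM -wE map_mxB.
  by rewrite (map_mx_Qp u).2 // subr0.
move=> [w]; have [w' ->] := lift_mx phi_surj w; rewrite -map_mxM => vE.
have Qv : Qp xs l (v' - w' *m D 0%N) by apply/map_mx_Qp; rewrite map_mxB vE subrr.
have -> : eps v' = eps (v' - w' *m D 0%N).
  by rewrite linearB /= [X in _ - X](_ : _ = 0) ?subr0 //; apply/(fr_ker FR); exists w'.
exact: Qp_linear.
Qed.

End Coeff.
End ReductionModPowers.

(** * (SAC) passes from R/Q^l to R *)

Section Ascent.
Variables (R : comPzRingType) (m : idealType R) (xs : seq R).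
Hypotheses (nR : noetherian R) (lm : is_local m).
Hypothesis xsm : forall x, x \in xs -> x \in m.
Hypothesis wxs : weakly_regular R^o xs.

Lemma row_weakly_regular n ys : weakly_regular R^o ys -> weakly_regular 'rV[R]_n ys.
Proof.
elim: ys => //= y t IH [yreg wt]; split; last exact: IH.
move=> v /(row_Qp t 1) h; apply/(row_Qp t 1) => b; apply: yreg.
by have := h b; rewrite mxE.
Qed.

(** If y v = q + w D0 with q in (t)F, then w is a cycle modulo (y, t), so w = y u' + q' modulo
    boundaries with q' in (t)F. Hence y kills v - u' D0 modulo (t), and y is regular there. *)
Lemma coker_regular r (D : forall i, 'M[R]_(r i.+1, r i)) (M : lmodType R)
    (eps : {linear 'rV[R]_(r 0) -> M}) y t :
  free_res D eps -> weakly_regular R^o (y :: t) -> row_exact_mod D (y :: t) 1 ->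
  forall u : M, Qs t full (y *: u) -> Qs t full u.
Proof.
move=> FR /(row_weakly_regular (r 0))[yreg _] ex1 u.
have [v <-] := fr_surj FR u; rewrite -linearZ /= => Qv.
have st n : submod (Qs t full : 'rV[R]_n -> Prop) by apply: Qs_submod; apply: full_submod.
have [q [Qq qE]] := Qp_lift (xs := t) (j := 1) (fr_surj FR) Qv.
have [w wE] : exists w, y *: v - q = w *m D 0%N.
  by apply/(fr_ker FR); rewrite linearB /= qE subrr.
have [|w' [u' [q' [_ Qq' uE]]]] := ex1 0%N w.
  rewrite -wE; exists v, (- q); split=> //; exact: submodN.
have wE' : y *: v - q = y *: (u' *m D 0%N) + q' *m D 0%N.
  rewrite wE -[w](subrK (w' *m D 1%N)) uE mulmxDl -mulmxA (fr_cplx FR) mulmx0 addr0.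
  by rewrite mulmxDl -scalemxAl.
have -> : eps v = eps (v - u' *m D 0%N).
  by rewrite linearB /= [X in _ - X](_ : _ = 0) ?subr0 //; apply/(fr_ker FR); exists u'.
apply: (Qp_linear eps (j := 1)); apply: yreg.
have -> : y *: (v - u' *m D 0%N) = q + q' *m D 0%N.
  by rewrite scalerBr -(subrK q (y *: v)) wE' addrAC [y *: _ + _]addrC addrK addrC.
by apply: submodD => //; apply: (Qp_linear (rowmul (D 0%N)) (j := 1)).
Qed.

Variables (S : comPzRingType) (phi : {rmorphism R -> S}) (l : nat).
Hypothesis phi_surj : surjective phi.
Hypothesis phi_ker : forall a, phi a = 0 <-> Qp xs l.+1 (a : R^o).
(** Suffixes of the reversed list are the initial segments of the sequence; duality over the
    corresponding quotients of R will supply this. *)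
Hypothesis suffix_row_exact : forall r (D : forall i, 'M[R]_(r i.+1, r i)),
  is_cplx D -> row_exact D ->
  forall ys t, xs = ys ++ t ->
  (forall i, coh0 D i full (Qs t full : R^o -> Prop)) -> row_exact_mod D t 1.

Lemma SAC_ascent : SAC S -> SAC R.
Proof.
move=> sS M fM extMR [N0 extMM].
have [r [D [eps FR]]] := free_res_exists nR fM.
have cD := fr_cplx FR.
have acR i : acyc D R^o i by apply/(Ext_acyc FR); apply: extMR.
have acM i : (N0 <= i)%N -> acyc D M i.
  by move=> Ni; apply/(Ext_acyc FR); apply: extMM; apply: leqW.
have suffix_wr ys t : xs = ys ++ t -> weakly_regular R^o t.
  move=> e; move: wxs; rewrite e; elim: ys {e} => //= y ys IH [_]; exact: IH.
have ex1 ys t : xs = ys ++ t -> row_exact_mod D t 1.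
  move=> e; apply: (suffix_row_exact cD (fr_exact FR) e) => i.
  exact: (coh0_weakly_regular cD (i0 := 0) (suffix_wr _ _ e)).
have wM : weakly_regular M xs.
  suff H t : forall ys, xs = ys ++ t -> weakly_regular M t by apply: (H xs [::]).
  elim: t => //= y t IH ys e; split.
    by apply: (coker_regular FR); [exact: suffix_wr e|exact: ex1 e].
  by apply: (IH (rcons ys y)); rewrite cat_rcons.
have qR := weakly_regular_quasi wxs; have qM := weakly_regular_quasi wM.
have exl : row_exact_mod D xs l.+1.
  by apply: (row_exact_modP cD (l := l.+1)) => //; apply: (ex1 [::]).
have [Y [eps' [FR' acY]]] := reduction_free_res phi_surj phi_ker FR exl.
have coM i0 : (forall i, (i0 <= i)%N -> acyc D M i) ->
    forall i, (i0 <= i)%N -> coh0 D i full (Qp xs 1 : M -> Prop).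
  exact: coh0_weakly_regular.
(* (SAC) over [S] is applied to M/Q^(l+1) M. Its hypotheses hold because R/Q^(l+1) and M/Q^(l+1) M
   are filtered by copies of R/Q and M/QM. *)
have cohMl i : coh0 D i full (Qp xs l.+1 : M -> Prop).
  apply/acY; apply/(Ext_acyc FR'); apply: sS => //.
  - exact: free_res_fin_gen FR'.
  - case=> // j _; apply/(Ext_acyc FR')/(acyc_base phi_surj phi_ker).
    apply: kills_coh0; apply: kills_quot => //.
    by apply: coh0_kills; apply: (coh0_weakly_regular cD (i0 := 0) wxs).
  exists N0.+1; case=> // j Nj; apply/(Ext_acyc FR')/acY.
  apply: kills_coh0; apply: kills_quot => //.
  by apply: coh0_kills; apply: (coM N0).
suff H n : forall i, (N0 <= i + n)%N -> acyc D M i.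
  by case=> // i _; apply/(Ext_acyc FR)/(H N0)/leq_addl.
elim: n => [|n IH] i Ni; first by apply: acM; rewrite -(addn0 i).
apply: (coh0_nakayama cD nR lm fM xsm wM).
(* Vanishing for M in indices above i gives it for M/QM there; with M/Q^(l+1) M in index i it
   descends to M/QM in index i, where Nakayama's lemma has reduced the claim. *)
apply: (coh0_descent cD (l := l)) => //; apply: (coM i.+1) => // j ij.
by apply: IH; apply: leq_trans Ni _; rewrite addnS -addSn leq_add2r.
Qed.

End Ascent.

(** * The theorem *)

(** The hypothesis on cohomology says that the reduction of D modulo [ys] has an exact dual, to
    which duality over [B'] applies. *)
Lemma row_exact_mod_dual (B B' : comPzRingType) (phi : {rmorphism B -> B'}) ys
    r (D : forall i, 'M[B]_(r i.+1, r i)) :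
  surjective phi -> (forall a, phi a = 0 <-> Qp ys 1 (a : B^o)) -> dual_exact B' ->
  is_cplx D -> (forall i, coh0 D i full (Qs ys full : B^o -> Prop)) -> row_exact_mod D ys 1.
Proof.
move=> ps pk de cD h; apply/(row_exact_map ps pk); apply: de.
  by move=> i; rewrite -map_mxM cD map_mx0.
by move=> i; apply/acyc_col/(acyc_base ps pk).
Qed.

(** * (SAC) passes from R/Q to R/Q^(l+1) *)

Section Truncation.
Variables (S A : comPzRingType) (psi : {rmorphism S -> A}) (xs : seq S) (l : nat).
Hypotheses (nS : noetherian S) (psi_surj : surjective psi).
Hypothesis psi_ker : forall a, psi a = 0 <-> Qp xs 1 (a : S^o).
Hypothesis lx : (l < size xs)%N.
Hypothesis qS : forall j, (j <= l)%N -> quasi_regular S^o xs j.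
Hypothesis xs_nil : forall w, w \in mons xs l.+1 -> w = 0.
Hypothesis deA : dual_exact A.

(** Results about N/Q^(l+1) N thereby speak of N itself. *)
Lemma Qp_nil (N : lmodType S) : (Qp xs l.+1 : N -> Prop) = zero_sub.
Proof.
apply/funext => y; apply/propext; split=> [/QpP[c ->]|->].
  rewrite /comb big1 // => i _; by rewrite (xs_nil (mem_nth 0 (ltn_ord i))) scale0r.
exact: (submod0 (Qp_submod _ _)).
Qed.

Lemma SAC_truncation : SAC A -> SAC S.
Proof.
move=> sA N fN extNS [N0 extNN].
have [r [D [eps FR]]] := free_res_exists nS fN.
have cD := fr_cplx FR.
have acS i : coh0 D i full (Qp xs l.+1 : S^o -> Prop).
  by rewrite Qp_nil; apply/acycP/(Ext_acyc FR); apply: extNS.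
have acN i : (N0 <= i)%N -> coh0 D i full (Qp xs l.+1 : N -> Prop).
  by move=> Ni; rewrite Qp_nil; apply/acycP/(Ext_acyc FR); apply: extNN; apply: leqW.
have fS : fin_gen S^o.
  apply/fin_gen_span; exists [:: 1 : S^o] => y; exists y, 0; split=> //.
  by rewrite addr0; exact/esym/mulr1.
(* First use of the length argument, with X = S: the dual of F/QF becomes exact, and duality over
   [A] makes F/QF exact. *)
have cS i : coh0 D i full (Qp xs 1 : S^o -> Prop).
  exact: (coh0_residue cD nS (i0 := 0) fS qS lx).
have ex1 : row_exact_mod D xs 1 by apply: (row_exact_mod_dual psi_surj psi_ker).
(* Exactness modulo Q spreads to exactness modulo Q^j, through which N inherits quasi-regularity
   from S. *)
have exj := row_exact_modP cD (l := l.+1) (fun j jl => qS jl) ex1.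
have qN j : (j <= l)%N -> quasi_regular N xs j.
  move=> jl; apply: (quasi_regular_coker cD (fr_surj FR) (fr_ker FR)) => //.
    exact: qS.
  by apply: exj; apply: leqW.
have [Y [eps' [FR' acY]]] := reduction_free_res psi_surj psi_ker FR ex1.
case=> // i _; apply/(Ext_acyc FR)/acycP; rewrite -Qp_nil.
(* N is filtered by copies of N/QN, so the conclusion of (SAC) over [A] for N/QN is enough. *)
apply: kills_coh0; apply: kills_quot => //; apply: coh0_kills.
apply/acY; apply/(Ext_acyc FR'); apply: sA => //.
- exact: free_res_fin_gen FR'.
- by case=> // j _; apply/(Ext_acyc FR')/(acyc_base psi_surj psi_ker).
(* Second use of the length argument, with X = N, in the degrees where Ext(N, N) vanishes. *)
exists N0.+1; case=> // j Nj; apply/(Ext_acyc FR')/acY.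
exact: (coh0_residue cD nS (i0 := N0) fN qN lx).
Qed.

End Truncation.

(** * Quotient rings of R by the ideals of a regular sequence *)

Section Quotients.
Variable R : comPzRingType.

Lemma noetherian_quotient (B B' : comPzRingType) (phi : {rmorphism B -> B'}) :
  surjective phi -> noetherian B -> noetherian B'.
Proof.
move=> ps nB I.
have sU : submod (fun a : B^o => phi a \in I).
  split; first by rewrite rmorph0 rpred0.
  by move=> a u v Iu Iv; rewrite rmorphD rmorphM; apply: rpredD => //; apply: ideal_mull.
have [s [sU' Us]] := noeth_reg nB sU.
exists [seq phi a | a <- s] => b; have [a <-] := ps b; apply/idP/idP => [/Us sa|].
  apply/ideal_genP; elim: s a sa {sU' Us} => [a ->|z s IH a [c [u [su ->]]]] /=.
    by rewrite rmorph0.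
  by exists (phi c), (phi u); rewrite rmorphD rmorphM; split=> //; apply: IH.
move/ideal_genP; apply: (span_sub (U := fun b : B'^o => b \in I)).
  by split=> [|a' u v Iu Iv]; [exact: rpred0|apply: rpredD => //; apply: ideal_mull].
by move=> _ /mapP[z zs ->]; apply: sU'.
Qed.

Lemma Qs_ideal (s : seq R) (a : R) : a \in ideal_gen s <-> Qs s full (a : R^o).
Proof.
rewrite ideal_genP; split.
  apply: span_sub => [|z zs]; first by apply: Qs_submod; apply: full_submod.
  by rewrite -[z]mulr1; apply: Qs_mem.
apply: Qs_min => [|x u xs _]; first exact: span_submod.
have -> : x *: (u : R^o) = u *: (x : R^o) by rewrite /GRing.scale /= mulrC.
exact/(submodZ (span_submod _))/span_mem.
Qed.

Lemma Qs_ideal_rev (s : seq R) (a : R) : a \in ideal_gen s <-> Qp (rev s) 1 (a : R^o).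
Proof.
rewrite Qs_ideal; split; apply: Qs_sub_seq => //; first by move=> z; rewrite mem_rev.
by move=> z; rewrite mem_rev.
Qed.

Lemma Qp_ideal_exp (s : seq R) l (a : R) :
  a \in ideal_exp (ideal_gen s) l <-> Qp s l (a : R^o).
Proof.
elim: l a => [|l IH] a; first by split.
split.
  move=> /asboolP[t tP ->]; elim: t tP => [_|p t IHt tP].
    by rewrite big_nil; exact: (submod0 (Qp_submod _ _)).
  rewrite big_cons; apply: (submodD (Qp_submod _ _)); last first.
    by apply: IHt => q qt; apply: tP; rewrite inE qt orbT.
  have [p1 /IH p2] := tP p (mem_head _ _); move/ideal_genP/spanP: p1 => [c ->].
  rewrite mulr_suml; apply: (submod_sum (Qp_submod s l.+1)) => i _.
  have -> : c i *: (s`_i : R^o) * p.2 = s`_i *: (c i *: (p.2 : R^o)).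
    by rewrite /GRing.scale /= mulrAC mulrC mulrA.
  apply: Qs_mem; [exact: Qp_submod|exact: mem_nth|].
  exact: (submodZ (Qp_submod _ _)).
apply: (Qs_min (V := fun a : R^o => a \in ideal_exp (ideal_gen s) l.+1)) => [|x u xs /IH Iu].
  split; first exact: rpred0.
  by move=> b u v Iu Iv; apply: rpredD => //; apply: ideal_mull.
apply/asboolP; exists [:: (x, u)] => [p|]; last by rewrite big_seq1.
by rewrite inE => /eqP->; split=> //=; apply/ideal_genP/span_mem.
Qed.

Lemma quotient_surj (I : idealType R) : surjective (quotient_map I).
Proof. by move=> q; have [a <-] := quotient_map_surj q; exists a. Qed.

Lemma quotient_factor (I J : idealType R) : {subset I <= J} ->
  exists psi : {rmorphism ideal_quotient I -> ideal_quotient J},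
    forall a, psi (quotient_map I a) = quotient_map J a.
Proof.
move=> IJ; pose f (q : ideal_quotient I) : ideal_quotient J := quotient_map J (repr q).
have fE a : f (quotient_map I a) = quotient_map J a.
  apply/eqP; rewrite -subr_eq0 -rmorphB; apply/eqP/quotient_map_eq0/IJ/quotient_map_eq0.
  by rewrite rmorphB /= {1}/quotient_map reprK subrr.
have fz : zmod_morphism f.
  move=> p q; have [a <-] := quotient_map_surj p; have [b <-] := quotient_map_surj q.
  by rewrite -rmorphB !fE rmorphB.
have fm : monoid_morphism f.
  split=> [|p q]; first by rewrite -[1](rmorph1 (quotient_map I)) fE rmorph1.
  have [a <-] := quotient_map_surj p; have [b <-] := quotient_map_surj q.
  by rewrite -rmorphM !fE rmorphM.
pose psi : {rmorphism ideal_quotient I -> ideal_quotient J} := HB.pack f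
  (GRing.isZmodMorphism.Build _ _ f fz) (GRing.isMonoidMorphism.Build _ _ f fm).
by exists psi.
Qed.

Section RegularSequence.
Variables (m : idealType R) (n : nat) (x : n.-tuple R).
Hypotheses (nR : noetherian R) (rx : regular_sequence m x).

Let nz (I : idealType R) : noetherian (ideal_quotient I).
Proof. exact: noetherian_quotient (@quotient_surj I) nR. Qed.

Lemma regular_next k a : (k < n)%N ->
  x`_k * a \in ideal_gen (take k x) -> a \in ideal_gen (take k x).
Proof.
move=> kn /quotient_map_eq0; rewrite rmorphM => h; apply/quotient_map_eq0.
by apply: (rx.2 k kn); rewrite mulr0.
Qed.

Lemma weakly_regular_rev k : (k <= n)%N -> weakly_regular R^o (rev (take k x)).
Proof.
elim: k => [|k IH] kn; first by rewrite take0.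
rewrite (take_nth 0) ?size_tuple // rev_rcons; split; last exact/IH/ltnW.
by move=> a /(Qs_ideal_rev _ _)/(regular_next kn)/Qs_ideal_rev.
Qed.

(* Propagates F along R -> R/(x_1) -> R/(x_1, x_2) -> ... *)
Lemma hypersurface_chain (F : comPzRingType -> Prop) :
  (forall (B B' : comPzRingType) (phi : {rmorphism B -> B'}) y, surjective phi ->
     (forall a, phi a = 0 <-> exists b, a = y * b) ->
     (forall a, y * a = 0 -> a = 0) -> noetherian B' -> F B -> F B') ->
  F R -> forall k, (k < n)%N -> F (ideal_quotient (ideal_gen (take k.+1 x))).
Proof.
move=> step FR; elim=> [|k IH] kn.
  (* The chain starts at R itself, not at its quotient by the zero ideal. *)
  apply: (step R _ (quotient_map (ideal_gen (take 1 x))) x`_0) => //.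
  - exact: quotient_surj.
  - move=> a; rewrite quotient_map_eq0 Qs_ideal_rev (take_nth 0) ?size_tuple // take0.
    split=> [[u [v [_ -> ->]]]|[b ->]]; first by exists u; rewrite addr0.
    by exists b, 0; rewrite addr0.
  - move=> a xa; have /ideal_genP : a \in ideal_gen (take 0 x).
      by apply: regular_next => //; rewrite xa rpred0.
    by rewrite take0.
  - exact: nz.
pose I := ideal_gen (take k.+1 x) : idealType R.
pose J := ideal_gen (take k.+2 x) : idealType R.
have JP a : a \in J <-> exists u v, v \in I /\ a = x`_k.+1 * u + v.
  rewrite /J Qs_ideal_rev (take_nth 0) ?size_tuple // rev_rcons.
  split=> [[u [v [_ Iv ->]]]|[u [v [Iv ->]]]].
    by exists u, v; split=> //; apply/Qs_ideal_rev.
  by exists u, v; split=> //; apply/Qs_ideal_rev.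
have IJ : {subset I <= J} by move=> a Ia; apply/JP; exists 0, a; rewrite mulr0 add0r.
have [psi psiE] := quotient_factor IJ.
apply: (step _ _ psi (quotient_map I x`_k.+1)); [| | |exact: nz|exact: IH (ltnW kn)].
- by move=> q; have [a <-] := quotient_map_surj q; exists (quotient_map I a).
- move=> q; have [a <-] := quotient_map_surj q; rewrite psiE quotient_map_eq0 JP.
  split=> [[u [v [Iv ->]]]|[b]].
    exists (quotient_map I u); rewrite rmorphD rmorphM /=.
    by rewrite (quotient_map_eq0 I v).2 ?addr0.
  have [u <-] := quotient_map_surj b; rewrite -rmorphM => e.
  exists u, (a - x`_k.+1 * u); split; last by rewrite addrC subrK.
  by apply/quotient_map_eq0; rewrite rmorphB /= e subrr.
move=> q; have [a <-] := quotient_map_surj q; rewrite -rmorphM.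
by move=> /quotient_map_eq0/(regular_next kn)/quotient_map_eq0.
Qed.

Hypothesis lm : is_local m.
Hypothesis deR : dual_exact R.
Hypothesis n0 : (0 < n)%N.

Let Q : idealType R := ideal_gen x.
Let xs := rev x.

Let deQ k : (k < n)%N -> dual_exact (ideal_quotient (ideal_gen (take k.+1 x))).
Proof.
apply: (hypersurface_chain (F := dual_exact)) => // B B' phi y ps pk yr nB'.
exact: (dual_exact_quot ps pk).
Qed.

Let take_all : take n x = x. Proof. by rewrite take_oversize ?size_tuple. Qed.

Let deA : dual_exact (ideal_quotient Q).
Proof. by have := @deQ n.-1; rewrite prednK // take_all; apply. Qed.

Let wxs : weakly_regular R^o xs.
Proof. by have := weakly_regular_rev (leqnn n); rewrite take_all. Qed.

Let kerQ l a : quotient_map (ideal_exp Q l) a = 0 <-> Qp xs l (a : R^o).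
Proof.
rewrite quotient_map_eq0 Qp_ideal_exp.
by split; apply: Qp_sub_seq => z; rewrite mem_rev.
Qed.

Lemma SAC_residue : SAC R -> SAC (ideal_quotient Q).
Proof.
move=> sR; have := hypersurface_chain (F := SAC) _ sR (k := n.-1).
rewrite prednK // take_all; apply=> //.
by move=> B B' phi y ps pk yr nB'; apply: (SAC_hypersurface ps pk).
Qed.

Lemma SAC_of_power l : (0 < l)%N -> SAC (ideal_quotient (ideal_exp Q l)) -> SAC R.
Proof.
case: l => // l _.
apply: (SAC_ascent nR lm _ wxs (@quotient_surj _) (kerQ l.+1)).
  by move=> z; rewrite mem_rev; apply: rx.1.
(* For the empty segment, exactness modulo 0 is exactness of F. *)
move=> r D cD eD ys t e h; case: t e h => [_ _|y t e h].
  by move=> i v v0; have [|w ->] := eD i v; [exact: v0|exists w; rewrite subrr].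
(* A nonempty suffix of the reversed sequence is a reversed initial segment, over whose quotient
   duality holds. *)
have [k kn tE] : exists2 k, (k < n)%N & y :: t = rev (take k.+1 x).
  have sx : size xs = n by rewrite size_rev size_tuple.
  exists (size t); first by rewrite -[X in (_ < X)%N]sx e size_cat /= addnS ltnS leq_addl.
  have := congr1 rev e; rewrite revK rev_cat => ->.
  by rewrite take_cat size_rev ltnn subnn take0 cats0 revK.
rewrite tE in h *.
apply: (row_exact_mod_dual (@quotient_surj _)) (deQ kn) cD h => a.
by rewrite quotient_map_eq0 Qs_ideal_rev.
Qed.

Lemma SAC_power l : (0 < l <= n)%N -> SAC (ideal_quotient Q) ->
  SAC (ideal_quotient (ideal_exp Q l)).
Proof.
case: l => // l /= ln sA.
pose phi : {rmorphism R -> ideal_quotient (ideal_exp Q l.+1)} := quotient_map _.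
have QlQ : {subset ideal_exp Q l.+1 <= Q}.
  by move=> a /Qp_ideal_exp h; apply/Qs_ideal; apply: (Qp_le (xs := x) (i := 1) _ h).
have [psi psiE] := quotient_factor QlQ.
have phi_surj : surjective phi by apply: quotient_surj.
have phiL := rmorph_semilinear phi.
pose ys := [seq phi z | z <- xs].
(* Membership in Q^j with j <= l + 1 can be tested modulo Q^(l+1). Quasi-regularity in degree j
   involves Q^(j+1), hence transfers to the quotient for j <= l. *)
have QphiP j (b : R) : (j <= l.+1)%N ->
    Qp ys j (phi b : (ideal_quotient (ideal_exp Q l.+1))^o) <-> Qp xs j (b : R^o).
  move=> jl; split=> [|h]; last exact: (semilinear_Qp phiL).
  move=> /(semilinear_Qp_lift phiL phi_surj)[u [Qu uE]].
  rewrite -[b](subrK u); apply: (submodD (Qp_submod xs j)) => //.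
  by apply: Qp_le jl _ _; apply/kerQ; rewrite rmorphB -[X in X - _]uE subrr.
apply: (SAC_truncation (psi := psi) (xs := ys) (l := l)) sA => //.
- exact: nz.
- by move=> q; have [a <-] := quotient_map_surj q; exists (phi a); apply: psiE.
- move=> q; have [a <-] := quotient_map_surj q; rewrite psiE -/phi QphiP //.
  by rewrite quotient_map_eq0 Qs_ideal_rev.
- by rewrite size_map size_rev size_tuple.
- move=> j jl c; have /choice[c' c'P] : forall i, exists a, phi a = c i.
    by move=> i; apply: phi_surj.
  have -> : comb (mons ys j) c = phi (comb (mons xs j) (c' : nat -> R^o)).
    rewrite /comb map_mons size_map [RHS](semilinear_sum phiL); apply: eq_bigr => i _.
    by rewrite (nth_map 0) // -c'P -(semilinearZ phiL).
  move=> /QphiP h i; rewrite map_mons size_map => ij; rewrite -c'P.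
  by apply/(QphiP 1) => //; apply: (weakly_regular_quasi wxs (h _)).
- move=> w; rewrite map_mons => /mapP[w' w'l ->]; apply/kerQ.
  by rewrite -[w']mulr1; apply: Qp_mem.
Qed.

End RegularSequence.
End Quotients.

Theorem theorem4p8 (R : comPzRingType) (m : idealType R) (n : nat)
    (x : n.-tuple R) :
  gorenstein_local m -> (0 < n)%N -> regular_sequence m x ->
  let Q : idealType R := ideal_gen x in
  [<-> SAC R;
       SAC (ideal_quotient Q);
       exists l : nat, (0 < l)%N /\ SAC (ideal_quotient (ideal_exp Q l));
       forall l : nat, (1 <= l <= n)%N -> SAC (ideal_quotient (ideal_exp Q l))].
Proof.
move=> [nR lm iR] n0 rx Q.
have deR : dual_exact R by move=> r D cD eD; apply: finite_inj_dim_row_exact.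
have AtoP := SAC_power nR rx deR n0.
split; first exact: (SAC_residue nR rx).
(* The first power is formally the product of Q with the unit ideal, so even exponent 1 goes through
   [SAC_power]. *)
split; first by move=> sA; exists 1%N; split=> //; apply: AtoP.
split=> [[k [k0 sk]] l ln|h].
  (* From R/Q^k up to R, down to R/Q, and from there to R/Q^l. *)
  by apply: AtoP => //; apply: (SAC_residue nR rx n0); apply: (SAC_of_power nR rx lm deR k0 sk).
by apply: (SAC_of_power nR rx lm deR (l := 1)) => //; apply: h; rewrite n0.
Qed.
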